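(* Let $(G_t)_{t\in T}$ be an admissible family of strictly pseudoconvex domains in $\mathbb{C}^n$ (in the sense defined in the context). Let $\varepsilon>0$. Then there exist constants $C>0$ and $\delta>0$ such that for every $t\in T$ and every $\zeta,\xi\in\partial G_t$ with $\|\zeta-\xi\|\geq\varepsilon$, we have $$\boldsymbol{k}_{G_t}(z,w)\geq-\frac{1}{2}\log\mathrm{dist}(z,\partial G_t)-\frac{1}{2}\log\mathrm{dist}(w,\partial G_t)-C$$ whenever $z\in G_t\cap\mathbb{B}(\zeta,\delta)$ and $w\in G_t\cap\mathbb{B}(\xi,\delta)$. In particular, if $(G_j)_{j\in\mathbb{N}}$ is a sequence of strictly pseudoconvex domains with $\mathcal{C}^2$-smooth boundaries such that $G_j$ converges to $G$, a strictly pseudoconvex domain with $\mathcal{C}^2$-smooth boundary, with respect to the $\mathcal{C}^2$ topology on domains, and if $\varepsilon>0$ is given, then there exist constants $C>0$ and $\delta>0$ such that for every $j\in\mathbb{N}$ and every $\zeta,\xi$, different points from $\partial G_j$ or from $\partial G$, such that $\|\zeta-\xi\|\geq\varepsilon$, we have $$\boldsymbol{k}_{G_j}(z,w)\geq-\frac{1}{2}\log\mathrm{dist}(z,\partial G_j)-\frac{1}{2}\log\mathrm{dist}(w,\partial G_j)-C$$ whenever $z\in G_j\cap\mathbb{B}(\zeta,\delta)$ and $w\in G_j\cap\mathbb{B}(\xi,\delta)$.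
   Context: Notation: $\mathbb{B}(\zeta,r)$ is the open Euclidean ball in $\mathbb{C}^n$; $\mathbb{D}$ is the open unit disc in $\mathbb{C}$; $\mathrm{dist}$ is Euclidean distance; $\mathcal{O}(\mathbb{D},G)$ is the set of holomorphic maps $\mathbb{D}\to G$; $A\subset\subset B$ means that $A$ is relatively compact in $B$. $\boldsymbol{p}$ is the Poincaré distance on $\mathbb{D}$, normalized so that $\boldsymbol{p}(0,\lambda)=\frac12\log\frac{1+|\lambda|}{1-|\lambda|}$. The Kobayashi pseudodistance of a domain $G$ is $$\boldsymbol{k}_G(z,w):=\inf\Big\{\sum_{j=1}^N\boldsymbol{p}(\xi_j,\zeta_j)\Big\},\quad z,w\in G,$$ the infimum being over all $N\in\mathbb{N}$, $\xi_j,\zeta_j\in\mathbb{D}$, such that there exist $p_0,\ldots,p_N\in G$ with $p_0=z$, $p_N=w$ and $f_j\in\mathcal{O}(\mathbb{D},G)$ with $f_j(\xi_j)=p_{j-1}$, $f_j(\zeta_j)=p_j$, $j=1,\ldots,N$. Strictly pseudoconvex domain: a bounded domain $G\subset\mathbb{C}^n$ for which there exist a neighborhood $U$ of $\partial G$ and a defining function $r:U\to\mathbb{R}$ of class $\mathcal{C}^2$, i.e. (I) $G\cap U=\{z\in U:r(z)<0\}$, (II) $(\mathbb{C}^n\setminus\overline{G})\cap U=\{z\in U:r(z)>0\}$, (III) $\nabla r(z):=\left(\frac{\partial r}{\partial\bar z_1}(z),\ldots,\frac{\partial r}{\partial\bar z_n}(z)\right)\neq 0$ for $z\in\partial G$,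 and such that $\mathcal{L}_r(z;X)>0$ for $z\in\partial G$ and nonzero $X$ in the complex tangent space $T_z^{\mathbb{C}}(\partial G)$, where $\mathcal{L}_r(z;X)=\sum_{j,k}\frac{\partial^2 r}{\partial z_j\partial\bar z_k}(z)X_j\overline{X_k}$ is the Levi form. Admissible family: $(G_t)_{t\in T}$ is a family of bounded strictly pseudoconvex domains in $\mathbb{C}^n$ with $\mathcal{C}^2$-smooth boundaries, where $T$ is a compact metric space with metric $d$, and there is a domain $U\subset\subset\mathbb{C}^n$ such that (i) $\bigcup_{t\in T}\partial G_t\subset\subset U$; (ii) for each $t\in T$ there exists a defining function $r_t\in\mathcal{C}^2(U)$ for $G_t$ (satisfying (I)–(III) on $U$) whose Levi form $\mathcal{L}_{r_t}$ is positive on $U\times(\mathbb{C}^n\setminus\{0\})$; (iii) for any $\varepsilon>0$ there exists a $\delta>0$ such that $\|r_t-r_s\|_{\mathcal{C}^2(U)}<\varepsilon$ for any $s,t\in T$ with $d(s,t)\leq\delta$. Convergence $G_j\to G$ in the $\mathcal{C}^2$ topology on domains means: there are a bounded open set $U\subset\mathbb{C}^n$ and $j_0$ with $\partial G\cup\bigcup_{j\ge j_0}\partial G_j\subset\subset U$, and $\mathcal{C}^2$ defining functions $r$ of $G$ and $r_j$ of $G_j$ ($j\ge j_0$) on $U$ with $\|r_j-r\|_{\mathcal{C}^2(U)}\to0$. *)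

(* Defs.v *)
(* C^n is 'rV[R[i]]_n, for an arbitrary R : realType. Its library topology comes
   from the sup norm and is the Euclidean one; Euclidean norms, balls and
   distances are defined explicitly below. *)
From HB Require Import structures.
From mathcomp Require Export all_boot all_order all_algebra complex.
From mathcomp Require Export all_classical all_reals all_analysis.
Export numFieldNormedType.Exports.

#[export] Set Implicit Arguments.
#[export] Unset Strict Implicit.
#[export] Unset Printing Implicit Defensive.

Import Order.TTheory GRing.Theory Num.Theory.

Local Open Scope classical_set_scope.
Local Open Scope ring_scope.
Local Open Scope complex_scope.

(* The library puts the topology and norm of a field K on K^o, and on K itself
   only when K is an abstract structure; R[i] needs its own copy. *)
HB.instance Definition _ (R : rcfType) := NormedModule.copy R[i] R[i]^o.

Section EuclideanGeometry.
Context {R : realType} {n : nat}.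
Implicit Types (z w : 'rV[R[i]]_n) (A B : set 'rV[R[i]]_n).

Definition cmod (c : R[i]) : R := complex.Re `|c|.

Definition enorm z : R := Num.sqrt (\sum_(k < n) cmod (z ord0 k) ^+ 2).

Definition eball z (r : R) : set 'rV[R[i]]_n := [set w | enorm (w - z) < r].

Definition dist_to z A : R := inf [set enorm (z - w) | w in A].

Definition boundary A : set 'rV[R[i]]_n := closure A `\` interior A.

Definition domain A : Prop := [/\ A !=set0, open A & connected A].

Definition relatively_compact_in A B : Prop := precompact A /\ closure A `<=` B.

End EuclideanGeometry.

Section Kobayashi.
Context {R : realType} {n : nat}.

Definition unit_disc : set R[i] := [set c | cmod c < 1].

Definition poincare_distance (a b : R[i]) : R :=
  let m := cmod ((a - b) / (1 - b^* * a)) in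
  2^-1 * ln ((1 + m) / (1 - m)).

(* [derivable f a 1] is over the field R[i]: complex differentiability at a.
   Only the values of f on the disc matter. *)
Definition holomorphic_disc (G : set 'rV[R[i]]_n) (f : R[i] -> 'rV[R[i]]_n) :=
  forall a, unit_disc a -> derivable f a 1 /\ G (f a).

Definition kobayashi_chain (G : set 'rV[R[i]]_n) (z w : 'rV[R[i]]_n) (N : nat)
    (p : nat -> 'rV[R[i]]_n) (f : nat -> R[i] -> 'rV[R[i]]_n)
    (xi zeta : nat -> R[i]) : Prop :=
  [/\ (0 < N)%N, p 0%N = z, p N = w, (forall j, (j <= N)%N -> G (p j)) &
      forall j, (j < N)%N ->
        [/\ holomorphic_disc G (f j), unit_disc (xi j), unit_disc (zeta j),
            f j (xi j) = p j & f j (zeta j) = p j.+1]].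

(* An extended real; finite on a domain, where chains always exist. *)
Definition kobayashi (G : set 'rV[R[i]]_n) (z w : 'rV[R[i]]_n) : \bar R :=
  ereal_inf [set s | exists N p f xi zeta, kobayashi_chain G z w N p f xi zeta /\
    s = (\sum_(j < N) poincare_distance (xi j) (zeta j))%:E].

End Kobayashi.

Section RealPartials.
Context {R : realType} {n : nat}.
Implicit Types (v z X : 'rV[R[i]]_n) (u : 'rV[R[i]]_n -> R).

Definition line_restriction v u z : R -> R := fun t => u (z + t%:C *: v).

Definition pderivable v u z : Prop := derivable (line_restriction v u z) 0 1.

Definition pderiv v u z : R := derive1 (line_restriction v u z) 0.

(* The 2n real coordinate directions: (k, false) is d/dx_k, (k, true) d/dy_k. *)
Definition real_dir (a : 'I_n * bool) : 'rV[R[i]]_n :=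
  (if a.2 then 'i else 1) *: delta_mx ord0 a.1.

Local Notation pd a := (pderiv (real_dir a)).

Definition C2_on (U : set 'rV[R[i]]_n) u : Prop :=
  forall z, U z ->
  [/\ {for z, continuous u},
      (forall a, pderivable (real_dir a) u z /\ {for z, continuous (pd a u)}) &
      forall a b, pderivable (real_dir b) (pd a u) z /\
                  {for z, continuous (pd b (pd a u))}].

(* Supremum over U of all partial derivatives of order at most 2; possibly +oo. *)
Definition C2_norm (U : set 'rV[R[i]]_n) u : \bar R :=
  ereal_sup [set s | exists2 z, U z &
    [\/ s = `|u z|%:E, (exists a, s = `|pd a u z|%:E) |
        exists a b, s = `|pd b (pd a u) z|%:E]].

(* Wirtinger derivatives of complex-valued functions. *)
Definition pderivC v (g : 'rV[R[i]]_n -> R[i]) z : R[i] :=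
  pderiv v (fun x => complex.Re (g x)) z +i* pderiv v (fun x => complex.Im (g x)) z.

Definition d_dz (k : 'I_n) (g : 'rV[R[i]]_n -> R[i]) z : R[i] :=
  2^-1 * (pderivC (real_dir (k, false)) g z - 'i * pderivC (real_dir (k, true)) g z).

Definition d_dzbar (k : 'I_n) (g : 'rV[R[i]]_n -> R[i]) z : R[i] :=
  2^-1 * (pderivC (real_dir (k, false)) g z + 'i * pderivC (real_dir (k, true)) g z).

Definition gradient (r : 'rV[R[i]]_n -> R) z : 'rV[R[i]]_n :=
  \row_k d_dzbar k (fun x => (r x)%:C) z.

(* As r is real and C^2 this is a real number; in R[i], [0 < c] means that c is
   real and positive. *)
Definition levi_form (r : 'rV[R[i]]_n -> R) (z X : 'rV[R[i]]_n) : R[i] :=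
  \sum_(j < n) \sum_(k < n)
    d_dz j (d_dzbar k (fun x => (r x)%:C)) z * X ord0 j * (X ord0 k)^*.

Definition complex_tangent (r : 'rV[R[i]]_n -> R) z : set 'rV[R[i]]_n :=
  [set X | \sum_(j < n) d_dz j (fun x => (r x)%:C) z * X ord0 j = 0].

End RealPartials.

Section Pseudoconvexity.
Context {R : realType} {n : nat}.
Implicit Types (G U : set 'rV[R[i]]_n) (r : 'rV[R[i]]_n -> R).

Definition C2_defining_function G U r : Prop :=
  (open U /\ boundary G `<=` U) /\
  [/\ C2_on U r,
      G `&` U = [set z | U z /\ r z < 0],
      ~` closure G `&` U = [set z | U z /\ 0 < r z] &
      forall z, boundary G z -> gradient r z != 0].

(* The C^2 defining function with nonzero gradient makes the boundary C^2-smooth,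
   so this smoothness is not a separate hypothesis. *)
Definition strictly_pseudoconvex G : Prop :=
  [/\ domain G, bounded_set G &
      exists U r, C2_defining_function G U r /\
        forall z (X : 'rV[R[i]]_n), boundary G z -> X != 0 -> complex_tangent r z X ->
          0 < levi_form r z X].

Definition admissible_family (T : metricType R) (G : T -> set 'rV[R[i]]_n) : Prop :=
  [/\ compact [set: T],
      (forall t, strictly_pseudoconvex (G t)) &
      exists U, [/\ domain U, relatively_compact_in U [set: 'rV[R[i]]_n],
        relatively_compact_in (\bigcup_t boundary (G t)) U &
        exists r : T -> 'rV[R[i]]_n -> R,
          (forall t, C2_defining_function (G t) U (r t) /\
             forall z (X : 'rV[R[i]]_n), U z -> X != 0 -> 0 < levi_form (r t) z X) /\
          forall eps : R, 0 < eps -> exists2 delta : R, 0 < delta &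
            forall s t, mdist s t <= delta ->
              (C2_norm U (fun z => r t z - r s z)%R < eps%:E)%E]].

Definition C2_converges (Gs : nat -> set 'rV[R[i]]_n) G : Prop :=
  exists U (j0 : nat), [/\ open U, bounded_set U,
    relatively_compact_in
      (boundary G `|` \bigcup_(j in [set j | (j0 <= j)%N]) boundary (Gs j)) U &
    exists r (rs : nat -> 'rV[R[i]]_n -> R),
      [/\ C2_defining_function G U r,
          (forall j, (j0 <= j)%N -> C2_defining_function (Gs j) U (rs j)) &
          C2_norm U (fun z => rs j z - r z) @[j --> \oo] --> 0%E]].

End Pseudoconvexity.

(* Main.v *)
Require Import Defs.
From mathcomp Require Import ring lra.
Import Order.TTheory GRing.Theory Num.Theory.
Local Open Scope classical_set_scope.
Local Open Scope ring_scope.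
Local Open Scope complex_scope.
Local Notation "z ^*" := (conjc z) : ring_scope.

(** Each boundary point repels the Kobayashi distance with the weight
    [- 2^-1 * ln dist]; the theorem says that two separated boundary points repel
    independently, with constants that depend only on second-order data of the
    defining functions. The proof builds, for a point [z] of [G], a real function
    [th] which is 1-Lipschitz for the Kobayashi distance, vanishes away from [z],
    and is at most [2^-1 * ln (dist z) + C] at [z].  For [z] and [w] with
    [eps <= |z - w|] the functions attached to [z] and [w] have disjoint supports, so
    their difference is still 1-Lipschitz, and comparing its values at [z] and [w]
    is the asserted inequality ([localized_barrier], [disc_lipschitz_sub],
    [kobayashi_lower_bound]).  The points [zeta] and [xi] serve only to keep [z] and
    [w] apart.

    Being Lipschitz for the Kobayashi distance is tested on discs: if the composite
    of [th] with every holomorphic disc in [G] has slope at most 1 at the centre,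
    then Moebius maps carry this to every point of every disc, integration along
    Poincare geodesics gives the bound for one disc, and summation the bound for
    chains ([kobayashi_ge]).

    The function [th] comes from a peak function [g] at a boundary point [zeta]:
    [g] is holomorphic near [zeta] and [Re g] lies between multiples of
    [|p - zeta|^2] and [|p - zeta|] on [G].  It is the polynomial [P - 4 K P^2], with
    [P] the Levi polynomial of a defining function [r]; Taylor's formula and strict
    pseudoconvexity in the quantitative form
    [c |X|^2 <= Levi (X) + c^-1 |d r (X)|^2] give the lower bound, at a scale that is
    uniform for boundary points in a compact set and for functions C^2-close to
    [r] ([peak_of_data], [uniform_peaks]).

    The peak function is only local, so discs that wander far from [zeta] must be
    controlled.  Cutting [Re g] off at a level [m] gives a function [V] on all of [G]
    that is superharmonic along every disc [f] and dominates a multiple of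
    [|p - zeta|^2].  An explicit harmonic minorant of [|f - zeta|^2], built from the
    Szego kernel, and the maximum principle bound
    [|f l - zeta|^2 (1 - |l|^2)] by [A * V (f 0)] ([hardy_bound]).  Hence [f] stays
    near [zeta] on a disc of radius [1 - M u], where [u = V (f 0)], and there
    [Re g o f] is positive, so its derivative at 0 is at most [2 u / (1 - M u)]
    ([positive_real_part_deriv_scaled]).  The function
    [phi s = 2^-1 * (ln s - M s)] has derivative [(1 - M s) / (2 s)], which
    compensates this exactly; [th] is [phi o V] cut off at a level [m']
    ([barrier_disc], [peak_barrier]).

    The one-variable theory rests on complex differentiability at each point alone:
    Goursat's bisection, applied to functions composed with the exponential, gives
    mean values over circles and with them the maximum principle.

    In the second part the Levi condition is given for one defining function of
    the limit domain and the C^2 convergence for another; strict pseudoconvexity is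
    carried from one to the other by comparing signs along the curves
    [z + t Y + t^2 b nu] ([levi_positive_transfer]).  For large [j] the constants are
    uniform; each of the finitely many other domains has its own constant. *)

(** * Moduli and complex differentiability *)
Section CmodTheory.
Context {R : realType}.
Implicit Types (a b c z w : R[i]) (x y e : R).

Lemma cmodE z : cmod z = Num.sqrt (complex.Re z ^+ 2 + complex.Im z ^+ 2).
Proof. by rewrite /cmod normc_def. Qed.

Lemma normC_cmod z : `|z| = (cmod z)%:C.
Proof. by rewrite /cmod normc_def. Qed.

Lemma cmod_ge0 z : 0 <= cmod z. Proof. by rewrite cmodE sqrtr_ge0. Qed.

Lemma cmod0 : cmod (0 : R[i]) = 0. Proof. by rewrite /cmod normr0. Qed.
Lemma cmod1 : cmod (1 : R[i]) = 1. Proof. by rewrite /cmod normr1. Qed.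

Lemma cmodM z w : cmod (z * w) = cmod z * cmod w.
Proof. by apply: complexI; rewrite rmorphM /= -!normC_cmod normrM. Qed.

Lemma cmodN z : cmod (- z) = cmod z.
Proof. by rewrite /cmod normrN. Qed.

Lemma cmodB z w : cmod (z - w) = cmod (w - z).
Proof. by rewrite /cmod distrC. Qed.

Lemma cmodD z w : cmod (z + w) <= cmod z + cmod w.
Proof. by rewrite -lecR rmorphD /= -!normC_cmod ler_normD. Qed.

Lemma cmod_eq0 z : (cmod z == 0) = (z == 0).
Proof.
by rewrite -[z == 0]normr_eq0 normC_cmod; apply/eqP/eqP => [->//|/complexI].
Qed.

Lemma cmod_gt0 z : (0 < cmod z) = (z != 0).
Proof. by rewrite lt_def cmod_eq0 cmod_ge0 andbT. Qed.

Lemma cmodV z : cmod z^-1 = (cmod z)^-1.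
Proof. by apply: complexI; rewrite fmorphV /= -!normC_cmod normfV. Qed.

Lemma cmod_conj z : cmod z^* = cmod z.
Proof. by rewrite /cmod normcJ. Qed.

Lemma cmodR x : cmod x%:C = `|x|.
Proof. by rewrite cmodE /= expr0n /= addr0 sqrtr_sqr. Qed.

Lemma cmod_sqr z : cmod z ^+ 2 = complex.Re z ^+ 2 + complex.Im z ^+ 2.
Proof. by rewrite cmodE sqr_sqrtr // addr_ge0 // sqr_ge0. Qed.

Lemma mulcJ z : z * z^* = (cmod z ^+ 2)%:C.
Proof. by rewrite -sqr_normc normC_cmod rmorphXn. Qed.

Lemma Re_le_cmod z : `|complex.Re z| <= cmod z.
Proof. by rewrite cmodE -sqrtr_sqr ler_wsqrtr // lerDl sqr_ge0. Qed.

Lemma Im_le_cmod z : `|complex.Im z| <= cmod z.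
Proof. by rewrite cmodE -sqrtr_sqr ler_wsqrtr // lerDr sqr_ge0. Qed.

Lemma cmod_le_ReIm z : cmod z <= `|complex.Re z| + `|complex.Im z|.
Proof.
rewrite -(@ler_pXn2r _ 2) ?nnegrE ?cmod_ge0 ?addr_ge0 // cmod_sqr sqrrD.
by rewrite !real_normK ?num_real // lerD2r lerDl mulrn_wge0 // mulr_ge0.
Qed.

Lemma cReD z w : complex.Re (z + w) = complex.Re z + complex.Re w.
Proof. by case: z w => [? ?] [? ?]. Qed.
Lemma cImD z w : complex.Im (z + w) = complex.Im z + complex.Im w.
Proof. by case: z w => [? ?] [? ?]. Qed.
Lemma cReN z : complex.Re (- z) = - complex.Re z.
Proof. by case: z. Qed.
Lemma cImN z : complex.Im (- z) = - complex.Im z.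
Proof. by case: z. Qed.
Lemma cReM z w : complex.Re (z * w) =
  complex.Re z * complex.Re w - complex.Im z * complex.Im w.
Proof. by case: z w => [? ?] [? ?]. Qed.
Lemma cImM z w : complex.Im (z * w) =
  complex.Re z * complex.Im w + complex.Im z * complex.Re w.
Proof. by case: z w => [? ?] [? ?]. Qed.
Lemma cReJ z : complex.Re z^* = complex.Re z. Proof. by case: z. Qed.
Lemma cImJ z : complex.Im z^* = - complex.Im z. Proof. by case: z. Qed.
Definition reimE := (cReD, cImD, cReN, cImN, cReM, cImM, cReJ, cImJ).

Lemma complex_ext z w : complex.Re z = complex.Re w -> complex.Im z = complex.Im w -> z = w.
Proof. by case: z w => [? ?] [? ?] /= -> ->. Qed.

Lemma Re_sum (I : Type) (s : seq I) (F : I -> R[i]) :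
  complex.Re (\sum_(i <- s) F i) = \sum_(i <- s) complex.Re (F i).
Proof. by apply: (big_morph (@complex.Re R)) => // x y; rewrite cReD. Qed.

Lemma cmod_sum (I : Type) (s : seq I) (F : I -> R[i]) :
  cmod (\sum_(i <- s) F i) <= \sum_(i <- s) cmod (F i).
Proof.
elim/big_rec2: _ => [|i x y _ h]; first by rewrite cmod0.
by apply: le_trans (cmodD _ _) _; rewrite lerD2l.
Qed.

Definition ccont (f : R[i] -> R[i]) a := forall e, 0 < e ->
  exists2 d, 0 < d & forall z, cmod (z - a) < d -> cmod (f z - f a) <= e.

Definition rcont (f : R[i] -> R) a := forall e, 0 < e ->
  exists2 d, 0 < d & forall z, cmod (z - a) < d -> `|f z - f a| <= e.

Definition has_cderiv (f : R[i] -> R[i]) a c := forall e, 0 < e ->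
  exists2 d, 0 < d & forall z, cmod (z - a) < d ->
    cmod (f z - f a - c * (z - a)) <= e * cmod (z - a).

Definition cdiff f a := exists c, has_cderiv f a c.

Lemma has_cderiv_lip f a c : has_cderiv f a c ->
  exists2 d, 0 < d & forall z, cmod (z - a) < d ->
    cmod (f z - f a) <= (cmod c + 1) * cmod (z - a).
Proof.
move=> /(_ 1 ltr01) [d d0 h]; exists d => // z /h {}h.
have -> : f z - f a = (f z - f a - c * (z - a)) + c * (z - a) by ring.
apply: le_trans (cmodD _ _) _; rewrite cmodM; lra.
Qed.

Lemma cdiff_ccont f a : cdiff f a -> ccont f a.
Proof.
case=> c /has_cderiv_lip [d d0 h] e e0.
have k0 : 0 < cmod c + 1 by have := cmod_ge0 c; lra.
exists (Num.min d (e / (cmod c + 1))); first by rewrite lt_min d0 divr_gt0.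
move=> z; rewrite lt_min ltr_pdivlMr // mulrC => /andP[/h h1 h2].
by apply: le_trans h1 _; exact: ltW.
Qed.

Lemma has_cderiv_cst k a : has_cderiv (fun=> k) a 0.
Proof.
move=> e e0; exists 1 => // z _; rewrite subrr mul0r subrr cmod0.
by rewrite mulr_ge0 ?cmod_ge0 // ltW.
Qed.

Lemma has_cderiv_id a : has_cderiv id a 1.
Proof.
move=> e e0; exists 1 => // z _; rewrite mul1r subrr cmod0.
by rewrite mulr_ge0 ?cmod_ge0 // ltW.
Qed.

Lemma has_cderivD f g a c c' : has_cderiv f a c -> has_cderiv g a c' ->
  has_cderiv (fun z => f z + g z) a (c + c').
Proof.
move=> hf hg e e0; have e20 : 0 < e / 2 by rewrite divr_gt0.
case: (hf _ e20) => d d0 {}hf; case: (hg _ e20) => d' d'0 {}hg.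
exists (Num.min d d'); first by rewrite lt_min d0.
move=> z; rewrite lt_min => /andP[/hf h /hg h'].
have -> : f z + g z - (f a + g a) - (c + c') * (z - a) =
  (f z - f a - c * (z - a)) + (g z - g a - c' * (z - a)) by ring.
apply: le_trans (cmodD _ _) _; lra.
Qed.

Lemma has_cderiv_comp f g a c c' : has_cderiv f a c -> has_cderiv g (f a) c' ->
  has_cderiv (fun z => g (f z)) a (c' * c).
Proof.
move=> hf hg e e0.
have [d1 d10 lf] := has_cderiv_lip hf.
set K := cmod c + 1 in lf; have K0 : 0 < K by rewrite /K; have := cmod_ge0 c; lra.
set K' := cmod c' + 1; have K'0 : 0 < K' by rewrite /K'; have := cmod_ge0 c'; lra.
have e10 : 0 < e / (2 * K) by rewrite divr_gt0 // mulr_gt0.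
have e20 : 0 < e / (2 * K') by rewrite divr_gt0 // mulr_gt0.
have [d2 d20 {}hg] := hg _ e10; have [d3 d30 {}hf] := hf _ e20.
exists (Num.min d1 (Num.min d3 (d2 / K))); first by rewrite !lt_min d10 d30 divr_gt0.
move=> z; rewrite !lt_min ltr_pdivlMr // => /and3P[/lf h1 /hf h2 h3].
have /hg h4 : cmod (f z - f a) < d2 by apply: le_lt_trans h1 _; rewrite mulrC.
have -> : g (f z) - g (f a) - c' * c * (z - a) =
  (g (f z) - g (f a) - c' * (f z - f a)) + c' * (f z - f a - c * (z - a)) by ring.
apply: le_trans (cmodD _ _) _; rewrite cmodM.
have p1 : cmod c' * cmod (f z - f a - c * (z - a)) <= e / 2 * cmod (z - a).
  apply: (@le_trans _ _ (K' * (e / (2 * K') * cmod (z - a)))).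
    by apply: ler_pM => //; rewrite ?cmod_ge0 // /K'; lra.
  rewrite le_eqVlt; apply/orP; left; apply/eqP; field; lra.
have p2 : e / (2 * K) * cmod (f z - f a) <= e / 2 * cmod (z - a).
  apply: (@le_trans _ _ (e / (2 * K) * (K * cmod (z - a)))).
    by rewrite ler_wpM2l // ltW.
  rewrite le_eqVlt; apply/orP; left; apply/eqP; field; lra.
lra.
Qed.

Lemma has_cderiv_sqr a : has_cderiv (fun z => z * z) a (2 * a).
Proof.
move=> e e0; exists e => // z h.
have -> : z * z - a * a - 2 * a * (z - a) = (z - a) * (z - a) by ring.
by rewrite cmodM ler_wpM2r ?cmod_ge0 // ltW.
Qed.

Lemma has_cderivZ k f a c : has_cderiv f a c -> has_cderiv (fun z => k * f z) a (k * c).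
Proof.
move=> hf; have hk b : has_cderiv (fun z => k * z) b k.
  move=> e e0; exists 1 => // z _.
  have -> : k * z - k * b - k * (z - b) = 0 by ring.
  by rewrite cmod0 mulr_ge0 ?cmod_ge0 // ltW.
exact: has_cderiv_comp hf (hk _).
Qed.

Lemma has_cderivM f g a c c' : has_cderiv f a c -> has_cderiv g a c' ->
  has_cderiv (fun z => f z * g z) a (f a * c' + g a * c).
Proof.
move=> hf hg.
have hs := has_cderiv_comp (has_cderivD hf hg) (has_cderiv_sqr _).
have hs' := has_cderiv_comp (has_cderivD hf (has_cderivZ (-1) hg)) (has_cderiv_sqr _).
have := has_cderivD (has_cderivZ (1/4) hs) (has_cderivZ (-1/4) hs').
have -> : (fun z => 1/4 * ((f z + g z) * (f z + g z)) +
    -1/4 * ((f z + -1 * g z) * (f z + -1 * g z))) = (fun z => f z * g z).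
  by apply/funext => z; field.
by have -> : 1 / 4 * (2 * (f a + g a) * (c + c')) + -1 / 4 * (2 * (f a + -1 * g a) * (c + -1 * c')) = f a * c' + g a * c by field.
Qed.

Lemma has_cderiv_inv a : a != 0 -> has_cderiv (fun z => z^-1) a (- a^-1 ^+ 2).
Proof.
move=> a0 e e0; have ca : 0 < cmod a by rewrite cmod_gt0.
exists (Num.min (cmod a / 2) (e * cmod a ^+ 3 / 2)).
  by rewrite lt_min !divr_gt0 // mulr_gt0 // exprn_gt0.
move=> z; rewrite lt_min => /andP[h1 h2].
have hz : cmod a / 2 < cmod z.
  have := cmodD (a - z) z; rewrite subrK cmodB; lra.
have z0 : z != 0 by rewrite -cmod_gt0; lra.
have -> : z^-1 - a^-1 - (- a^-1 ^+ 2) * (z - a) = (z - a) * ((z - a) / (z * a ^+ 2)).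
  by field; rewrite a0.
rewrite cmodM mulrC ler_wpM2r ?cmod_ge0 // cmodM cmodV expr2 !cmodM -expr2.
have hp : 0 < cmod z * cmod a ^+ 2 by rewrite mulr_gt0 ?exprn_gt0 //; lra.
rewrite ler_pdivrMr //; apply: le_trans (ltW h2) _.
have -> : e * cmod a ^+ 3 / 2 = e * (cmod a / 2 * cmod a ^+ 2) by field.
by rewrite ler_pM2l // ler_pM2r ?exprn_gt0 // ltW.
Qed.

Lemma cdiff_cst k a : cdiff (fun=> k) a.
Proof. by exists 0; exact: has_cderiv_cst. Qed.
Lemma cdiff_id a : cdiff id a.
Proof. by exists 1; exact: has_cderiv_id. Qed.
Lemma cdiffD f g a : cdiff f a -> cdiff g a -> cdiff (fun z => f z + g z) a.
Proof. by move=> [c h] [d k]; exists (c + d); exact: has_cderivD h k. Qed.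
Lemma cdiffM f g a : cdiff f a -> cdiff g a -> cdiff (fun z => f z * g z) a.
Proof. by move=> [c h] [d k]; eexists; exact: has_cderivM h k. Qed.
Lemma cdiffZ k f a : cdiff f a -> cdiff (fun z => k * f z) a.
Proof. by move=> [c h]; exists (k * c); exact: has_cderivZ h. Qed.
Lemma cdiffN f a : cdiff f a -> cdiff (fun z => - f z) a.
Proof.
move=> /(cdiffZ (-1)); have -> // : (fun z => -1 * f z) = (fun z => - f z).
by apply/funext => z; rewrite mulN1r.
Qed.
Lemma cdiffB f g a : cdiff f a -> cdiff g a -> cdiff (fun z => f z - g z) a.
Proof. by move=> h /cdiffN k; exact: cdiffD. Qed.
Lemma cdiff_comp f g a : cdiff f a -> cdiff g (f a) -> cdiff (fun z => g (f z)) a.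
Proof. by move=> [c h] [d k]; eexists; exact: has_cderiv_comp h k. Qed.
Lemma cdiffV f a : f a != 0 -> cdiff f a -> cdiff (fun z => (f z)^-1) a.
Proof.
move=> fa h; apply: (cdiff_comp (g := fun z => z^-1) h).
by eexists; exact: has_cderiv_inv.
Qed.
Lemma cdiff_sum (I : Type) (s : seq I) (F : I -> R[i] -> R[i]) a :
  (forall i, cdiff (F i) a) -> cdiff (fun z => \sum_(i <- s) F i z) a.
Proof.
move=> h; elim: s => [|i s IH].
  have -> : (fun z => \sum_(i <- [::]) F i z) = (fun=> 0).
    by apply/funext => z; rewrite big_nil.
  exact: cdiff_cst.
have -> : (fun z => \sum_(j <- i :: s) F j z) = (fun z => F i z + \sum_(j <- s) F j z).
  by apply/funext => z; rewrite big_cons.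
exact: cdiffD.
Qed.

Lemma cdiff_ext f g a r : 0 < r -> (forall z, cmod (z - a) < r -> f z = g z) ->
  cdiff f a -> cdiff g a.
Proof.
move=> r0 h [c hc]; exists c => e e0; have [d d0 hd] := hc e e0.
exists (Num.min r d); first by rewrite lt_min r0.
move=> z; rewrite lt_min => /andP[h1 h2].
by rewrite -!h ?subrr ?cmod0 //; exact: hd.
Qed.
End CmodTheory.

(** * Bisection, integrals and derivatives on the line *)
Section Bisection.
Context {R : realType}.
Implicit Types (x y w h e : R).

Lemma half_pow_lt (w d : R) : 0 < d -> exists k0 : nat, forall k : nat,
  (k0 <= k)%N -> w / 2 ^+ k < d.
Proof.
move=> d0; exists (Num.truncn (`|w| / d)).+1 => k hk.
have p0 : 0 < 2 ^+ k :> R by rewrite exprn_gt0.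
rewrite ltr_pdivrMr //; apply: le_lt_trans (ler_norm w) _.
rewrite mulrC -ltr_pdivrMr //.
apply: (@lt_le_trans _ _ (Num.truncn (`|w| / d)).+1%:R); first exact: truncnS_gt.
apply: (@le_trans _ _ k%:R); first by rewrite ler_nat.
by rewrite -natrX ler_nat ltnW // ltn_expl.
Qed.

(** Goursat's bisection: if the claim failed for the whole rectangle it would fail
    for one quarter of it, then for one quarter of that, and the nested
    rectangles shrink to a point at which the local hypothesis contradicts this.
    The generation [k] is part of the claim so that errors may shrink with it; a
    rectangle of height 0 gives bisection of an interval. *)
Lemma square_induction (x0 y0 w h : R) (P : nat -> R -> R -> Prop) :
  0 <= w -> 0 <= h ->
  (forall k x y, P k.+1 x y -> P k.+1 (x + w / 2 ^+ k.+1) y ->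
     P k.+1 x (y + h / 2 ^+ k.+1) ->
     P k.+1 (x + w / 2 ^+ k.+1) (y + h / 2 ^+ k.+1) -> P k x y) ->
  (forall a b, x0 <= a <= x0 + w -> y0 <= b <= y0 + h ->
     exists2 d, 0 < d & forall k x y,
       x <= a <= x + w / 2 ^+ k -> y <= b <= y + h / 2 ^+ k ->
       w / 2 ^+ k < d -> h / 2 ^+ k < d -> P k x y) ->
  P 0%N x0 y0.
Proof.
move=> w0 h0 Psub Ploc; apply: contrapT => nP.
pose wk k := w / 2 ^+ k; pose hk k := h / 2 ^+ k.
have wk0 k : 0 <= wk k by rewrite divr_ge0 // exprn_ge0.
have hk0 k : 0 <= hk k by rewrite divr_ge0 // exprn_ge0.
have wkS k : wk k = wk k.+1 + wk k.+1.
  by rewrite /wk exprS; field; rewrite ?expf_neq0 ?pnatr_eq0.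
have hkS k : hk k = hk k.+1 + hk k.+1.
  by rewrite /hk exprS; field; rewrite ?expf_neq0 ?pnatr_eq0.
have step k (p : R * R) : exists q : R * R, ~ P k p.1 p.2 ->
   [/\ ~ P k.+1 q.1 q.2, p.1 <= q.1 <= p.1 + wk k.+1 & p.2 <= q.2 <= p.2 + hk k.+1].
  case: (pselect (P k p.1 p.2)) => [Pk|nPk]; first by exists p.
  have wk1 := wk0 k.+1; have hk1 := hk0 k.+1.
  case: (pselect (P k.+1 p.1 p.2)) => [P1|?]; last by exists p; split => //; lra.
  case: (pselect (P k.+1 (p.1 + wk k.+1) p.2)) => [P2|?]; last first.
    by exists (p.1 + wk k.+1, p.2); split => //=; lra.
  case: (pselect (P k.+1 p.1 (p.2 + hk k.+1))) => [P3|?]; last first.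
    by exists (p.1, p.2 + hk k.+1); split => //=; lra.
  exists (p.1 + wk k.+1, p.2 + hk k.+1); split => //=; try lra.
  by move=> P4; apply: nPk; exact: Psub.
have [nxt0 nxtP0] := choice (fun kp : nat * (R * R) => step kp.1 kp.2).
pose nxt k p := nxt0 (k, p).
have nxtP k p : ~ P k p.1 p.2 ->
   [/\ ~ P k.+1 (nxt k p).1 (nxt k p).2, p.1 <= (nxt k p).1 <= p.1 + wk k.+1
     & p.2 <= (nxt k p).2 <= p.2 + hk k.+1].
  exact: (nxtP0 (k, p)).
pose s := fix s k := if k is j.+1 then nxt j (s j) else (x0, y0).
have sP k : ~ P k (s k).1 (s k).2 by elim: k => [|k IH] //=; case: (nxtP k (s k) IH).
have sx k : (s k).1 <= (s k.+1).1 <= (s k).1 + wk k.+1.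
  by case: (nxtP k _ (sP k)).
have sy k : (s k).2 <= (s k.+1).2 <= (s k).2 + hk k.+1.
  by case: (nxtP k _ (sP k)).
have nest (t : nat -> R) (z : nat -> R) :
    (forall k, 0 <= z k) -> (forall k, z k = z k.+1 + z k.+1) ->
    (forall k, t k <= t k.+1 <= t k + z k.+1) ->
    forall j k, t j <= t k + z k.
  move=> z0 zS ht j k.
  have mono m n : (m <= n)%N -> t m <= t n.
    move=> /subnK <-; elim: (n - m)%N => [|i IH] //.
    by apply: le_trans IH _; rewrite addSn; case/andP: (ht (i + m)%N).
  have anti m n : (m <= n)%N -> t n + z n <= t m + z m.
    move=> /subnK <-; elim: (n - m)%N => [|i IH] //.
    apply: le_trans _ IH; rewrite addSn [z (i + m)%N]zS.
    by case/andP: (ht (i + m)%N) => _; lra.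
  have [jk|/ltnW kj] := leqP j k.
    by apply: le_trans (mono _ _ jk) _; have := z0 k; lra.
  by apply: le_trans _ (anti _ _ kj); have := z0 j; lra.
have lim (t : nat -> R) (z : nat -> R) :
    (forall k, 0 <= z k) -> (forall k, z k = z k.+1 + z k.+1) ->
    (forall k, t k <= t k.+1 <= t k + z k.+1) ->
    exists a, forall k, t k <= a <= t k + z k.
  move=> z0 zS ht; have N := nest t z z0 zS ht.
  exists (sup (range t)) => k; apply/andP; split.
    apply: ub_le_sup; last by exists k.
    by exists (t 0%N + z 0%N) => _ [j _ <-].
  by apply: ge_sup; [exists (t 0%N); exists 0%N | move=> _ [j _ <-]].
have [a ha] := lim _ _ wk0 wkS sx; have [b hb] := lim _ _ hk0 hkS sy.
have /Ploc : x0 <= a <= x0 + w by have := ha 0%N; rewrite /= /wk expr0 divr1.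
have hb0 : y0 <= b <= y0 + h by have := hb 0%N; rewrite /= /hk expr0 divr1.
move=> /(_ b hb0) [d d0 {}Ploc].
have [k1 hk1] := half_pow_lt w d0; have [k2 hk2] := half_pow_lt h d0.
apply: (sP (maxn k1 k2)); apply: Ploc; [exact: ha | exact: hb | |].
- by apply: hk1; rewrite leq_maxl.
- by apply: hk2; rewrite leq_maxr.
Qed.
End Bisection.

Section SegmentIntegral.
Context {R : realType}.
Implicit Types (f g : R -> R) (a b c e : R).

Definition intg f a b : R := (\int[lebesgue_measure]_(t in `[a, b]) f t)%R.

Definition cont_on f a b := forall t, a <= t <= b -> {for t, continuous f}.

Lemma cont_on_integrable f a b : cont_on f a b ->
  lebesgue_measure.-integrable `[a, b] (EFin \o f).
Proof.
move=> cf; apply: continuous_compact_integrable; first exact: segment_compact.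
by apply: continuous_in_subspaceT => t; rewrite inE /= in_itv /= => /cf.
Qed.

Lemma intg_cat f a b c : a <= b -> b <= c -> cont_on f a c ->
  intg f a c = intg f a b + intg f b c.
Proof.
move=> ab bc cf; have i := cont_on_integrable cf.
have := @Rintegral_itvB R f (BLeft a) (BRight c) b i.
rewrite !bnd_simp => /(_ ab bc) h.
rewrite /intg -[X in _ = _ + X]Rintegral_itv_obnd_cbnd.
  by rewrite -h addrC subrK.
apply: integrableS i => //; apply: subset_itv; rewrite ?bnd_simp //.
Qed.

Lemma intgB f g a b : cont_on f a b -> cont_on g a b ->
  intg (fun t => f t - g t) a b = intg f a b - intg g a b.
Proof. by move=> cf cg; rewrite /intg RintegralB //; exact: cont_on_integrable. Qed.

Lemma cont_on_cst k a b : cont_on (fun=> k) a b.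
Proof. by move=> t _; exact: cst_continuous. Qed.

Lemma intg_cst k a b : a <= b -> intg (fun=> k) a b = k * (b - a).
Proof.
move=> ab; rewrite /intg Rintegral_cst//= lebesgue_measure_itv/= lte_fin.
by case: ltP => [//|ba] /=; have -> : a = b; [lra | rewrite subrr].
Qed.

Lemma intg_le f g a b : cont_on f a b -> cont_on g a b ->
  (forall t, a <= t <= b -> f t <= g t) -> intg f a b <= intg g a b.
Proof.
move=> cf cg fg; apply: le_Rintegral => //; try exact: cont_on_integrable.
Qed.

(** The form in which differentiability enters Goursat's argument: an integrand
    that is nearly constant has nearly the expected integral. *)
Lemma intg_near f a b k e : a <= b -> cont_on f a b ->
  (forall t, a <= t <= b -> `|f t - k| <= e) ->
  `|intg f a b - k * (b - a)| <= e * (b - a).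
Proof.
move=> ab cf h.
have h1 : intg f a b <= intg (fun=> k + e) a b.
  apply: intg_le => //; first exact: cont_on_cst.
  by move=> t /h; rewrite ler_norml; lra.
have h2 : intg (fun=> k - e) a b <= intg f a b.
  apply: intg_le => //; first exact: cont_on_cst.
  by move=> t /h; rewrite ler_norml; lra.
move: h1 h2; rewrite !intg_cst // ler_norml; lra.
Qed.
End SegmentIntegral.

Section RealDerivative.
Context {R : realType}.
Implicit Types (f : R -> R) (x l e d : R).

Lemma is_derive_bound f x l : is_derive x (1 : R) f l ->
  forall e, 0 < e -> exists2 d, 0 < d & forall t, `|t - x| < d ->
    `|f t - f x - l * (t - x)| <= e * `|t - x|.
Proof.
move=> [df dl] e e0.
have : (fun h : R => h^-1 *: ((f \o shift x) (h *: (1 : R)) - f x)) @ 0^' --> l.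
  by move: df; rewrite -dl => /cvg_ex[l' h]; rewrite /derive (cvg_lim _ h).
move/cvgrPdist_le => /(_ e e0); rewrite near_withinE => -[d /= d0 h].
exists d => // t tx; have [->|tx0] := eqVneq t x.
  by rewrite !subrr mulr0 subr0 normr0 mulr0.
have tx1 : t - x != 0 by rewrite subr_eq0.
have := h (t - x); rewrite /= sub0r normrN => /(_ tx tx1).
rewrite /shift /= [_ *: 1]mulr1 subrK => hh.
have -> : f t - f x - l * (t - x) = - ((l - (t - x)^-1 *: (f t - f x)) * (t - x)).
  by rewrite /GRing.scale /=; field.
by rewrite normrN normrM ler_wpM2r.
Qed.

Lemma bound_is_derive f x l :
  (forall e, 0 < e -> exists2 d, 0 < d & forall t, `|t - x| < d ->
    `|f t - f x - l * (t - x)| <= e * `|t - x|) -> is_derive x (1 : R) f l.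
Proof.
move=> H.
have cv : (fun h : R => h^-1 *: ((f \o shift x) (h *: (1 : R)) - f x)) @ 0^' --> l.
  apply/cvgrPdist_le => e /H [d d0 h]; rewrite near_withinE; exists d => // t /=.
  rewrite sub0r normrN => td t0; have := h (t + x); rewrite addrK => /(_ td) hh.
  rewrite /shift /= [_ *: 1]mulr1.
  have -> : l - t^-1 *: (f (t + x) - f x) = - (f (t + x) - f x - l * t) / t.
    by rewrite /GRing.scale /=; field.
  by rewrite normrM normrN normfV ler_pdivrMr ?normr_gt0.
by split; [apply/cvg_ex; exists l | exact: cvg_lim cv].
Qed.

Lemma continuous_bound f x : {for x, continuous f} <->
  forall e, 0 < e -> exists2 d, 0 < d & forall t, `|t - x| < d -> `|f t - f x| <= e.
Proof.
split=> [/cvgrPdist_le h e /h [d d0 hd]|h].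
  by exists d => // t tx; rewrite distrC; apply: hd; rewrite /= distrC.
apply/cvgrPdist_le => e /h [d d0 hd]; exists d => // t /=.
by rewrite distrC => /hd; rewrite distrC.
Qed.
End RealDerivative.

(** * The exponential and Goursat's theorem on a strip *)
Section ComplexExponential.
Context {R : realType}.
Implicit Types (z w : R[i]) (x y : R).

Definition cexp z : R[i] :=
  (expR (complex.Re z) * cos (complex.Im z)) +i* (expR (complex.Re z) * sin (complex.Im z)).

Lemma cexpD z w : cexp (z + w) = cexp z * cexp w.
Proof.
apply: complex_ext; rewrite ?(cReM, cImM) /= !(cReD, cImD) expRD ?cosD ?sinD; ring.
Qed.

Lemma cexp_periodic z : cexp (z + (0 +i* (pi *+ 2))) = cexp z.
Proof.
rewrite cexpD; have -> : cexp (0 +i* (pi *+ 2)) = 1.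
  by rewrite /cexp /= expR0 cos2pi sin2pi mulr1 mulr0.
by rewrite mulr1.
Qed.

Lemma cmod_cexp z : cmod (cexp z) = expR (complex.Re z).
Proof.
rewrite cmodE /= !exprMn -mulrDr cos2Dsin2 mulr1 sqrtr_sqr ger0_norm //.
Qed.

Lemma has_cderiv_cexp0 : has_cderiv cexp 0 1.
Proof.
move=> e e0.
have [k [e1 ke k1]] : exists k : R, [/\ 0 < k, k <= e / 10 & k <= 1].
  exists (Num.min (e / 10) 1); rewrite lt_min ltr01 !ge_min !lexx orbT andbT; split=> //.
  by rewrite divr_gt0.
have [d1 d10 h1] := is_derive_bound (is_derive_expR 0) e1.
have [d2 d20 h2] := is_derive_bound (is_derive_cos 0) e1.
have [d3 d30 h3] := is_derive_bound (is_derive_sin 0) e1.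
exists (Num.min (Num.min d1 d2) (Num.min d3 k)).
  by rewrite !lt_min d10 d20 d30 e1.
move=> z; rewrite subr0 !lt_min => /andP[/andP[z1 z2] /andP[z3 zk]].
set x := complex.Re z; set y := complex.Im z.
have xz : `|x| <= cmod z by exact: Re_le_cmod.
have yz : `|y| <= cmod z by exact: Im_le_cmod.
set t := cmod z in z1 z2 z3 zk xz yz *.
have t0 : 0 <= t by exact: cmod_ge0.
have hE : `|expR x - 1 - x| <= k * t.
  have := h1 x; rewrite expR0 subr0 mul1r => /(_ (le_lt_trans xz z1)) /le_trans; apply.
  by rewrite ler_wpM2l // ltW.
have hC : `|cos y - 1| <= k * t.
  have := h2 y; rewrite cos0 sin0 subr0 oppr0 mul0r subr0 => /(_ (le_lt_trans yz z2)) /le_trans; apply.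
  by rewrite ler_wpM2l // ltW.
have hS : `|sin y - y| <= k * t.
  have := h3 y; rewrite sin0 cos0 !subr0 mul1r => /(_ (le_lt_trans yz z3)) /le_trans; apply.
  by rewrite ler_wpM2l // ltW.
have c1 : `|cos y| <= 1 by rewrite ler_norml cos_geN1 cos_le1.
have kt : k * t <= t by rewrite -[leRHS]mul1r ler_wpM2r.
have hX : `|expR x - 1| <= 2 * t.
  have -> : expR x - 1 = (expR x - 1 - x) + x by ring.
  by apply: le_trans (ler_normD _ _) _; lra.
have hS2 : `|sin y| <= 2 * t.
  have -> : sin y = (sin y - y) + y by ring.
  by apply: le_trans (ler_normD _ _) _; lra.
apply: le_trans (cmod_le_ReIm _) _.
rewrite !reimE /cexp /= -/x -/y expR0 cos0 sin0.
have -> : expR x * cos y - 1 * 1 - (1 * x - 0 * y) =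
  (expR x - 1 - x) * cos y + (cos y - 1) * 1 + x * (cos y - 1) by ring.
have -> : expR x * sin y - 1 * 0 - (1 * y + 0 * x) =
  (expR x - 1) * sin y + (sin y - y) by ring.
have q1 : `|(expR x - 1 - x) * cos y| <= k * t * 1 by rewrite normrM ler_pM.
have q2 : `|x * (cos y - 1)| <= t * (k * t) by rewrite normrM ler_pM.
have q3 : `|(expR x - 1) * sin y| <= (2 * t) * (2 * t) by rewrite normrM ler_pM.
have tk : t * t <= k * t by rewrite ler_wpM2r // ltW.
have ktt : t * (k * t) <= k * t.
  by rewrite mulrC -[leRHS]mulr1 ler_wpM2l ?mulr_ge0 ?(ltW e1) //; lra.
have ket : k * t <= e / 10 * t by rewrite ler_wpM2r.
have et0 : 0 <= e * t by rewrite mulr_ge0 // ltW.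
rewrite mulr1.
have a1 := ler_normD ((expR x - 1 - x) * cos y + (cos y - 1)) (x * (cos y - 1)).
have a2 := ler_normD ((expR x - 1 - x) * cos y) (cos y - 1).
have a3 := ler_normD ((expR x - 1) * sin y) (sin y - y).
lra.
Qed.

Lemma cdiff_cexp z : cdiff cexp z.
Proof.
have h : has_cderiv (fun w => w + - z) z 1.
  by have := has_cderivD (has_cderiv_id z) (has_cderiv_cst (- z) z); rewrite addr0.
have h0 : has_cderiv cexp (z + - z) 1 by rewrite subrr; exact: has_cderiv_cexp0.
have -> : cexp = (fun w => cexp z * cexp (w + - z)).
  by apply/funext => w; rewrite -cexpD addrC subrK.
by eexists; exact: has_cderivZ (has_cderiv_comp h h0).
Qed.
End ComplexExponential.

Lemma cdiff_Im_continuous (R : realType) (W : R[i] -> R[i]) x y : cdiff W (x +i* y) ->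
  {for y, continuous (fun t => complex.Im (W (x +i* t)))}.
Proof.
move=> /cdiff_ccont h; apply/continuous_bound => e /h [d d0 {}h].
exists d => // t ty; rewrite -cImN -cImD; apply: le_trans (Im_le_cmod _) (h _ _).
by rewrite cmodE /= subrr expr0n add0r sqrtr_sqr.
Qed.

Section Goursat.
Context {R : realType}.
Variables (W : R[i] -> R[i]) (X T : R).
Hypothesis T0 : 0 <= T.
Hypothesis Wdiff : forall z, complex.Re z < X -> cdiff W z.
Hypothesis Wper : forall z, W (z + (0 +i* T)) = W z.

Let u (x y : R) := complex.Re (W (x +i* y)).
Let v (x y : R) := complex.Im (W (x +i* y)).

Let cont_v x y : x < X -> {for y, continuous (v x)}.
Proof. by move=> xX; apply: cdiff_Im_continuous; apply: Wdiff. Qed.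

Let cont_u x y : x < X -> {for x, continuous (u ^~ y)}.
Proof.
move=> xX; apply/continuous_bound => e e0.
have [d d0 h] := cdiff_ccont (@Wdiff (x +i* y) xX) e0.
exists d => // t ty; rewrite /u -cReN -cReD; apply: le_trans (Re_le_cmod _) (h _ _).
by rewrite cmodE /= subrr expr0n addr0 sqrtr_sqr.
Qed.

Let hor x x' y := intg (u ^~ y) x x'.
Let ver x y y' := intg (v x) y y'.
(* the real part of the integral of W dz around the rectangle *)
Let circ x x' y y' := hor x x' y - hor x x' y' - ver x' y y' + ver x y y'.

Let circ_local a b e : a < X -> 0 < e ->
  exists2 d, 0 < d & forall x x' y y', x <= a <= x' -> y <= b <= y' -> x' < X ->
    x' - x < d -> y' - y < d ->
    `|circ x x' y y'| <= e * ((x' - x) + (y' - y)) ^+ 2.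
Proof.
move=> aX e0; have e20 : 0 < e / 2 by rewrite divr_gt0.
have [c /(_ _ e20) [d d0 hc]] := @Wdiff (a +i* b) aX.
exists (d / 2); first by rewrite divr_gt0.
move=> x x' y y' /andP[xa ax'] /andP[yb by'] x'X xd yd.
set l := x' - x; set m := y' - y.
have hW s t : x <= s <= x' -> y <= t <= y' ->
    cmod (W (s +i* t) - W (a +i* b) - c * ((s - a) +i* (t - b))) <= e / 2 * (l + m).
  move=> /andP[xs sx'] /andP[yt ty'].
  have k : cmod ((s +i* t) - (a +i* b)) <= l + m.
    apply: le_trans (cmod_le_ReIm _) _; apply: lerD; rewrite /= ler_norml /l /m; lra.
  apply: le_trans (hc _ _) _; first by apply: le_lt_trans k _; rewrite /l /m; lra.
  by rewrite ler_wpM2l // ltW.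
have xx' : x <= x' by lra. have yy' : y <= y' by lra.
have H : `|hor x x' y - hor x x' y' - (complex.Im c * m) * l| <= e * (l + m) * l.
  rewrite /hor -intgB; try by move=> t tx; apply: cont_u; lra.
  apply: intg_near => //.
    move=> t tx; apply: (@continuousB _ _ _ (u ^~ y) (u ^~ y')); apply: cont_u; lra.
  move=> t tx; have yy : y <= y <= y' by lra. have yy2 : y <= y' <= y' by lra.
  have := le_trans (Re_le_cmod _) (hW _ _ tx yy).
  have := le_trans (Re_le_cmod _) (hW _ _ tx yy2).
  rewrite !reimE /= -/(u t y) -/(u t y') -/(u a b) !ler_norml /m; lra.
have V : `|ver x' y y' - ver x y y' - (complex.Im c * l) * m| <= e * (l + m) * m.
  rewrite /ver -intgB; try by move=> t tx; apply: cont_v; lra.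
  apply: intg_near => //.
    move=> t tx; apply: (@continuousB _ _ _ (v x') (v x)); apply: cont_v; lra.
  move=> t ty; have xxx : x <= x <= x' by lra. have xx2 : x <= x' <= x' by lra.
  have := le_trans (Im_le_cmod _) (hW _ _ xxx ty).
  have := le_trans (Im_le_cmod _) (hW _ _ xx2 ty).
  rewrite !reimE /= -/(v x t) -/(v x' t) -/(v a b) !ler_norml /l; lra.
rewrite /circ -/l -/m expr2 mulrA mulrDr; move: H V; rewrite !ler_norml; lra.
Qed.

Let circ_cat x x' x'' y y' y'' : x <= x' -> x' <= x'' -> y <= y' -> y' <= y'' ->
  x'' < X ->
  circ x x'' y y'' = circ x x' y y' + circ x' x'' y y' + circ x x' y' y'' + circ x' x'' y' y''.
Proof.
move=> h1 h2 h3 h4 h5; rewrite /circ /hor /ver.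
have cu t : cont_on (u ^~ t) x x'' by move=> s sx; apply: cont_u; lra.
have cv s : s <= x'' -> cont_on (v s) y y'' by move=> sx t _; apply: cont_v; lra.
rewrite !(intg_cat h1 h2 (cu _)) !(intg_cat h3 h4 (cv _ _)) //; last exact: le_trans h2.
ring.
Qed.

Let circ0 x x' : x <= x' -> x' < X -> circ x x' 0 T = 0.
Proof.
move=> xx' x'X; apply/eqP; rewrite -normr_eq0 eq_le normr_ge0 andbT.
apply/ler_addgt0Pl => e e0; rewrite addr0.
pose w := x' - x; pose c := (w + T) ^+ 2 + 1.
have c0 : 0 < c by rewrite ltr_wpDl ?sqr_ge0.
have w0 : 0 <= w by rewrite subr_ge0.
pose P k a b := x <= a -> a + w / 2 ^+ k <= x' ->
  `|circ a (a + w / 2 ^+ k) b (b + T / 2 ^+ k)| <= e / 4 ^+ k.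
suff : P 0%N x 0.
  by rewrite /P expr0 !divr1 add0r /w [x + _]addrC subrK; exact.
apply: (@square_induction R x 0 w T P) => // [k a b p1 p2 p3 p4 xa ax'|a b ha hb].
  set a' := a + w / 2 ^+ k.+1; set b' := b + T / 2 ^+ k.+1.
  have eT (t : R) : t / 2 ^+ k = t / 2 ^+ k.+1 + t / 2 ^+ k.+1.
    by rewrite exprS; field; rewrite ?expf_neq0 ?pnatr_eq0.
  have e4 : e / 4 ^+ k = e / 4 ^+ k.+1 * 4.
    by rewrite exprS; field; rewrite ?expf_neq0 ?pnatr_eq0.
  have wk0 : 0 <= w / 2 ^+ k.+1 by rewrite divr_ge0 // exprn_ge0.
  have Tk0 : 0 <= T / 2 ^+ k.+1 by rewrite divr_ge0 // exprn_ge0.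
  have aa' : a <= a' by rewrite lerDl.
  move: ax'; rewrite e4 !eT !addrA -/a' -/b' => ax'.
  rewrite (@circ_cat a a' (a' + w / 2 ^+ k.+1) b b' (b' + T / 2 ^+ k.+1)) ?lerDl //; last lra.
  have {}p1 : `|circ a a' b b'| <= e / 4 ^+ k.+1 by apply: p1 => //; rewrite -/a'; lra.
  have {}p2 : `|circ a' (a' + w / 2 ^+ k.+1) b b'| <= e / 4 ^+ k.+1.
    by apply: p2; rewrite -/a'; lra.
  have {}p3 : `|circ a a' b' (b' + T / 2 ^+ k.+1)| <= e / 4 ^+ k.+1.
    by apply: p3 => //; rewrite -/a'; lra.
  have {}p4 : `|circ a' (a' + w / 2 ^+ k.+1) b' (b' + T / 2 ^+ k.+1)| <= e / 4 ^+ k.+1.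
    by apply: p4; rewrite -/a'; lra.
  move: p1 p2 p3 p4; rewrite !ler_norml; lra.
have aX : a < X by move: ha; rewrite /w; lra.
have [d d0 hd] := circ_local b aX (divr_gt0 e0 c0).
exists d => // k s t hs ht ws Ts xs sx'.
apply: le_trans (hd _ _ _ _ hs ht _ _ _) _; try lra.
have k0 : 0 < 4 ^+ k :> R by rewrite exprn_gt0.
have -> : s + w / 2 ^+ k - s + (t + T / 2 ^+ k - t) = (w + T) / 2 ^+ k by ring.
rewrite exprMn exprVn -exprM mulnC exprM.
have -> : 2 ^+ 2 = 4 :> R by ring.
rewrite mulrA ler_wpM2r ?invr_ge0 ?(ltW k0) // -mulrA ler_piMr ?(ltW e0) //.
by rewrite mulrC ler_pdivrMr // mul1r /c lerDl.
Qed.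

(** The contour integral of [W] over a rectangle one period high vanishes by
    bisection, and its horizontal sides cancel by periodicity.  The strip suits
    functions composed with [z |-> a + exp z]: vertical segments become circles
    about [a], and a singularity at [a] is moved to infinity. *)
Lemma goursat_strip x x' : x <= x' -> x' < X ->
  intg (fun y => complex.Im (W (x +i* y))) 0 T = intg (fun y => complex.Im (W (x' +i* y))) 0 T.
Proof.
move=> xx' x'X; have := circ0 xx' x'X; rewrite /circ.
have -> : hor x x' T = hor x x' 0.
  rewrite /hor; congr intg; apply/funext => s; rewrite /u -[in RHS]Wper.
  by congr (complex.Re (W _)); apply: complex_ext => /=; rewrite ?addr0 ?add0r.
rewrite subrr sub0r /ver => h; apply/eqP; rewrite -subr_eq0 addrC; exact/eqP.
Qed.
End Goursat.

(** * The maximum principle *)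
Section MaximumPrinciple.
Context {R : realType}.
Implicit Types (F : R[i] -> R[i]) (a z : R[i]) (r e : R).

(** Complex differentiability at [a] itself is replaced by continuity: the divided
    differences used below are of this kind, and the mean value argument never
    evaluates a derivative at the centre of its circles. *)
Definition punctured_holo F a r :=
  ccont F a /\ forall z, 0 < cmod (z - a) < r -> cdiff F z.

(** A weak mean value property.  The mean of [Re F] over circles about [a] does not
    depend on the radius, by [goursat_strip] after the substitution
    [z = a + exp w], and it tends to [Re (F a)] for small radii by continuity. *)
Lemma mean_value_no_strict_max F a r0 r k : punctured_holo F a r0 ->
  0 < r < r0 -> 0 < k ->
  ~ (forall z, cmod (z - a) = r -> complex.Re (F z) <= complex.Re (F a) - k).
Proof.
move=> [Fa Fd] /andP[rp rr0] k0 H.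
have r00 : 0 < r0 by lra.
have [T [T0 cT]] : exists T : R, 0 < T /\ forall z, cexp (z + (0 +i* T)) = cexp z.
  by exists (pi *+ 2); split; [rewrite mulrn_wgt0 // pi_gt0 | exact: cexp_periodic].
have ea z : cmod (a + cexp z - a) = expR (complex.Re z).
  by rewrite addrC addKr cmod_cexp.
(* multiplying by i turns real parts into imaginary ones *)
have [W [ImW Wp Wd]] : exists W : R[i] -> R[i],
    [/\ forall z, complex.Im (W z) = complex.Re (F (a + cexp z)),
        forall z, W (z + (0 +i* T)) = W z &
        forall z, complex.Re z < ln r0 -> cdiff W z].
  exists (fun z => 'i * F (a + cexp z)); split=> z.
  - by rewrite cImM /= mul0r add0r mul1r.
  - by rewrite cT.
  - move=> zr; apply: cdiffZ; apply: (@cdiff_comp _ (fun z => a + cexp z)).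
      by apply: cdiffD (cdiff_cst _ _) (cdiff_cexp _).
    by apply: Fd; rewrite ea expR_gt0 -[ltRHS]lnK ?posrE // ltr_expR.
have k20 : 0 < k / 2 by rewrite divr_gt0.
have [d d0 hd] := Fa _ k20.
have lr : ln r < ln r0 by rewrite ltr_ln ?posrE.
have [x [xr xd]] : exists x, x <= ln r /\ expR x < d.
  exists (Num.min (ln r) (ln (d / 2))); split; first by rewrite ge_min lexx.
  apply: (@le_lt_trans _ _ (expR (ln (d / 2)))).
    by rewrite ler_expR ge_min lexx orbT.
  by rewrite lnK ?posrE ?divr_gt0 //; lra.
have G := goursat_strip (ltW T0) Wd Wp xr lr.
have cW s : s < ln r0 -> cont_on (fun y => complex.Im (W (s +i* y))) 0 T.
  by move=> sr t _; apply: cdiff_Im_continuous; exact: Wd.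
have h1 : intg (fun y => complex.Im (W (ln r +i* y))) 0 T <=
    (complex.Re (F a) - k) * (T - 0).
  rewrite -intg_cst ?(ltW T0) //; apply: intg_le; [exact: cW|exact: cont_on_cst|].
  by move=> t _; rewrite ImW; apply: H; rewrite ea /= lnK.
have h2 : `|intg (fun y => complex.Im (W (x +i* y))) 0 T
    - complex.Re (F a) * (T - 0)| <= k / 2 * (T - 0).
  apply: intg_near; [exact: ltW|apply: cW; lra|] => t _.
  rewrite ImW -cReN -cReD; apply: le_trans (Re_le_cmod _) _.
  by apply: hd; rewrite ea.
rewrite G in h2.
have : 0 < k * (T) by rewrite mulr_gt0.
move: h1 h2; rewrite subr0 ler_norml; lra.
Qed.

Lemma rcont_pair (phi : R[i] -> R) (x y : R) : rcont phi (x +i* y) ->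
  {for (x, y), continuous (fun p : R * R => phi (p.1 +i* p.2))}.
Proof.
move=> h; apply/cvgrPdist_le => e /h [d d0 {}h].
have d20 : 0 < d / 2 by rewrite divr_gt0.
exists (ball x (d / 2), ball y (d / 2)); first by split; apply: nbhsx_ballx.
move=> [s t] /= [xs yt]; rewrite distrC; apply: h.
apply: le_lt_trans (cmod_le_ReIm _) _ => /=.
move: xs yt; rewrite /ball /= ![`|_ - s|]distrC ![`|_ - t|]distrC; lra.
Qed.

(** What the maximum principle asks for in place of subharmonicity: a harmonic
    function touching [phi] from below at [a].  Maxima of harmonic functions have
    such minorants, corners included. *)
Definition local_minorant (phi : R[i] -> R) a := exists F r,
  [/\ 0 < r, punctured_holo F a r, complex.Re (F a) = phi a &
      forall z, cmod (z - a) < r -> complex.Re (F z) <= phi z].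

Lemma ccont_comb F G a c : ccont F a -> ccont G a -> ccont (fun z => F z + c * G z) a.
Proof.
move=> hF hG e e0; have K0 : 0 < 2 * (cmod c + 1) by have := cmod_ge0 c; lra.
have [d d0 {}hF] := hF _ (divr_gt0 e0 (ltr0Sn _ 1)).
have [d' d'0 {}hG] := hG _ (divr_gt0 e0 K0).
exists (Num.min d d'); first by rewrite lt_min d0.
move=> z; rewrite lt_min => /andP[/hF h1 /hG h2].
have -> : F z + c * G z - (F a + c * G a) = (F z - F a) + c * (G z - G a) by ring.
apply: le_trans (cmodD _ _) _; rewrite cmodM.
have : cmod c * cmod (G z - G a) <= (cmod c + 1) * (e / (2 * (cmod c + 1))).
  by apply: ler_pM => //; rewrite ?cmod_ge0 //; lra.
have -> : (cmod c + 1) * (e / (2 * (cmod c + 1))) = e / 2 by field; lra.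
lra.
Qed.

(** If [phi] were positive somewhere, [phi + k |z|^2] with suitable [k] would have its
    maximum at an interior point [a].  There the harmonic minorant, corrected by
    the linear part of [k |z|^2] at [a], falls by [k * r^2] on a small circle of
    radius [r] about [a], because [|z|^2 - |a|^2 - 2 Re (a^* (z - a)) = |z - a|^2].
    No mean value property allows this. *)
Lemma maximum_principle (phi : R[i] -> R) :
  (forall a, cmod a <= 1 -> rcont phi a) ->
  (forall a, cmod a = 1 -> phi a <= 0) ->
  (forall a, cmod a < 1 -> local_minorant phi a) ->
  forall z, cmod z < 1 -> phi z <= 0.
Proof.
move=> cphi phi1 phim z0 z01; rewrite leNgt; apply/negP => pz.
pose k := phi z0 / 2; have k0 : 0 < k by rewrite divr_gt0.
pose psi z := phi z + k * cmod z ^+ 2.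
pose D : set (R * R) := [set p | cmod (p.1 +i* p.2) <= 1].
have cn (z w : R[i]) : cmod (z - w) < 1 -> `|cmod z ^+ 2 - cmod w ^+ 2| <=
    (2 * cmod w + 1) * cmod (z - w).
  move=> zw; rewrite subr_sqr normrM mulrC.
  have t1 : cmod z <= cmod w + cmod (z - w).
    by rewrite -[X in cmod X <= _](subrK w) addrC [leRHS]addrC addrC cmodD.
  have t2 : cmod w <= cmod z + cmod (z - w).
    by rewrite cmodB -[X in cmod X <= _](subrK z) addrC [leRHS]addrC addrC cmodD.
  have c1 := cmod_ge0 z; have c2 := cmod_ge0 w.
  apply: ler_pM => //; last by rewrite ler_norml; lra.
  by rewrite ger0_norm ?addr_ge0 //; lra.
have cpsi a : cmod a <= 1 -> rcont psi a.
  move=> a1 e e0; have e20 : 0 < e / 2 by rewrite divr_gt0.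
  have [d d0 h] := cphi a a1 _ e20.
  have K0 : 0 < 2 * k * 3 by lra.
  exists (Num.min d (Num.min 1 (e / (2 * k * 3)))).
    by rewrite !lt_min d0 ltr01 divr_gt0.
  move=> z; rewrite !lt_min => /and3P[/h h1 h2 h3].
  have -> : psi z - psi a = (phi z - phi a) + k * (cmod z ^+ 2 - cmod a ^+ 2).
    by rewrite /psi; ring.
  apply: le_trans (ler_normD _ _) _; rewrite normrM (gtr0_norm k0).
  have : k * `|cmod z ^+ 2 - cmod a ^+ 2| <= k * (3 * (e / (2 * k * 3))).
    rewrite ler_wpM2l ?(ltW k0) //; apply: le_trans (cn _ _ h2) _.
    by apply: ler_pM; rewrite ?cmod_ge0 ?(ltW h3) //; have := cmod_ge0 a; lra.
  have -> : k * (3 * (e / (2 * k * 3))) = e / 2 by field; lra.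
  lra.
have Dne : D !=set0 by exists (0, 0); rewrite /D /= cmod0.
have cD : compact D.
  have cB : compact ((`[-1, 1] : set R) `*` (`[-1, 1] : set R)).
    by apply: compact_setX; exact: segment_compact.
  apply: (subclosed_compact _ cB).
  - apply: (@closed_comp _ _ (fun p : R * R => cmod (p.1 +i* p.2)) [set x : R | x <= 1]); last exact: closed_le.
    move=> [x y] _; apply: (@rcont_pair (@cmod R)) => e e0; exists e => // z ze.
    have t1 : cmod z <= cmod (x +i* y) + cmod (z - (x +i* y)).
      by rewrite -[X in cmod X <= _](subrK (x +i* y)) addrC [leRHS]addrC addrC cmodD.
    have t2 : cmod (x +i* y) <= cmod z + cmod (z - (x +i* y)).
      by rewrite [cmod (_ - _)]cmodB -[X in cmod X <= _](subrK z) addrC [leRHS]addrC addrC cmodD.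
    rewrite ler_norml; lra.
  - move=> [x y] /= h; split; rewrite /= in_itv /= -ler_norml.
      exact: le_trans (Re_le_cmod (x +i* y)) h.
    exact: le_trans (Im_le_cmod (x +i* y)) h.
have : {within D, continuous (fun p : R * R => psi (p.1 +i* p.2))}.
  apply: continuous_in_subspaceT => -[x y]; rewrite inE => Dxy.
  exact: rcont_pair (cpsi _ Dxy).
move=> /(compact_EVT_max Dne cD) [[x y]]; rewrite inE /D /= => Da maxa.
set a := x +i* y in Da.
have {}maxa z : cmod z <= 1 -> psi z <= psi a.
  by case: z => s t h; have := maxa (s, t); rewrite inE; exact.
have pa : phi z0 <= psi a.
  apply: le_trans (maxa _ (ltW z01)); rewrite /psi lerDl.
  by rewrite mulr_ge0 ?sqr_ge0 // ltW.
have a1 : cmod a < 1.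
  rewrite lt_neqAle Da andbT; apply/eqP => ca1.
  by have := phi1 _ ca1; move: pa; rewrite /psi ca1 /k; lra.
have [F [r [r0 [Fc Fd] Fa Fm]]] := phim a a1.
pose r2 := Num.min r (1 - cmod a).
have r20 : 0 < r2 by rewrite /r2 lt_min r0; lra.
pose G z := F z + (2 * k)%:C * (a^* * z - a^* * a).
have Gp : punctured_holo G a r.
  split; last first.
    move=> z /Fd hz; apply: cdiffD => //; apply: cdiffZ; apply: cdiffB (cdiff_cst _ _).
    exact: cdiffZ (cdiff_id _).
  apply: (@ccont_comb F (fun z => a^* * z - a^* * a)) => //; apply: cdiff_ccont.
  by apply: cdiffB (cdiff_cst _ _); exact: cdiffZ (cdiff_id _).
have hr : 0 < r2 / 2 < r.
  have : r2 <= r by rewrite /r2 ge_min lexx.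
  lra.
apply: (mean_value_no_strict_max Gp hr (k := k * (r2 / 2) ^+ 2)).
  by rewrite mulr_gt0 // exprn_gt0 // divr_gt0.
move=> z zr; have zr' : cmod (z - a) < r by lra.
have zl : cmod z <= 1.
  have : cmod z <= cmod a + cmod (z - a).
    by rewrite -[X in cmod X <= _](subrK a) addrC [leRHS]addrC addrC cmodD.
  have : r2 <= 1 - cmod a by rewrite /r2 ge_min lexx orbT.
  lra.
have := maxa z zl; have := Fm z zr'; rewrite /psi -zr !cmod_sqr /G !reimE Fa /=.
move: (complex.Re z) (complex.Im z) => s t; lra.
Qed.
End MaximumPrinciple.

(** * The Szego minorant *)
Section DividedDifference.
Context {R : realType}.
Implicit Types (F G h : R[i] -> R[i]) (a b c z : R[i]) (r : R).

Definition divdiff h a c z := if z == a then c else (h z - h a) / (z - a).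

Lemma divdiff_ccont h a c : has_cderiv h a c -> ccont (divdiff h a c) a.
Proof.
move=> hc e e0; have [d d0 hd] := hc e e0; exists d => // z /hd {}hd.
rewrite /divdiff eqxx; case: eqVneq => [_|za]; first by rewrite subrr cmod0 ltW.
have za0 : 0 < cmod (z - a) by rewrite cmod_gt0 subr_eq0.
rewrite -(ler_pM2r za0) -cmodM.
have -> : ((h z - h a) / (z - a) - c) * (z - a) = h z - h a - c * (z - a).
  by field; rewrite subr_eq0.
exact: hd.
Qed.

Lemma divdiff_cdiff h a c z : z != a -> cdiff h z -> cdiff (divdiff h a c) z.
Proof.
move=> za hz; have za0 : 0 < cmod (z - a) by rewrite cmod_gt0 subr_eq0.
apply: (@cdiff_ext _ (fun w => (h w - h a) * (w - a)^-1) _ _ _ za0).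
  move=> w wz; rewrite /divdiff; case: eqVneq => // wa.
  by move: wz; rewrite wa cmodB ltxx.
apply: cdiffM; first exact: cdiffB hz (cdiff_cst _ _).
by apply: cdiffV; [rewrite subr_eq0 | exact: cdiffB (cdiff_id _) (cdiff_cst _ _)].
Qed.

(** A divided difference at [a] extends holomorphically over [a], but the maximum
    principle asks only for continuity there, which is immediate from the
    derivative. *)
Definition holo_off r a F :=
  ccont F a /\ forall z, cmod z < r -> z != a -> cdiff F z.

Lemma holo_off_holo r a F : cmod a < r ->
  (forall z, cmod z < r -> cdiff F z) -> holo_off r a F.
Proof. by move=> ar h; split=> [|z /h //]; apply/cdiff_ccont/h. Qed.

Lemma holo_off_comb r a F G c : holo_off r a F -> holo_off r a G ->
  holo_off r a (fun z => F z + c * G z).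
Proof.
move=> [h1 h2] [h3 h4]; split; first exact: ccont_comb.
by move=> z zr za; apply: cdiffD; [exact: h2 | apply: cdiffZ; exact: h4].
Qed.

Lemma holo_off_divdiff r a h c : cmod a < r -> has_cderiv h a c ->
  (forall z, cmod z < r -> cdiff h z) -> holo_off r a (divdiff h a c).
Proof.
move=> ar hc hd; split; first exact: divdiff_ccont.
by move=> z zr za; apply: divdiff_cdiff => //; exact: hd.
Qed.

Lemma holo_off_sum r a (I : Type) (s : seq I) (F : I -> R[i] -> R[i]) : cmod a < r ->
  (forall i, holo_off r a (F i)) -> holo_off r a (fun z => \sum_(i <- s) F i z).
Proof.
move=> ar h; elim: s => [|i s IH].
  have -> : (fun z => \sum_(i <- [::]) F i z) = (fun=> 0).
    by apply/funext => z; rewrite big_nil.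
  by apply: holo_off_holo => // z _; exact: cdiff_cst.
have -> : (fun z => \sum_(j <- i :: s) F j z) = (fun z => F i z + 1 * \sum_(j <- s) F j z).
  by apply/funext => z; rewrite big_cons mul1r.
exact: holo_off_comb.
Qed.

Lemma holo_off_ccont r a F z : holo_off r a F -> cmod z < r -> ccont F z.
Proof.
by move=> [h1 h2] zr; case: (eqVneq z a) => [->//|za]; apply/cdiff_ccont/h2.
Qed.

Lemma holo_off_punctured r a F b : holo_off r a F -> cmod b < r ->
  exists2 d, 0 < d & punctured_holo F b d.
Proof.
move=> hF br; have [ba|ba] := eqVneq b a.
  exists (r - cmod b); first lra.
  split; first exact: holo_off_ccont hF br.
  move=> z /andP[z0 zb]; apply: hF.2; last by rewrite -ba -subr_eq0 -cmod_gt0.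
  by have := cmodD (z - b) b; rewrite subrK; lra.
have ab : 0 < cmod (b - a) by rewrite cmod_gt0 subr_eq0.
exists (Num.min (r - cmod b) (cmod (b - a))); first by rewrite lt_min ab; lra.
split; first exact: holo_off_ccont hF br.
move=> z /andP[_]; rewrite lt_min => /andP[z1 z2]; apply: hF.2.
  by have := cmodD (z - b) b; rewrite subrK; lra.
by apply/eqP => za; move: z2; rewrite za cmodB ltxx.
Qed.

Lemma ccont_Re F a : ccont F a -> rcont (fun z => complex.Re (F z)) a.
Proof.
move=> h e /h [d d0 hd]; exists d => // z /hd; apply: le_trans.
by rewrite -cReN -cReD Re_le_cmod.
Qed.

Lemma Re_half z : complex.Re z = complex.Re ((z + z^*) / 2).
Proof. by rewrite -ReJ_add. Qed.

Lemma circle_conj z : cmod z = 1 -> z != 0 /\ z^* = z^-1.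
Proof.
move=> z1; have z0 : z != 0 by rewrite -cmod_gt0 z1.
split=> //; apply: (mulfI z0); rewrite mulcJ z1 expr1n mulfV //.
Qed.

(** With [B z = (1 - l^* z)^-1] and [c = h l * (1 - |l|^2)], the function
    [|h|^2 - |h - c B|^2] is at most [|h|^2], and on the unit circle it equals
    [2 Re (h conj (c B)) - |c|^2 |B|^2].  Both terms extend harmonically to the disc:
    [conj B] is [z / (z - l)] on the circle, whose pole is moved to the conjugate
    side, where it does no harm; and [|B|^2] is the Poisson kernel up to a factor.
    The value at 0 of the extension is [|h l|^2 (1 - |l|^2)], by the reproducing
    property of the Szego kernel.  The factor [z] in the divided difference comes
    from [z / (z - l)]. *)
Lemma szego_minorant h l r : cmod l < 1 -> 1 < r -> r * cmod l <= 1 ->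
  (forall z, cmod z < r -> cdiff h z) ->
  exists Q, [/\ holo_off r l Q,
    (forall z, cmod z = 1 -> complex.Re (Q z) <= cmod (h z) ^+ 2) &
    complex.Re (Q 0) = cmod (h l) ^+ 2 * (1 - cmod l ^+ 2)].
Proof.
move=> l1 r1 rl hd; have lr : cmod l < r by lra.
have lp z : cmod z < r -> 1 - l^* * z != 0.
  move=> zr; rewrite subr_eq0; apply/eqP => e.
  have : cmod (l^* * z) = 1 by rewrite -e cmod1.
  rewrite cmodM cmod_conj => e1.
  have l0 : 0 < cmod l.
    by rewrite lt_def cmod_ge0 andbT; apply/eqP => l0; move: e1; rewrite l0 mul0r; lra.
  have : cmod l * cmod z < cmod l * r by rewrite ltr_pM2l.
  rewrite e1 mulrC; lra.
have ll : 1 - l * l^* != 0 by rewrite mulrC; exact: lp.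
have [g' hg'] := hd _ lr.
have hg := has_cderivM (has_cderiv_id l) hg'.
set g := (X in has_cderiv _ _ X) in hg.
have [k kE] : exists k, k = 1 - l * l^* by eexists.
pose c := h l * k.
have kJ : k^* = k by rewrite kE rmorphB rmorph1 rmorphM /= conjcK mulrC.
pose E z := z / (1 - l^* * z).
pose K z := (1 + l^* * z) / (1 - l^* * z).
have Ed z : cmod z < r -> cdiff (fun z => (1 - l^* * z)^-1) z.
  move=> zr; apply: cdiffV; first exact: lp.
  exact: cdiffB (cdiff_cst _ _) (cdiffZ _ (cdiff_id _)).
have hE : holo_off r l E.
  by apply: holo_off_holo => // z zr; apply: cdiffM (cdiff_id _) (Ed _ zr).
have hK : holo_off r l K.
  apply: holo_off_holo => // z zr; apply: cdiffM (Ed _ zr).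
  exact: cdiffD (cdiff_cst _ _) (cdiffZ _ (cdiff_id _)).
have hD : holo_off r l (divdiff (fun z => z * h z) l g).
  by apply: holo_off_divdiff => // z zr; apply: cdiffM (cdiff_id _) (hd _ zr).
(* the divided difference removes the pole of 2 c^* h z / (z - l); the term with E
   is the conjugate of the pole part and restores the real part; the term with K
   is the Poisson kernel *)
pose Q z := 0 + (2 * c^*) * divdiff (fun z => z * h z) l g z
  + (2 * (c^* * l * h l)^*) * E z + (- (c * c^* / k)) * K z.
exists Q; split.
- do 3 apply: holo_off_comb => //.
  by apply: holo_off_holo => // z _; exact: cdiff_cst.
- move=> z z1; have [z0 zJ] := circle_conj z1.
  have zl : z != l by apply/eqP => zl; move: z1; rewrite zl; lra.
  have zr : cmod z < r by rewrite z1.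
  have := lp z zr => lz.
  have zl0 : z - l != 0 by rewrite subr_eq0.
  (* on the circle z^* = 1 / z, so the conjugate of 1 / (1 - l^* z) is z / (z - l) *)
  pose B := (1 - l^* * z)^-1; pose B' := z / (z - l).
  have BJ : B^* = B'.
    rewrite /B fmorphV rmorphB rmorph1 rmorphM /= conjcK zJ /B'.
    by field; rewrite zl0 z0.
  have B'J : B'^* = B by rewrite -BJ conjcK.
  pose Y := c^* * l * h l * B' * z^-1.
  have YJ : Y^* = (c^* * l * h l)^* * B * z.
    by rewrite /Y 2!rmorphM /= B'J conjc_inv zJ invrK.
  have eQ : Q z = 2 * (c^* * h z * B' - Y) + 2 * Y^* - c * c^* / k * K z.
    rewrite /Q /divdiff (negbTE zl) /E add0r YJ /Y /B /B' -!addrA; congr (_ + _).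
      by field; rewrite z0 zl0.
    by congr (_ + _); [rewrite -!mulrA; congr (_ * (_ * _)); rewrite mulrC | rewrite mulNr].
  have eK : K z + (K z)^* = 2 * k * B * B'.
    rewrite /K rmorphM rmorphD rmorph1 rmorphM /= conjcK -/B BJ zJ /B /B' kE.
    by field; rewrite lz zl0 z0.
  suff e : (Q z + (Q z)^*) / 2 = h z * (h z)^* - (h z - c * B) * (h z - c * B)^*.
    by rewrite Re_half e !mulcJ -rmorphB /= lerBlDr lerDl sqr_ge0.
  have QJ : (Q z)^* = 2 * (c * (h z)^* * B - Y^*) + 2 * Y - c * c^* / k * (K z)^*.
    have J (a1 a2 a3 a4 a5 : R[i]) : (2 * (a1 - a2) + 2 * a3 - a4 * a5)^* =
        2 * (a1^* - a2^*) + 2 * a3^* - a4^* * a5^*.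
      by rewrite !(rmorph_nat, rmorphB, rmorphD, rmorphM).
    have J3 (a1 a2 a3 : R[i]) : (a1 * a2 * a3)^* = a1^* * a2^* * a3^*.
      by rewrite !rmorphM.
    by rewrite eQ J (J3 c^* (h z)) (J3 c c^*) conjc_inv !conjcK kJ B'J [c^* * c]mulrC.
  have k0 : k != 0 by rewrite kE.
  have -> : Q z + (Q z)^* = 2 * (c^* * h z * B' + c * (h z)^* * B)
      - c * c^* / k * (K z + (K z)^*) by rewrite QJ eQ; ring.
  have J2 (a1 a2 a3 : R[i]) : (a1 - a2 * a3)^* = a1^* - a2^* * a3^*.
    by rewrite !(rmorphB, rmorphM).
  by rewrite eK J2 BJ; field.
- rewrite /Q /divdiff /E /K !(mulr0, mul0r, subr0, addr0, add0r).
  have -> : (if 0 == l then g else - (l * h l) / - l) = h l.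
    case: eqVneq => [l0|l0]; last by field; rewrite eq_sym.
    by rewrite /g -l0 mul0r add0r mulr1.
  rewrite divr1 mulr1.
  have hlJ : c^* = (h l)^* * k by rewrite /c rmorphM /= kJ.
  suff -> : 2 * c^* * h l - c * c^* / k = (cmod (h l) ^+ 2 * (1 - cmod l ^+ 2))%:C by [].
  have -> : (cmod (h l) ^+ 2 * (1 - cmod l ^+ 2))%:C = h l * (h l)^* * k.
    by rewrite kE !mulcJ rmorphM rmorphB rmorph1.
  rewrite hlJ /c.
  by field; rewrite kE.
Qed.
End DividedDifference.

(** * Estimates for functions on the disc *)
Section DiscEstimates.
Context {R : realType}.
Implicit Types (F G : R[i] -> R[i]) (a b c z : R[i]) (r s : R).

(** Superharmonicity by touching: a holomorphic function whose real part lies above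
    [v] and meets it at [b].  Minima of real parts of holomorphic functions and of
    constants have this property. *)
Definition superharmonic (v : R[i] -> R) := forall b, cmod b < 1 -> exists F r,
  [/\ 0 < r, forall z, cmod (z - b) < r -> cdiff F z, complex.Re (F b) = v b &
      forall z, cmod (z - b) < r -> v z <= complex.Re (F z)].

Lemma rcont_comb (p q : R[i] -> R) k a : rcont p a -> rcont q a ->
  rcont (fun z => p z + k * q z) a.
Proof.
move=> hp hq e e0; have K0 : 0 < 2 * (`|k| + 1) by have := normr_ge0 k; lra.
have [d d0 {}hp] := hp _ (divr_gt0 e0 (ltr0Sn _ 1)).
have [d' d'0 {}hq] := hq _ (divr_gt0 e0 K0).
exists (Num.min d d'); first by rewrite lt_min d0.
move=> z; rewrite lt_min => /andP[/hp h1 /hq h2].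
have -> : p z + k * q z - (p a + k * q a) = (p z - p a) + k * (q z - q a) by ring.
apply: le_trans (ler_normD _ _) _; rewrite normrM.
have : `|k| * `|q z - q a| <= (`|k| + 1) * (e / (2 * (`|k| + 1))).
  by apply: ler_pM => //; rewrite ?normr_ge0 //; lra.
have -> : (`|k| + 1) * (e / (2 * (`|k| + 1))) = e / 2 by field; lra.
lra.
Qed.

(** The mean of [|h|^2] over the circle is at most that of [A * v], hence at most
    [A * v 0], and it dominates [|h l|^2 (1 - |l|^2)] by [szego_minorant].  The two
    means are compared by the maximum principle applied to the minorant minus
    [A * v], without integrating. *)
Lemma hardy_bound n (h : 'I_n -> R[i] -> R[i]) (v : R[i] -> R) A r :
  1 < r -> 0 <= A ->
  (forall k z, cmod z < r -> cdiff (h k) z) ->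
  (forall z, cmod z <= 1 -> rcont v z) -> superharmonic v ->
  (forall z, cmod z = 1 -> \sum_(k < n) cmod (h k z) ^+ 2 <= A * v z) ->
  forall l, cmod l < 1 ->
  (\sum_(k < n) cmod (h k l) ^+ 2) * (1 - cmod l ^+ 2) <= A * v 0.
Proof.
move=> r1 A0 hd vc vs hv l l1.
have [s [s1 sr sl]] : exists s, [/\ 1 < s, s <= r & s * cmod l <= 1].
  have := cmod_ge0 l; rewrite le_eqVlt => /orP[/eqP l0|l0].
    by exists r; rewrite -l0 mulr0.
  exists (Num.min r (cmod l)^-1); split.
  - by rewrite lt_min r1 invf_gt1.
  - by rewrite ge_min lexx.
  - by rewrite -ler_pdivlMr // div1r ge_min lexx orbT.
have hd' k z : cmod z < s -> cdiff (h k) z by move=> zs; apply: hd; lra.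
have [Q hQ] := choice (fun k => szego_minorant l1 s1 sl (hd' k)).
have ls : cmod l < s by lra.
pose P z := \sum_(k < n) Q k z.
have hP : holo_off s l P by apply: holo_off_sum => // k; case: (hQ k).
have : complex.Re (P 0) + - A * v 0 <= 0.
  apply: (maximum_principle (phi := fun z => complex.Re (P z) + - A * v z)).
  - move=> a a1; apply: rcont_comb; last exact: vc.
    by apply/ccont_Re/(holo_off_ccont hP); lra.
  - move=> a a1; rewrite mulNr subr_le0; apply: le_trans (hv a a1).
    by rewrite Re_sum; apply: ler_sum => k _; case: (hQ k) => _ + _; exact.
  - move=> a a1; have [|d d0 [Pc Pd]] := holo_off_punctured (b := a) hP; first lra.
    have [F [d' [d'0 Fd Fa Fm]]] := vs a a1.
    exists (fun z => P z + (- A)%:C * F z), (Num.min d d'); split.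
    + by rewrite lt_min d0.
    + split.
        apply: ccont_comb => //; apply/cdiff_ccont/Fd.
        by rewrite subrr cmod0.
      move=> z /andP[z0]; rewrite lt_min => /andP[z1 z2].
      by apply: cdiffD; [apply: Pd; rewrite z0 | apply: cdiffZ; exact: Fd].
    + by rewrite cReD cReM /= mul0r subr0 Fa.
    + move=> z; rewrite lt_min => /andP[z1 z2].
      rewrite cReD cReM /= mul0r subr0 lerD2l !mulNr lerN2 ler_wpM2l //.
      exact: Fm.
  - by rewrite cmod0.
rewrite mulNr subr_le0; apply: le_trans; rewrite Re_sum mulr_suml.
by rewrite le_eqVlt; apply/orP; left; apply/eqP/eq_bigr => k _; case: (hQ k).
Qed.

(** The Caratheodory bound: integrate [Re F * (1 - Re (k^* z))], which is
    nonnegative, over the circle, where the unimodular [k] rotates [c] to a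
    positive number.  Instead of integrating, the function [S] below has
    this product as its real part on the circle, and
    [Re (S 0) = Re (F 0) - |c| / 2]. *)
Lemma positive_real_part_deriv F c r : 1 < r ->
  (forall z, cmod z < r -> cdiff F z) -> has_cderiv F 0 c ->
  (forall z, cmod z = 1 -> 0 <= complex.Re (F z)) ->
  cmod c <= 2 * complex.Re (F 0).
Proof.
move=> r1 Fd Fc Fp.
have [->|c0] := eqVneq c 0.
  rewrite cmod0 mulr_ge0 // -oppr_le0.
  apply: (maximum_principle (phi := fun z => - complex.Re (F z))); last by rewrite cmod0.
  - move=> a a1; have {}a1 : cmod a < r by lra.
    move=> e e0; have [d d0 hd] := ccont_Re (cdiff_ccont (Fd a a1)) e0.
    by exists d => // z /hd; rewrite -opprD normrN.
  - by move=> a /Fp; rewrite oppr_le0.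
  - move=> a a1; exists (fun z => - F z), (1 - cmod a); split.
    + lra.
    + have ha z : cmod (z - a) < 1 - cmod a -> cmod z < r.
        by have := cmodD (z - a) a; rewrite subrK; lra.
      split=> [|z /andP[_ za]]; last exact/cdiffN/Fd/ha.
      by apply/cdiff_ccont/cdiffN/Fd; lra.
    + by rewrite cReN.
    + by move=> z _; rewrite cReN.
have cc : 0 < cmod c by rewrite cmod_gt0.
have ccC : (cmod c)%:C != 0 by rewrite -(rmorph0 (real_complex R)) (inj_eq (@complexI _)) gt_eqF.
have [k k1 kc] : exists2 k, cmod k = 1 & k * c = (cmod c)%:C.
  exists (c^* / (cmod c)%:C).
    by rewrite cmodM cmodV cmod_conj cmodR gtr0_norm // mulfV // gt_eqF.
  by rewrite mulrAC [c^* * c]mulrC mulcJ rmorphXn expr2 /= mulfK.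
have r0 : cmod (0 : R[i]) < r by rewrite cmod0; lra.
(* Re S = (Re F) (1 - Re (k^* z)) >= 0 on the circle *)
pose S z := F z + (- 2^-1) * ((k^* * (z * F z) + k * divdiff F 0 c z) + k^* * ((F 0)^* * z)).
have hS : holo_off r 0 S.
  apply: holo_off_comb; first exact: holo_off_holo.
  apply: holo_off_comb; last first.
    by apply: holo_off_holo => // z _; apply: cdiffZ (cdiff_id _).
  apply: holo_off_comb; last exact: holo_off_divdiff.
  by apply: holo_off_holo => // z zr; apply: cdiffZ; apply: cdiffM (cdiff_id _) (Fd _ zr).
suff : - complex.Re (S 0) <= 0.
  rewrite oppr_le0 /S /divdiff eqxx !mulr0 mul0r mulr0 add0r addr0 kc.
  have -> : - 2^-1 = (- 2^-1)%:C :> R[i] by rewrite rmorphN fmorphV rmorph_nat.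
  rewrite cReD cReM /= mul0r subr0; lra.
apply: (maximum_principle (phi := fun z => - complex.Re (S z))); last by rewrite cmod0.
- move=> a a1; have {}a1 : cmod a < r by lra.
  move=> e e0; have [d d0 hd] := ccont_Re (holo_off_ccont hS a1) e0.
  by exists d => // z /hd; rewrite -opprD normrN.
- move=> z z1; rewrite oppr_le0.
  have [z0 zJ] := circle_conj z1.
  suff -> : complex.Re (S z) = complex.Re (F z) * (1 - complex.Re (k^* * z)).
    rewrite mulr_ge0 ?Fp // subr_ge0; apply: le_trans (ler_norm _) _.
    by apply: le_trans (Re_le_cmod _) _; rewrite cmodM cmod_conj k1 mul1r z1.
  have -> : S z = F z - 2^-1 * (k^* * z * F z + k * z^* * F z) +
      2^-1 * (k * F 0 * z^* - (k * F 0 * z^*)^*).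
    rewrite /S /divdiff (negbTE z0) 2!rmorphM /= zJ conjc_inv zJ invrK.
    by field; rewrite z0.
  have -> : k * z^* = (k^* * z)^* by rewrite rmorphM /= conjcK.
  move: (k^* * z) (F z) (k * F 0 * z^*) => [x1 x2] [y1 y2] [w1 w2].
  have -> : 2^-1 = (2^-1)%:C :> R[i] by rewrite fmorphV rmorph_nat.
  rewrite /=; lra.
- move=> a a1; have [|d d0 [Sc Sd]] := holo_off_punctured (b := a) hS; first lra.
  exists (fun z => - S z), d; split=> //.
  + split; last by move=> z /Sd /cdiffN.
    move=> e /Sc [d' d'0 h]; exists d' => // z /h.
    by rewrite -opprD cmodN.
  + by rewrite cReN.
  + by move=> z _; rewrite cReN.
Qed.

(** Rescaling to radii [s < r], then letting [s] tend to [r]: positivity is known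
    only inside the open disc. *)
Lemma positive_real_part_deriv_scaled F c r : 0 < r ->
  (forall z, cmod z < r -> cdiff F z) -> has_cderiv F 0 c ->
  (forall z, cmod z < r -> 0 <= complex.Re (F z)) ->
  cmod c * r <= 2 * complex.Re (F 0).
Proof.
move=> r0 Fd Fc Fp.
have H s : 0 < s < r -> cmod c * s <= 2 * complex.Re (F 0).
  move=> /andP[s0 sr].
  have rs : 1 < r / s by rewrite ltr_pdivlMr // mul1r.
  have scale z : cmod (s%:C * z) = s * cmod z by rewrite cmodM cmodR gtr0_norm.
  have hs : has_cderiv (fun z => s%:C * z) 0 s%:C.
    by have := has_cderivZ s%:C (has_cderiv_id 0); rewrite mulr1.
  have -> : cmod c * s = cmod (c * s%:C) by rewrite cmodM cmodR gtr0_norm.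
  have -> : F 0 = F (s%:C * 0) by rewrite mulr0.
  apply: (@positive_real_part_deriv (fun z => F (s%:C * z)) _ _ rs).
  - move=> z zr; apply: (@cdiff_comp _ (fun z => s%:C * z)); first by apply: cdiffZ (cdiff_id _).
    by apply: Fd; rewrite scale mulrC -ltr_pdivlMr.
  - by apply: has_cderiv_comp hs _; rewrite mulr0.
  - by move=> z z1; apply: Fp; rewrite scale z1 mulr1.
rewrite leNgt; apply/negP => lt.
have F0 : 0 <= complex.Re (F 0) by apply: Fp; rewrite cmod0.
have c0 : 0 < cmod c.
  rewrite lt_def cmod_ge0 andbT; apply/eqP => c0; move: lt; rewrite c0 mul0r; lra.
pose K := 2 * complex.Re (F 0) / cmod c.
have Kr : K < r by rewrite /K ltr_pdivrMr // [r * _]mulrC.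
have K0 : 0 <= K by apply: divr_ge0; lra.
have Km : 0 < (K + r) / 2 < r by apply/andP; split; lra.
have := H _ Km; have : cmod c * K = 2 * complex.Re (F 0) by rewrite /K; field; lra.
have : cmod c * K < cmod c * r by rewrite ltr_pM2l.
lra.
Qed.
End DiscEstimates.

(** * Discs and the Kobayashi distance *)
Section HolomorphicDiscs.
Context {R : realType} {n : nat}.
Implicit Types (G : set 'rV[R[i]]_n) (f : R[i] -> 'rV[R[i]]_n) (a b z : R[i]).

Lemma posC_real (e : R[i]) : 0 < e -> exists2 d : R, 0 < d & e = d%:C.
Proof.
case: e => x y; rewrite ltcE /= => /andP[/eqP -> x0].
by exists x.
Qed.

Lemma derivable_coord_cdiff f a k : derivable f a 1 -> cdiff (fun z => f z ord0 k) a.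
Proof.
move=> /cvg_ex[/= l hl]; exists (l ord0 k) => e e0.
have := cvg_comp _ _ hl (@coord_continuous R[i] 1 n ord0 k l).
move/cvgrPdist_le => /(_ e%:C); rewrite ltcR => /(_ e0).
rewrite near_withinE => -[d /= d0 h].
have [d' d'0 dE] := posC_real d0; exists d' => // z za.
have [->|za0] := eqVneq z a.
  by rewrite !subrr mulr0 subr0 cmod0 mulr0.
have zn : z - a != 0 by rewrite subr_eq0.
have := h (z - a); rewrite /= sub0r normrN dE !normC_cmod ltcR => /(_ za zn).
rewrite lecR => hh.
have -> : f z ord0 k - f a ord0 k - l ord0 k * (z - a) =
   - ((l ord0 k - ((z - a)^-1 *: (f ((z - a) *: 1 + a) - f a)) ord0 k) * (z - a)).
  by rewrite !mxE [_ *: 1]mulr1 subrK; field; rewrite subr_eq0.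
by rewrite cmodN cmodM ler_wpM2r ?cmod_ge0.
Qed.

Definition hdisc G f := forall a, cmod a < 1 ->
  (forall k, cdiff (fun z => f z ord0 k) a) /\ G (f a).

Lemma holomorphic_disc_hdisc G f : holomorphic_disc G f -> hdisc G f.
Proof. by move=> h a /h[fa Ga]; split => // k; exact: derivable_coord_cdiff. Qed.

Definition mob a z := (z + a) / (1 + a^* * z).

Lemma mob_den a z : cmod a < 1 -> cmod z < 1 -> 1 + a^* * z != 0.
Proof.
move=> a1 z1; apply/eqP => e.
have : cmod (a^* * z) = 1.
  have -> : a^* * z = - 1 by apply/eqP; rewrite -addr_eq0 addrC e.
  by rewrite cmodN cmod1.
rewrite cmodM cmod_conj => az; have : cmod a * cmod z <= cmod a.
  by rewrite ler_piMr ?cmod_ge0 // ltW.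
lra.
Qed.

Lemma mob_disc a z : cmod a < 1 -> cmod z < 1 -> cmod (mob a z) < 1.
Proof.
move=> a1 z1; have d0 := mob_den a1 z1.
rewrite /mob cmodM cmodV ltr_pdivrMr ?cmod_gt0 // mul1r.
rewrite -(@ltr_pXn2r _ 2) ?nnegrE ?cmod_ge0 //.
have sq (x : R[i]) : cmod x < 1 -> cmod x ^+ 2 < 1 by move=> x1; rewrite expr_lt1 ?cmod_ge0.
have a2 := sq _ a1; have z2 := sq _ z1.
have : 0 < (1 - cmod a ^+ 2) * (1 - cmod z ^+ 2) by rewrite mulr_gt0 ?subr_gt0.
rewrite !cmod_sqr; case: a z {a1 z1 a2 z2 d0} => [a1 a2] [z1 z2] /=; lra.
Qed.

Lemma mob_cdiff a z : cmod a < 1 -> cmod z < 1 -> cdiff (mob a) z.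
Proof.
move=> a1 z1; apply: cdiffM; first exact: cdiffD (cdiff_id _) (cdiff_cst _ _).
apply: cdiffV; first exact: mob_den.
exact: cdiffD (cdiff_cst _ _) (cdiffZ _ (cdiff_id _)).
Qed.

Lemma hdisc_mob G f a : cmod a < 1 -> hdisc G f -> hdisc G (fun z => f (mob a z)).
Proof.
move=> a1 hf z z1; have [fd Gf] := hf _ (mob_disc a1 z1); split=> // k.
exact: (@cdiff_comp _ _ (fun w => f w ord0 k) _ (mob_cdiff a1 z1) (fd k)).
Qed.

Lemma hdisc_rot G f c : cmod c = 1 -> hdisc G f -> hdisc G (fun z => f (c * z)).
Proof.
move=> c1 hf z z1; have cz : cmod (c * z) < 1 by rewrite cmodM c1 mul1r.
have [fd Gf] := hf _ cz; split=> // k.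
exact: (@cdiff_comp _ (fun z => c * z) (fun w => f w ord0 k) _ (cdiffZ _ (cdiff_id _)) (fd k)).
Qed.

(** The slope at the centre of every disc is at most 1; since discs may be
    precomposed with Moebius maps this bounds the slope at every point, in the
    Poincare metric.  The factor [1 + e] is there because the barriers have corners
    and need not be differentiable along discs. *)
Definition disc_lipschitz G (Th : 'rV[R[i]]_n -> R) := forall f, hdisc G f ->
  forall e, 0 < e -> exists2 d : R, 0 < d & forall z, cmod z < d ->
    `|Th (f z) - Th (f 0)| <= (1 + e) * cmod z.

(** The Poincare distance from 0 to [t]. *)
Definition halflog (t : R) := 2^-1 * ln ((1 + t) / (1 - t)).

Lemma halflog_ge (t : R) : 0 <= t < 1 -> t <= (1 + t) * halflog t.
Proof.
move=> /andP[t0 t1].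
have p1 : 0 < 1 + t by lra. have p2 : 0 < 1 - t by lra.
have h : ln ((1 - t) / (1 + t)) <= - (2 * t) / (1 + t).
  have -> : (1 - t) / (1 + t) = 1 + (- (2 * t) / (1 + t)) by field; lra.
  by apply: le_ln1Dx; rewrite ltr_pdivlMr //; lra.
have e : ln ((1 + t) / (1 - t)) = - ln ((1 - t) / (1 + t)).
  by rewrite -lnV ?invf_div // posrE divr_gt0.
have : (1 + t) * ln ((1 - t) / (1 + t)) <= (1 + t) * (- (2 * t) / (1 + t)).
  by rewrite ler_pM2l.
have -> : (1 + t) * (- (2 * t) / (1 + t)) = - (2 * t) by field; lra.
rewrite /halflog e; lra.
Qed.

(** Invariance of the Poincare distance under the Moebius map that sends [s] to 0. *)
Lemma halflog_sub (s t : R) : 0 <= s -> s <= t -> t < 1 ->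
  halflog t - halflog s = halflog ((t - s) / (1 - s * t)).
Proof.
move=> s0 st t1; have st1 : 0 < 1 - s * t.
  by rewrite subr_gt0; apply: (@le_lt_trans _ _ s); [rewrite ler_piMr // ltW | lra].
have p : 0 < (1 + t) * (1 - s) by rewrite mulr_gt0 //; lra.
have q : 0 < (1 - t) * (1 + s) by rewrite mulr_gt0 //; lra.
rewrite /halflog -mulrBr -ln_div ?posrE; try by apply: divr_gt0; lra.
congr (_ * ln _); field; apply/and5P; split; lra.
Qed.

Lemma mob_real (s t : R) : 0 <= s -> s < 1 -> 0 <= t < 1 ->
  mob s%:C ((t - s) / (1 - s * t))%:C = t%:C.
Proof.
move=> s0 s1 /andP[t0 t1]; have st1 : 0 < 1 - s * t.
  by rewrite subr_gt0; apply: (@le_lt_trans _ _ s); [rewrite ler_piMr // ltW | lra].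
have ss : 0 < 1 - s * s.
  by rewrite subr_gt0; apply: (@le_lt_trans _ _ s); [rewrite ler_piMr // ltW | lra].
have e1 : (1 : R[i]) = 1%:C by [].
rewrite /mob conjc_real e1 -rmorphM -!rmorphD -fmorphV -rmorphM.
congr (_%:C); field; rewrite !gt_eqF //=; lra.
Qed.

(** Bisection of the segment from 0 to [x].  Near a point [a] of the segment, the
    Moebius map centred at [a] turns the Lipschitz condition into a bound by Poincare
    lengths, with one factor [1 + e] from that condition and one from comparing
    Euclidean and Poincare lengths of short segments; [halflog] adds up along the
    segment. *)
Lemma geodesic_bound G Th f (x : R) : disc_lipschitz G Th -> hdisc G f -> 0 <= x < 1 ->
  Th (f x%:C) - Th (f 0) <= halflog x.
Proof.
move=> hT hf /andP[x0 x1].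
pose F t := Th (f t%:C).
have key e : 0 < e -> F x - F 0 <= (1 + e) ^+ 2 * (halflog x - halflog 0).
  move=> e0.
  pose P k (s y : R) := 0 <= s -> s + x / 2 ^+ k <= x ->
    F (s + x / 2 ^+ k) - F s <= (1 + e) ^+ 2 * (halflog (s + x / 2 ^+ k) - halflog s).
  have -> : x = 0 + x / 2 ^+ 0 by rewrite expr0 divr1 add0r.
  suff : P 0%N 0 0 by apply; rewrite // expr0 divr1 add0r.
  apply: (@square_induction _ 0 0 x 0 P) => // [k s y p1 p2 _ _ s0|a b].
    have eT : x / 2 ^+ k = x / 2 ^+ k.+1 + x / 2 ^+ k.+1.
      by rewrite exprS; field; rewrite ?expf_neq0 ?pnatr_eq0.
    have xk : 0 <= x / 2 ^+ k.+1 by rewrite divr_ge0 // exprn_ge0.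
    rewrite eT addrA => sx.
    have h1 : F (s + x / 2 ^+ k.+1) - F s <=
        (1 + e) ^+ 2 * (halflog (s + x / 2 ^+ k.+1) - halflog s) by apply: p1 => //; lra.
    have := p2 _ sx; have -> : 0 <= s + x / 2 ^+ k.+1 by lra.
    move=> /(_ isT); lra.
  rewrite add0r => /andP[a0 ax] _.
  have a1 : cmod a%:C < 1 by rewrite cmodR ger0_norm //; lra.
  have ea0 : 0 < 1 - x * x.
    by rewrite subr_gt0; apply: (@le_lt_trans _ _ x); [rewrite ler_piMr // ltW | lra].
  have [d d0 hd] := hT _ (hdisc_mob a1 hf) e e0.
  have m0 : mob a%:C 0 = a%:C by rewrite /mob add0r mulr0 addr0 divr1.
  exists (Num.min d e * (1 - x * x)); first by rewrite mulr_gt0 // lt_min d0.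
  move=> k s y /andP[sa as'] _ wd _ s0 sx.
  set s' := s + x / 2 ^+ k in as' sx *.
  have ws : x / 2 ^+ k = s' - s by rewrite /s'; ring.
  have loc u v w : (u = a /\ v = w) \/ (v = a /\ u = w) -> s <= u -> u <= v -> v <= s' ->
      `|F v - F u| <= (1 + e) ^+ 2 * (halflog v - halflog u).
    move=> uv su uv' vs'.
    have u0 : 0 <= u by lra. have v1 : v < 1 by lra.
    have uvx : u * v <= x * x by apply: ler_pM; lra.
    have uv1 : 0 < 1 - u * v by lra.
    pose la := (v - u) / (1 - u * v).
    have la0 : 0 <= la by apply: divr_ge0; [rewrite subr_ge0 | exact: ltW].
    have lad : la < Num.min d e.
      rewrite /la ltr_pdivrMr; last lra.
      apply: (@le_lt_trans _ _ (x / 2 ^+ k)); first by lra.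
      apply: lt_le_trans wd _; rewrite ler_wpM2l ?le_min ?(ltW d0) ?(ltW e0) //; lra.
    have [lad' lae] : la < d /\ la < e by apply/andP; rewrite -lt_min.
    have la1 : la < 1 by rewrite /la ltr_pdivrMr; [nra | lra].
    have hl : la <= (1 + e) * (halflog v - halflog u).
      rewrite halflog_sub // -/la.
      have hla : la <= (1 + la) * halflog la by apply: halflog_ge; lra.
      apply: (le_trans hla); apply: ler_wpM2r; last lra.
      have p1 : 0 < 1 + la by lra.
      by rewrite -(pmulr_rge0 _ p1); exact: le_trans la0 hla.
    have hF : `|F v - F u| <= (1 + e) * la.
      case: uv => -[E1 E2].
        have := hd la%:C; rewrite cmodR ger0_norm // m0 => /(_ lad').
        by rewrite /la -E1 mob_real //; lra.
      have := hd (- la)%:C; rewrite cmodR normrN ger0_norm // m0 => /(_ lad').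
      have -> : - la = (u - a) / (1 - a * u) by rewrite /la E1 [u * a]mulrC -mulNr opprB.
      by rewrite mob_real ?E1 1?distrC //; lra.
    apply: le_trans hF _; rewrite expr2 -mulrA ler_wpM2l //; lra.
  have h1 := loc s a s (or_intror (conj erefl erefl)) (lexx _) sa as'.
  have h2 := loc a s' s' (or_introl (conj erefl erefl)) sa as' (lexx _).
  have := le_trans (ler_norm _) h1; have := le_trans (ler_norm _) h2; lra.
have hl0 : halflog 0 = 0 by rewrite /halflog addr0 subr0 divr1 ln1 mulr0.
rewrite hl0 subr0 in key.
rewrite -/(F x) -[0]/(0%:C) -/(F 0).
apply/ler_addgt0Pr => e e0.
have H0 : 0 <= halflog x.
  rewrite /halflog mulr_ge0 ?ln_ge0 // ler_pdivlMr; lra.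
pose e' := Num.min 1 (e / (3 * halflog x + 1)).
have e'0 : 0 < e' by rewrite lt_min ltr01 divr_gt0 //; lra.
have e'1 : e' <= 1 by rewrite ge_min lexx.
have e'2 : e' * (3 * halflog x + 1) <= e by rewrite -ler_pdivlMr ?ge_min ?lexx ?orbT //; lra.
apply: le_trans (key _ e'0) _.
have : e' * e' * halflog x <= e' * halflog x.
  by rewrite ler_wpM2r // ler_piMr // ltW.
rewrite sqrrD expr1n mul1r; lra.
Qed.

(** A Moebius map and a rotation move [b] to 0 and [a] to the positive axis. *)
Lemma poincare_bound G Th f a b : disc_lipschitz G Th -> hdisc G f ->
  unit_disc a -> unit_disc b -> Th (f a) - Th (f b) <= poincare_distance a b.
Proof.
move=> hT hf a1 b1; rewrite /unit_disc /= in a1 b1.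
rewrite /poincare_distance -[Num.conj b]/(b^*).
set w := (a - b) / (1 - b^* * a); set m := cmod w; rewrite -/(halflog m).
have nb1 : cmod (- b) < 1 by rewrite cmodN.
have wE : w = mob (- b) a by rewrite /w /mob rmorphN mulNr.
have w1 : m < 1 by rewrite /m wE; exact: mob_disc.
have bden := mob_den b1 b1.
have mw : mob b w = a.
  have d1 := mob_den nb1 a1; have bb : 1 - b^* * b != 0.
    rewrite mulrC mulcJ subr_eq0; apply/eqP => /(congr1 (@complex.Re R)) /=.
    have : cmod b ^+ 2 < 1 by rewrite expr_lt1 ?cmod_ge0.
    lra.
  rewrite rmorphN mulNr /= in d1.
  rewrite /mob /w; move: (b^*) d1 bb => c d1 bb; field.
  rewrite d1 /=; have -> : 1 - c * a + c * (a - b) = 1 - c * b by ring.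
  exact: bb.
have m0 : 0 <= m by exact: cmod_ge0.
have [c [c1 cm]] : exists c, cmod c = 1 /\ c * m%:C = w.
  have [w0|w0] := eqVneq w 0.
    by exists 1; rewrite cmod1 /m w0 cmod0 mul1r.
  have mC : (cmod w)%:C != 0 by rewrite -normC_cmod normr_eq0.
  exists (w / (cmod w)%:C); rewrite /m divfK // cmodM cmodV cmodR.
  by rewrite ger0_norm ?cmod_ge0 // mulfV // cmod_eq0.
have := geodesic_bound hT (hdisc_rot c1 (hdisc_mob b1 hf)) (x := m).
rewrite cm mw mulr0 /mob add0r mulr0 addr0 divr1; apply.
by rewrite m0 w1.
Qed.

Lemma kobayashi_ge G Th (x y : 'rV[R[i]]_n) : disc_lipschitz G Th ->
  ((Th x - Th y)%:E <= kobayashi G x y)%E.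
Proof.
move=> hT; apply: le_ereal_inf_tmp => _ [N [p [f [xi [zeta [[N0 p0 pN Gp hc] ->]]]]]].
rewrite lee_fin -p0 -pN.
have -> : Th (p 0%N) - Th (p N) = \sum_(j < N) (Th (p j) - Th (p j.+1)).
  rewrite -(big_mkord xpredT (fun j => Th (p j) - Th (p j.+1))).
  by rewrite -[LHS]opprB -(telescope_sumr (fun j => Th (p j))) // -sumrN; apply: eq_bigr => j _; rewrite opprB.
apply: ler_sum => j _; have [hf x1 z1 <- <-] := hc j (ltn_ord j).
by apply: (poincare_bound hT) => //; exact: holomorphic_disc_hdisc.
Qed.
End HolomorphicDiscs.

(** * The Euclidean norm *)
Section EuclideanNorm.
Context {R : realType} {n : nat}.
Implicit Types (x y z p q : 'rV[R[i]]_n).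

Lemma enorm_ge0 x : 0 <= enorm x. Proof. exact: sqrtr_ge0. Qed.

Lemma enorm_sqr x : enorm x ^+ 2 = \sum_(k < n) cmod (x ord0 k) ^+ 2.
Proof. by rewrite sqr_sqrtr // sumr_ge0 // => k _; rewrite sqr_ge0. Qed.

Lemma cmod_le_enorm x k : cmod (x ord0 k) <= enorm x.
Proof.
rewrite -(@ler_pXn2r _ 2) ?nnegrE ?cmod_ge0 ?enorm_ge0 // enorm_sqr (bigD1 k) //=.
by rewrite lerDl sumr_ge0 // => j _; rewrite sqr_ge0.
Qed.

Lemma enorm_eq0 x : enorm x = 0 -> x = 0.
Proof.
move=> x0; apply/rowP => k; rewrite mxE; apply/eqP; rewrite -cmod_eq0.
by rewrite eq_le cmod_ge0 andbT -x0 cmod_le_enorm.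
Qed.

Lemma enorm0 : enorm (0 : 'rV[R[i]]_n) = 0.
Proof.
rewrite /enorm big1 ?sqrtr0 // => k _; by rewrite mxE cmod0 expr0n.
Qed.

Lemma enormN x : enorm (- x) = enorm x.
Proof. by rewrite /enorm; congr Num.sqrt; apply: eq_bigr => k _; rewrite mxE cmodN. Qed.

Lemma enormB x y : enorm (x - y) = enorm (y - x).
Proof. by rewrite -enormN opprB. Qed.

Lemma enormZ c x : enorm (c *: x) = cmod c * enorm x.
Proof.
rewrite /enorm -[cmod c in RHS]ger0_norm ?cmod_ge0 // -sqrtr_sqr -sqrtrM ?sqr_ge0 //.
rewrite mulr_sumr; congr Num.sqrt; apply: eq_bigr => k _.
by rewrite mxE cmodM exprMn.
Qed.

Lemma enormD x y : enorm (x + y) <= enorm x + enorm y.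
Proof.
have [x0|x0] := eqVneq (enorm x) 0; first by rewrite (enorm_eq0 x0) enorm0 !add0r.
have [y0|y0] := eqVneq (enorm y) 0; first by rewrite (enorm_eq0 y0) enorm0 !addr0.
have xp : 0 < enorm x by rewrite lt_def x0 enorm_ge0.
have yp : 0 < enorm y by rewrite lt_def y0 enorm_ge0.
rewrite -(@ler_pXn2r _ 2) ?nnegrE ?enorm_ge0 ?addr_ge0 ?enorm_ge0 //.
(* (|a| + |b|)^2 <= (1 + t) |a|^2 + (1 + 1/t) |b|^2, with t = |y| / |x| *)
pose t := enorm y / enorm x; have t0 : 0 < t by rewrite divr_gt0.
have -> : (enorm x + enorm y) ^+ 2 = (1 + t) * enorm x ^+ 2 + (1 + t^-1) * enorm y ^+ 2.
  by rewrite /t; field; rewrite x0 y0.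
rewrite !enorm_sqr !mulr_sumr -big_split /=; apply: ler_sum => k _; rewrite mxE.
apply: (@le_trans _ _ ((cmod (x ord0 k) + cmod (y ord0 k)) ^+ 2)).
  by rewrite ler_pXn2r ?nnegrE ?cmod_ge0 ?addr_ge0 ?cmod_ge0 // cmodD.
set a := cmod _; set b := cmod _; rewrite -subr_ge0.
have -> : (1 + t) * a ^+ 2 + (1 + t^-1) * b ^+ 2 - (a + b) ^+ 2 = t^-1 * (t * a - b) ^+ 2.
  by field; rewrite gt_eqF.
by rewrite mulr_ge0 ?sqr_ge0 // invr_ge0 ltW.
Qed.

Lemma enorm_dist_triangle x y z : enorm (x - z) <= enorm (x - y) + enorm (y - z).
Proof.
have -> : x - z = (x - y) + (y - z) by rewrite addrA subrK.
exact: enormD.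
Qed.

Lemma rcont_enorm (f : R[i] -> 'rV[R[i]]_n) z0 (a : R[i]) :
  (forall k, ccont (fun w => f w ord0 k) a) -> rcont (fun w => enorm (f w - z0)) a.
Proof.
move=> h e e0.
have hs : exists2 d : R, 0 < d & forall w, cmod (w - a) < d ->
    \sum_(k < n) cmod ((f w - f a) ord0 k) ^+ 2 <= e ^+ 2.
  pose N : R := n%:R + 1; have N0 : 0 < N by rewrite ltr_wpDl ?ler0n.
  pose e' := Num.min 1 (e ^+ 2 / N).
  have e'0 : 0 < e' by rewrite lt_min ltr01 divr_gt0 // exprn_gt0.
  have [d hd] := choice (fun k => let: ex_intro2 d d0 hd := h k e' e'0 in
    ex_intro (fun d => 0 < d /\ forall w, cmod (w - a) < d ->
      cmod (f w ord0 k - f a ord0 k) <= e') d (conj d0 hd)).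
  exists (\big[Num.min/1]_(k < n) d k).
    elim/big_ind: _ => // [x y x0 y0|k _]; first by rewrite lt_min x0.
    by case: (hd k).
  move=> w za; apply: (@le_trans _ _ (\sum_(k < n) e ^+ 2 / N)).
    apply: ler_sum => k _; rewrite !mxE.
    have : cmod (f w ord0 k - f a ord0 k) <= e'.
      have [_] := hd k; apply; apply: lt_le_trans za _; exact: bigmin_le_cond.
    rewrite le_min => /andP[h1 h2]; apply: le_trans h2; rewrite expr2.
    by rewrite ler_piMr ?cmod_ge0.
  rewrite sumr_const card_ord -mulr_natr -mulrA ler_piMr ?sqr_ge0 //.
  by rewrite mulrC ler_pdivrMr // mul1r /N lerDl.
have [d d0 hd] := hs; exists d => // w /hd; rewrite -enorm_sqr.
rewrite ler_pXn2r ?nnegrE ?enorm_ge0 ?(ltW e0) // => hz.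
have t1 := enorm_dist_triangle (f w) (f a) z0.
have t2 := enorm_dist_triangle (f a) (f w) z0.
rewrite (enormB (f a) (f w)) in t2.
rewrite ler_norml; lra.
Qed.
End EuclideanNorm.

(** * Barriers from peak functions *)
Section Barrier.
Context {R : realType} {n : nat}.
Implicit Types (G : set 'rV[R[i]]_n) (p q zeta : 'rV[R[i]]_n) (f : R[i] -> 'rV[R[i]]_n).

(** Holomorphy of several variables, observed through holomorphic discs. *)
Definition disc_holomorphic (g : 'rV[R[i]]_n -> R[i]) := forall f a,
  (forall k, cdiff (fun z => f z ord0 k) a) -> cdiff (fun z => g (f z)) a.

(** A local holomorphic peak function at [zeta] (up to the sign and an exponential).
    A single [eta] serves as radius and as both constants, so that uniformity over
    a family is a statement about one number. *)
Definition peak (eta : R) G zeta := exists g, disc_holomorphic g /\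
  forall p, G p -> enorm (p - zeta) < eta ->
    eta * enorm (p - zeta) ^+ 2 <= complex.Re (g p) <= eta^-1 * enorm (p - zeta).

Lemma norm_min_le (x y m : R) : `|Num.min x m - Num.min y m| <= `|x - y|.
Proof.
case: (leP x m) => xm; case: (leP y m) => ym; rewrite ?lexx ?subrr ?normr0 //.
- by rewrite !ler0_norm; lra.
- by rewrite !ger0_norm; lra.
Qed.

Section OnePeak.
Variables (eta Rb rho : R) (G : set 'rV[R[i]]_n) (zeta : 'rV[R[i]]_n) (g : 'rV[R[i]]_n -> R[i]).
Hypotheses (eta0 : 0 < eta) (Rb0 : 0 < Rb) (rho0 : 0 < rho) (rho_eta : rho <= eta).
Hypothesis GRb : forall p, G p -> enorm (p - zeta) <= Rb.
Hypothesis zetaG : ~ G zeta.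
Hypothesis gh : disc_holomorphic g.
Hypothesis gpeak : forall p, G p -> enorm (p - zeta) < eta ->
    eta * enorm (p - zeta) ^+ 2 <= complex.Re (g p) <= eta^-1 * enorm (p - zeta).

Let u p := complex.Re (g p).
(* u is at least m where rho / 2 <= |p - zeta| < rho, so V is continuous across the
   sphere of radius rho *)
Let m := eta * (rho / 2) ^+ 2.
Let V p := if enorm (p - zeta) < rho then Num.min (u p) m else m.
(* makes |p - zeta|^2 at most A * V on all of G *)
Let A := eta^-1 + Rb ^+ 2 / m.
(* with this M, Hardy's bound on the disc of radius 1 - M * V (f 0) gives
   |f - zeta|^2 <= rho^2 / 2 *)
Let M := 4 * A / rho ^+ 2.
(* below the level m' both V = u and M * V <= 1 / 2 *)
Let m' := Num.min (m / 2) ((2 * M)^-1).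

Let m0 : 0 < m. Proof. by rewrite mulr_gt0 // exprn_gt0 // divr_gt0. Qed.
Let A0 : 0 < A.
Proof. by rewrite ltr_pwDl ?invr_gt0 // divr_ge0 ?sqr_ge0 ?ltW. Qed.
Let M0 : 0 < M. Proof. by rewrite divr_gt0 ?exprn_gt0 // mulr_gt0. Qed.
Let m'0 : 0 < m'. Proof. by rewrite lt_min divr_gt0 //= invr_gt0 mulr_gt0. Qed.
Let m'm : m' < m.
Proof. by apply: (@le_lt_trans _ _ (m / 2)); [rewrite ge_min lexx | have := m0; lra]. Qed.
Let Mm' : M * m' <= 2^-1.
Proof.
apply: (@le_trans _ _ (M * (2 * M)^-1)).
  by rewrite ler_wpM2l ?(ltW M0) // ge_min lexx orbT.
by rewrite invfM mulrCA mulfV ?mulr1 // gt_eqF.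
Qed.

Let Gpos p : G p -> 0 < enorm (p - zeta).
Proof.
move=> Gp; rewrite lt_def enorm_ge0 andbT; apply/eqP => /enorm_eq0 /eqP.
by rewrite subr_eq0 => /eqP pz; apply: zetaG; rewrite -pz.
Qed.

Let u_ge p : G p -> enorm (p - zeta) < rho -> eta * enorm (p - zeta) ^+ 2 <= u p.
Proof. by move=> Gp pr; have /andP[] := gpeak Gp (lt_le_trans pr rho_eta). Qed.

Let u_le p : G p -> enorm (p - zeta) < rho -> u p <= eta^-1 * enorm (p - zeta).
Proof. by move=> Gp pr; have /andP[] := gpeak Gp (lt_le_trans pr rho_eta). Qed.

Let V_pos p : G p -> 0 < V p.
Proof.
move=> Gp; rewrite /V; case: ifP => // pr; rewrite lt_min m0 andbT.
by apply: lt_le_trans (u_ge Gp pr); rewrite mulr_gt0 // exprn_gt0 // Gpos.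
Qed.

Let V_le p : V p <= m.
Proof. by rewrite /V; case: ifP => // _; rewrite ge_min lexx orbT. Qed.

Let V_far p : G p -> rho / 2 <= enorm (p - zeta) -> V p = m.
Proof.
move=> Gp hp; rewrite /V; case: ifP => // pr; apply/min_idPr.
apply: le_trans (u_ge Gp pr); rewrite ler_pM2l // ler_pXn2r ?nnegrE ?enorm_ge0 //.
by rewrite divr_ge0 // ltW.
Qed.

Let V_near p : G p -> V p < m -> enorm (p - zeta) < rho / 2 /\ V p = u p.
Proof.
move=> Gp Vm; have pr2 : enorm (p - zeta) < rho / 2.
  by rewrite ltNge; apply/negP => /(V_far Gp) e; rewrite e ltxx in Vm.
split=> //; have pr : enorm (p - zeta) < rho by have := rho0; lra.
by move: Vm; rewrite /V pr gt_min ltxx orbF => /ltW /min_idPl.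
Qed.

Let V_enorm p : G p -> enorm (p - zeta) ^+ 2 <= A * V p.
Proof.
move=> Gp; have := V_le p; rewrite le_eqVlt => /orP[/eqP Ve|Vl].
  rewrite Ve /A mulrDl divfK ?gt_eqF //.
  apply: (@le_trans _ _ (Rb ^+ 2)); last by rewrite lerDr mulr_ge0 ?invr_ge0 ?ltW.
  by rewrite ler_pXn2r ?nnegrE ?enorm_ge0 ?(ltW Rb0) // GRb.
have [pr Vu] := V_near Gp Vl; have pr' : enorm (p - zeta) < rho by have := rho0; lra.
have := u_ge Gp pr'; rewrite -Vu mulrC -ler_pdivlMr // => h.
apply: le_trans h _; rewrite mulrC ler_wpM2r ?(ltW (V_pos Gp)) // /A lerDl.
by rewrite divr_ge0 ?sqr_ge0 // ltW.
Qed.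

(* the derivative (1 - M x) / (2 x) inverts the bound 2 x / (1 - M x) for the slope of
   u along a disc with u = x at its centre *)
Let phi (x : R) := 2^-1 * (ln x - M * x).

Let th p := phi (Num.min (V p) m') - phi m'.

Section OneDisc.
Variable f : R[i] -> 'rV[R[i]]_n.
Hypothesis fG : hdisc G f.

Let f_cont a zt : cmod a < 1 -> rcont (fun z => enorm (f z - zt)) a.
Proof.
by move=> a1; apply: rcont_enorm => k; apply: cdiff_ccont; case: (fG a1).
Qed.

Let in_disc a : cmod a < 1 -> exists2 d : R, 0 < d & forall z, cmod (z - a) < d -> cmod z < 1.
Proof.
move=> a1; exists (1 - cmod a); first lra.
by move=> z za; have := cmodD (z - a) a; rewrite subrK; lra.
Qed.

(* The threshold 3 rho / 4 lies between rho / 2, beyond which V = m, and rho, up to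
   which V is the minimum of u and m. *)
Let V_local a : cmod a < 1 ->
  (exists2 d : R, 0 < d & forall z, cmod (z - a) < d ->
     cmod z < 1 /\ V (f z) = Num.min (complex.Re (g (f z))) m) \/
  (exists2 d : R, 0 < d & forall z, cmod (z - a) < d -> cmod z < 1 /\ V (f z) = m).
Proof.
move=> a1; have [d1 d10 hd1] := in_disc a1; have rp := rho0.
have r40 : 0 < rho / 8 by lra.
have [d2 d20 hd2] := f_cont zeta a1 r40.
have [h|h] := ltP (enorm (f a - zeta)) (3 * rho / 4); [left|right];
  exists (Num.min d1 d2); rewrite ?lt_min ?d10 // => z; rewrite lt_min => /andP[/hd1 z1 /hd2].
  rewrite ler_norml => /andP[_ h2]; split=> //.
  by rewrite /V; have -> : enorm (f z - zeta) < rho by lra.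
rewrite ler_norml => /andP[h2 _]; split=> //; apply: V_far; first by case: (fG z1).
lra.
Qed.

Let Vf_cont a : cmod a < 1 -> rcont (fun z => V (f z)) a.
Proof.
move=> a1; have [fd _] := fG a1.
case: (V_local a1) => -[d d0 hd] e e0.
  have [d' d'0 hd'] := ccont_Re (cdiff_ccont (gh fd)) e0.
  exists (Num.min d d'); first by rewrite lt_min d0.
  move=> z; rewrite lt_min => /andP[/hd[_ ->] /hd'].
  have [_ ->] : cmod a < 1 /\ V (f a) = Num.min (complex.Re (g (f a))) m.
    by apply: hd; rewrite subrr cmod0.
  by apply: le_trans; exact: norm_min_le.
exists d => // z /hd[_ ->].
have [_ ->] : cmod a < 1 /\ V (f a) = m by apply: hd; rewrite subrr cmod0.
by rewrite subrr normr0 ltW.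
Qed.

Let V_super a : cmod a < 1 -> exists F r,
  [/\ 0 < r, forall z, cmod (z - a) < r -> cmod z < 1 /\ cdiff F z,
      complex.Re (F a) = V (f a) &
      forall z, cmod (z - a) < r -> V (f z) <= complex.Re (F z)].
Proof.
move=> a1; have [d1 d10 hd1] := in_disc a1; have [fd Gf] := fG a1.
have := V_le (f a); rewrite le_eqVlt => /orP[/eqP Ve|Vl].
  exists (fun=> m%:C), d1; split=> [//|z /hd1 z1||z _].
  - by split=> //; exact: cdiff_cst.
  - by rewrite Ve.
  - exact: V_le.
have [_ Vu] := V_near Gf Vl.
have [[d d0 hd]|[d d0 hd]] := V_local a1; last first.
  have [_ e] : cmod a < 1 /\ V (f a) = m by apply: hd; rewrite subrr cmod0.
  by rewrite e ltxx in Vl.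
exists (fun z => g (f z)), d; split=> // z /hd[z1 Vz].
  by split=> //; apply: gh; case: (fG z1).
by rewrite Vz ge_min lexx.
Qed.

Let hardy s l : 0 < s < 1 -> cmod l < 1 ->
  enorm (f (s%:C * l) - zeta) ^+ 2 * (1 - cmod l ^+ 2) <= A * V (f 0).
Proof.
move=> /andP[s0 s1] l1.
have sm z : cmod (s%:C * z) = s * cmod z by rewrite cmodM cmodR gtr0_norm.
have sd z : cmod z < s^-1 -> cmod (s%:C * z) < 1.
  by move=> zs; rewrite sm mulrC -ltr_pdivlMr // div1r.
have sz1 z : cmod z <= 1 -> cmod (s%:C * z) < 1.
  by move=> z1; apply: sd; apply: le_lt_trans z1 _; rewrite invf_gt1.
have sdist z w : cmod (s%:C * z - s%:C * w) = s * cmod (z - w) by rewrite -mulrBr sm.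
have := @hardy_bound R n (fun k z => f (s%:C * z) ord0 k - zeta ord0 k)
  (fun z => V (f (s%:C * z))) A s^-1.
rewrite mulr0 => /(_ _ _ _ _ _ _ l l1).
have -> : \sum_(k < n) cmod (f (s%:C * l) ord0 k - zeta ord0 k) ^+ 2
    = enorm (f (s%:C * l) - zeta) ^+ 2.
  by rewrite enorm_sqr; apply: eq_bigr => k _; rewrite !mxE.
apply.
- by rewrite invf_gt1.
- exact: ltW.
- move=> k z zs; apply: cdiffB (cdiff_cst _ _).
  have [fd _] := fG (sd _ zs).
  exact: (@cdiff_comp _ (fun z => s%:C * z) (fun w => f w ord0 k) _ (cdiffZ _ (cdiff_id _)) (fd k)).
- move=> z z1 e e0; have [d d0 hd] := Vf_cont (sz1 _ z1) e0.
  exists d => // w wz; apply: hd; rewrite sdist.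
  by apply: le_lt_trans wz; rewrite ler_piMl ?cmod_ge0 // ltW.
- move=> b b1; have [F [r [r0 Fd Fb Fm]]] := V_super (sz1 _ (ltW b1)).
  have lt z : cmod (z - b) < r -> cmod (s%:C * z - s%:C * b) < r.
    by move=> zb; rewrite sdist; apply: le_lt_trans zb; rewrite ler_piMl ?cmod_ge0 // ltW.
  exists (fun z => F (s%:C * z)), r; split=> // z zb.
    have [_ Fz] := Fd _ (lt _ zb).
    exact: (@cdiff_comp _ (fun z => s%:C * z) F _ (cdiffZ _ (cdiff_id _)) Fz).
  exact/Fm/lt.
- move=> z z1; have Gz : G (f (s%:C * z)) by case: (fG (sz1 z _)); rewrite ?z1.
  apply: le_trans (V_enorm Gz); rewrite enorm_sqr le_eqVlt; apply/orP; left.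
  by apply/eqP/eq_bigr => k _; rewrite !mxE.
Qed.

Let disc0 : cmod (0 : R[i]) < 1. Proof. by rewrite cmod0. Qed.
Let Gf0 : G (f 0). Proof. by case: (fG disc0). Qed.

(* A disc with centre close to zeta stays close to zeta, except near the unit circle:
   this replaces the usual localization of the Kobayashi metric. Hardy's bound is
   applied to the disc shrunk by s, midway between the radius reached and 1. *)
Let localization w : V (f 0) <= m' -> cmod w < 1 - M * V (f 0) -> enorm (f w - zeta) < rho.
Proof.
move=> Vm' wr; set u0 := V (f 0) in Vm' wr.
have u00 : 0 < u0 by exact: V_pos.
have Mu0 : 0 < M * u0 by rewrite mulr_gt0.
have Mu1 : M * u0 <= 2^-1 by apply: le_trans Mm'; rewrite ler_pM2l.
pose s := 1 - M * u0 / 2; have s01 : 0 < s < 1 by rewrite /s; apply/andP; split; lra.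
have [s0 s1] := andP s01.
have c0 := cmod_ge0 w.
pose l := w / s%:C; have sC : s%:C != 0 :> R[i] by rewrite -cmod_gt0 cmodR gtr0_norm.
have lE : cmod l = cmod w / s by rewrite cmodM cmodV cmodR gtr0_norm.
have lb : cmod l <= 1 - M * u0 / 2.
  rewrite lE ler_pdivrMr // -/s.
  have : s * s = 1 - M * u0 + (M * u0) ^+ 2 / 4 by rewrite /s; field.
  have := sqr_ge0 (M * u0); lra.
have l1 : cmod l < 1 by lra.
have := hardy s01 l1; rewrite [s%:C * l]mulrC divfK // -/u0 => H.
have l2 : M * u0 / 2 <= 1 - cmod l ^+ 2.
  have : cmod l ^+ 2 <= cmod l by rewrite expr2 ler_piMr ?cmod_ge0 // ltW.
  lra.
have e2 : enorm (f w - zeta) ^+ 2 * (M * u0 / 2) <= A * u0.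
  by apply: le_trans H; rewrite ler_wpM2l ?sqr_ge0.
have e3 : enorm (f w - zeta) ^+ 2 <= rho ^+ 2 / 2.
  rewrite -(ler_pM2r (_ : 0 < M * u0 / 2)); last by rewrite divr_gt0.
  apply: le_trans e2 _; rewrite le_eqVlt; apply/orP; left; apply/eqP.
  by rewrite /M; field; rewrite gt_eqF.
rewrite -(@ltr_pXn2r _ 2) ?nnegrE ?enorm_ge0 ?(ltW rho0) //.
have : 0 < rho ^+ 2 by rewrite exprn_gt0.
lra.
Qed.

(** If [V (f 0) > m'], the barrier vanishes near the centre.  Otherwise [Re g o f] is
    positive on the disc of radius [1 - M u0], with [u0 = V (f 0)], and the bound on
    its derivative [c] at 0 reads [K * |c| <= 1], where [K] is the derivative of
    [phi] at [u0]. *)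
Lemma barrier_disc e : 0 < e -> exists2 d : R, 0 < d & forall z, cmod z < d ->
  `|th (f z) - th (f 0)| <= (1 + e) * cmod z.
Proof.
move=> e0.
have [Vm'|Vm'] := leP (V (f 0)) m'; last first.
  have vp : 0 < (V (f 0) - m') / 2 by have := subr_gt0 m' (V (f 0)); rewrite Vm'; lra.
  have [d d0 hd] := Vf_cont disc0 vp; exists d => // z zd.
  have := hd z; rewrite subr0 ler_norml => /(_ zd) /andP[hz _].
  have Vz : m' < V (f z) by lra.
  rewrite /th (min_idPr (ltW Vz)) (min_idPr (ltW Vm')) subrr normr0.
  by rewrite mulr_ge0 ?cmod_ge0 //; lra.
set u0 := V (f 0) in Vm'.
have u00 : 0 < u0 by exact: V_pos.
have Mu0 : 0 < M * u0 by rewrite mulr_gt0.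
have Mu1 : M * u0 <= 2^-1 by apply: le_trans Mm'; rewrite ler_pM2l.
pose r := 1 - M * u0; have r0 : 0 < r by rewrite /r; lra.
have r1 : r < 1 by rewrite /r; lra.
have [_ Vu] := V_near Gf0 (le_lt_trans Vm' m'm).
have Fd z : cmod z < r -> cdiff (fun z => g (f z)) z.
  by move=> zr; apply: gh; have [] := fG (lt_trans zr r1).
have Fp z : cmod z < r -> 0 <= complex.Re (g (f z)).
  move=> zr; have [_ Gz] := fG (lt_trans zr r1).
  by apply: le_trans (u_ge Gz (localization Vm' zr)); rewrite mulr_ge0 ?sqr_ge0 // ltW.
have r00 : cmod (0 : R[i]) < r by rewrite cmod0.
have [c hc] := Fd 0 r00.
have := positive_real_part_deriv_scaled r0 Fd hc Fp; rewrite -/(u (f 0)) -Vu -/u0 => cr.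
pose K := 2^-1 * (u0^-1 - M).
have K0 : 0 < K.
  rewrite /K mulr_gt0 ?invr_gt0 // subr_gt0 -(ltr_pM2r u00) mulVf ?gt_eqF //; lra.
have Kc : K * cmod c <= 1.
  rewrite -(ler_pM2r r0) mul1r -mulrA; apply: le_trans (_ : K * (2 * u0) <= r).
    by rewrite ler_pM2l.
  by rewrite /K /r le_eqVlt; apply/orP; left; apply/eqP; field; rewrite gt_eqF.
have c0 := cmod_ge0 c.
pose e1 := Num.min 1 (e / (2 * K)); pose e2 := e / (cmod c + 1).
have e10 : 0 < e1 by rewrite lt_min ltr01 divr_gt0 // mulr_gt0.
have e20 : 0 < e2 by rewrite divr_gt0 //; lra.
have [d1 d10 hd1] := hc e1 e10.
have [d2 d20 hd2] := is_derive_bound (is_derive1_ln u00) e20.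
have K1 : 0 < cmod c + 1 by lra.
exists (Num.min (Num.min d1 r) (d2 / (cmod c + 1))).
  by rewrite !lt_min d10 r0 divr_gt0.
move=> z; rewrite !lt_min => /andP[/andP[zd1 zr]].
rewrite ltr_pdivlMr // => zd2.
have [z1 Gz] : cmod z < 1 /\ G (f z).
  by have zz := lt_trans zr r1; split=> //; case: (fG zz).
have zrho := localization Vm' zr.
have z0 := cmod_ge0 z.
have Vz : Num.min (V (f z)) m' = Num.min (complex.Re (g (f z))) m'.
  by rewrite /V zrho -minA; congr Num.min; apply/min_idPr/ltW.
set y := Num.min (complex.Re (g (f z))) m'.
have uz : `|complex.Re (g (f z)) - u0| <= (cmod c + e1) * cmod z.
  rewrite [u0]Vu -cReN -cReD; apply: le_trans (Re_le_cmod _) _.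
  have := hd1 z; rewrite !subr0 => /(_ zd1) h.
  have -> : g (f z) - g (f 0) = (g (f z) - g (f 0) - c * z) + c * z by ring.
  by apply: le_trans (cmodD _ _) _; rewrite cmodM; lra.
have yu : `|y - u0| <= (cmod c + e1) * cmod z.
  by rewrite /y -{1}(min_idPl Vm'); apply: le_trans (norm_min_le _ _ _) uz.
have e11 : e1 <= 1 by rewrite ge_min lexx.
have e12 : e1 * (2 * K) <= e.
  have K2 : 0 < 2 * K by rewrite mulr_gt0.
  by rewrite -(ler_pdivlMr _ _ K2) /e1 ge_min lexx orbT.
have e22 : e2 * (cmod c + 1) = e by rewrite /e2 divfK // gt_eqF.
have yu' : `|y - u0| <= (cmod c + 1) * cmod z.
  by apply: le_trans yu _; rewrite ler_wpM2r // lerD2l.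
rewrite mulrC in zd2; have hy := hd2 y (le_lt_trans yu' zd2).
rewrite /th Vz -/y (min_idPl Vm') -/u0.
have -> : phi y - phi m' - (phi u0 - phi m') =
    2^-1 * (ln y - ln u0 - u0^-1 * (y - u0)) + K * (y - u0) by rewrite /phi /K; ring.
apply: le_trans (ler_normD _ _) _; rewrite (normrM 2^-1) (normrM K) (gtr0_norm K0) gtr0_norm //.
have b1 : K * `|y - u0| <= (1 + e / 2) * cmod z.
  apply: (@le_trans _ _ (K * ((cmod c + e1) * cmod z))); first by rewrite ler_pM2l.
  rewrite mulrA ler_wpM2r // mulrDr; lra.
have b2 : e2 * `|y - u0| <= e * cmod z.
  by rewrite -e22 -mulrA ler_pM2l.
lra.
Qed.
End OneDisc.

(** The upper bound follows from [u p <= eta^-1 * |p - zeta|]; when [V p > m'] the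
    barrier is 0 and [|p - zeta|] is bounded below.  The constant is left in terms
    of [eta], [Rb] and [rho] to show that it does not depend on [G] or [zeta]. *)
Lemma peak_barrier : exists th : 'rV[R[i]]_n -> R,
  [/\ disc_lipschitz G th,
      forall p, G p -> rho / 2 <= enorm (p - zeta) -> th p = 0 &
      forall p, G p -> th p <= 2^-1 * ln (enorm (p - zeta)) + 2^-1 * `|ln eta|
        + `|2^-1 * (ln m' - M * m')| + `|ln (Num.min (eta * m') (rho / 2))|].
Proof.
exists th; rewrite /th; split.
- by move=> f fG e e0; exact: barrier_disc.
- by move=> p Gp /(V_far Gp) ->; rewrite (min_idPr (ltW m'm)) subrr.
move=> p Gp; rewrite -/(phi m').
have ep := Gpos Gp.
have rp := rho0.
have [Vm'|Vm'] := leP (V p) m'.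
  have [pr Vu] := V_near Gp (le_lt_trans Vm' m'm).
  have pr' : enorm (p - zeta) < rho by lra.
  have up := V_pos Gp.
  have : ln (V p) <= ln (eta^-1 * enorm (p - zeta)).
    by rewrite ler_ln ?posrE ?mulr_gt0 ?invr_gt0 // Vu; exact: u_le.
  rewrite lnM ?posrE ?invr_gt0 // lnV ?posrE // /phi.
  have := ler_norm (- ln eta); rewrite normrN.
  have := ler_norm (- phi m'); rewrite normrN /phi.
  have : 0 <= M * V p by rewrite mulr_ge0 // ltW.
  have := normr_ge0 (ln (Num.min (eta * m') (rho / 2))); lra.
rewrite subrr.
have lb : Num.min (eta * m') (rho / 2) <= enorm (p - zeta).
  rewrite ge_min; have [pr|pr] := ltP (enorm (p - zeta)) (rho / 2); last by rewrite orbT.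
  have pr' : enorm (p - zeta) < rho by lra.
  apply/orP; left; rewrite mulrC -ler_pdivlMr // mulrC; apply: le_trans (u_le Gp pr').
  by move: Vm'; rewrite /V pr' lt_min => /andP[/ltW].
have mp : 0 < Num.min (eta * m') (rho / 2) by rewrite lt_min mulr_gt0 // divr_gt0.
have : ln (Num.min (eta * m') (rho / 2)) <= ln (enorm (p - zeta)).
  by rewrite ler_ln ?posrE.
have := ler_norm (- ln (Num.min (eta * m') (rho / 2))); rewrite normrN.
have := normr_ge0 (ln eta); have := normr_ge0 (phi m'); rewrite /phi.
have := normr_ge0 (ln (Num.min (eta * m') (rho / 2))); lra.
Qed.
End OnePeak.
End Barrier.

(** * The lower bound from peak functions *)
Section LowerBound.
Context {R : realType} {n : nat}.
Implicit Types (G : set 'rV[R[i]]_n) (p q zeta : 'rV[R[i]]_n) (f : R[i] -> 'rV[R[i]]_n).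

Lemma barrier_exists (eta Rb rho : R) : 0 < eta -> 0 < Rb -> 0 < rho -> rho <= eta ->
  exists C : R, forall G zeta, (forall p, G p -> enorm (p - zeta) <= Rb) -> ~ G zeta ->
    peak eta G zeta -> exists th : 'rV[R[i]]_n -> R,
    [/\ disc_lipschitz G th,
      forall p, G p -> rho / 2 <= enorm (p - zeta) -> th p = 0 &
      forall p, G p -> th p <= 2^-1 * ln (enorm (p - zeta)) + C].
Proof.
move=> eta0 Rb0 rho0 rhoeta; eexists => G zeta GRb zG [g [gh gp]].
have [th [h1 h2 h3]] := peak_barrier eta0 Rb0 rho0 rhoeta GRb zG gh gp.
by exists th; split=> // p /h3; rewrite -!addrA; exact.
Qed.

Lemma dist_to_approx p (B : set 'rV[R[i]]_n) : 0 < dist_to p B ->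
  exists2 q, B q & enorm (p - q) < 2 * dist_to p B.
Proof.
move=> d0; pose S := [set enorm (p - w) | w in B].
have S0 : S !=set0.
  apply/set0P/eqP => S0; move: d0; rewrite /dist_to -/S S0 inf0; lra.
have hS : has_inf S.
  by split=> //; exists 0 => _ [w _ <-]; exact: enorm_ge0.
have [_ [q Bq <-] hq] := inf_adherent d0 hS.
exists q => //; move: hq; rewrite -/(dist_to p B); lra.
Qed.

(** For [z] close to the boundary, take the barrier at a nearly closest boundary point;
    it vanishes outside a ball of radius [sig] about [z].  For the other [z] the
    logarithm is bounded below, and 0 will do. *)
Lemma localized_barrier (eta Rb sig : R) : 0 < eta -> 0 < Rb -> 0 < sig ->
  exists C : R, 0 <= C /\ forall G, open G -> (forall p, G p -> enorm p <= Rb) ->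
    (forall zeta, boundary G zeta -> peak eta G zeta) ->
    forall z, G z -> exists th : 'rV[R[i]]_n -> R,
    [/\ disc_lipschitz G th,
      forall p, G p -> sig < enorm (p - z) -> th p = 0 &
      th z <= 2^-1 * ln (dist_to z (boundary G)) + C].
Proof.
move=> eta0 Rb0 sig0; pose rho := Num.min eta sig.
have rho0 : 0 < rho by rewrite lt_min eta0.
have rhoe : rho <= eta by rewrite ge_min lexx.
have rhos : rho <= sig by rewrite ge_min lexx orbT.
have Rb'0 : 0 < 2 * Rb + sig by lra.
have [C hC] := barrier_exists eta0 Rb'0 rho0 rhoe.
exists (`|C| + `|ln 2| + `|ln (sig / 4)|); split; first by rewrite !addr_ge0.
move=> G oG GRb Gpeak z Gz.
(* the zero barrier serves if the distance is at least sig / 4, and also if it is 0,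
   where ln is 0 by convention *)
have far (c : R) : 0 <= 2^-1 * ln c + (`|C| + `|ln 2| + `|ln (sig / 4)|) ->
    dist_to z (boundary G) = c \/ c = sig / 4 /\ c <= dist_to z (boundary G) ->
    exists th : 'rV[R[i]]_n -> R, [/\ disc_lipschitz G th,
      forall p, G p -> sig < enorm (p - z) -> th p = 0 &
      th z <= 2^-1 * ln (dist_to z (boundary G)) + (`|C| + `|ln 2| + `|ln (sig / 4)|)].
  move=> c0 cd; exists (fun=> 0); split=> //.
    move=> f _ e e0; exists 1 => // w _; rewrite subrr normr0 mulr_ge0 ?cmod_ge0 //; lra.
  case: cd => [->//|[cs cd]].
  have : ln c <= ln (dist_to z (boundary G)).
    by rewrite ler_ln ?posrE //; [rewrite cs divr_gt0 | apply: lt_le_trans cd; rewrite cs divr_gt0].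
  lra.
have C0 : 0 <= `|C| + `|ln 2| + `|ln (sig / 4)| by rewrite !addr_ge0.
have [d0|d0] := leP (dist_to z (boundary G)) 0.
  by apply: far (or_introl erefl); rewrite ln0 // mulr0 add0r.
have [ds|ds] := leP (sig / 4) (dist_to z (boundary G)).
  apply: far (or_intror (conj erefl ds)).
  have := ler_norm (- ln (sig / 4)); rewrite normrN.
  have := normr_ge0 (ln (sig / 4)); have := normr_ge0 C; have := normr_ge0 (ln (2 : R)); lra.
have [zeta bz zd] := dist_to_approx d0.
have zs : enorm (z - zeta) < sig / 2 by lra.
have zb : enorm zeta <= Rb + sig.
  have := enormD z (zeta - z); rewrite addrC subrK enormB; have := GRb _ Gz; lra.
have zG : ~ G zeta by case: bz => _ + Gzt; apply; exact: open_nbhs_nbhs (conj oG Gzt).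
have dz : forall p, G p -> enorm (p - zeta) <= 2 * Rb + sig.
  move=> p Gp; have := enormD p (- zeta); rewrite enormN; have := GRb _ Gp; lra.
have [th [h1 h2 h3]] := hC G zeta dz zG (Gpeak _ bz).
exists th; split=> //.
  move=> p Gp ps; apply: h2 => //.
  have := enorm_dist_triangle p zeta z; rewrite (enormB zeta z); lra.
apply: le_trans (h3 _ Gz) _.
have ez : 0 < enorm (z - zeta).
  rewrite lt_def enorm_ge0 andbT; apply/eqP => /enorm_eq0 /eqP; rewrite subr_eq0 => /eqP e.
  by apply: zG; rewrite -e.
have : ln (enorm (z - zeta)) <= ln (2 * dist_to z (boundary G)).
  by rewrite ler_ln ?posrE ?mulr_gt0 // ltW.
rewrite lnM ?posrE //.
have := ler_norm C; have := ler_norm (ln (2 : R)).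
have := normr_ge0 (ln (sig / 4)); have := normr_ge0 (ln (2 : R)); lra.
Qed.

(** Near the centre of any given disc at least one of the two functions vanishes
    identically, so the slopes are not added. *)
Lemma disc_lipschitz_sub G th1 th2 z w (eps : R) : 0 < eps -> 3 * eps <= enorm (z - w) ->
  disc_lipschitz G th1 -> (forall p, G p -> eps < enorm (p - z) -> th1 p = 0) ->
  disc_lipschitz G th2 -> (forall p, G p -> eps < enorm (p - w) -> th2 p = 0) ->
  disc_lipschitz G (fun p => th2 p - th1 p).
Proof.
move=> eps0 zw l1 s1 l2 s2 f hf e e0.
have d0 : cmod (0 : R[i]) < 1 by rewrite cmod0.
have [fd Gf] := hf _ d0.
have near0 (x : 'rV[R[i]]_n) th : eps < enorm (f 0 - x) ->
    (forall p, G p -> eps < enorm (p - x) -> th p = 0 :> R) ->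
    exists2 d : R, 0 < d & forall t, cmod t < d -> th (f t) = 0 /\ th (f 0) = 0.
  move=> fx hth; have g0 : 0 < (enorm (f 0 - x) - eps) / 2 by lra.
  have fc k : ccont (fun t => f t ord0 k) 0 by exact/cdiff_ccont/fd.
  have [d d00 hd] := rcont_enorm x fc g0.
  exists (Num.min d 1); first by rewrite lt_min d00 ltr01.
  move=> t; rewrite lt_min => /andP[td t1]; split; last exact: hth.
  have := hd t; rewrite subr0 ler_norml => /(_ td) /andP[h _].
  by apply: hth; [case: (hf _ t1) | lra].
have [fz|fz] := ltP eps (enorm (f 0 - z)).
  have [d d00 hd] := near0 _ _ fz s1; have [d' d'0 hd'] := l2 _ hf _ e0.
  exists (Num.min d d'); first by rewrite lt_min d00.
  by move=> t; rewrite lt_min => /andP[/hd[-> ->] /hd']; rewrite !subr0.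
have fw : eps < enorm (f 0 - w).
  by have := enorm_dist_triangle z (f 0) w; rewrite (enormB z (f 0)); lra.
have [d d00 hd] := near0 _ _ fw s2; have [d' d'0 hd'] := l1 _ hf _ e0.
exists (Num.min d d'); first by rewrite lt_min d00.
move=> t; rewrite lt_min => /andP[/hd[-> ->] /hd'].
by rewrite !sub0r -opprD normrN.
Qed.

(** The difference [tw - tz] of the barriers at [w] and [z] takes the value [- tz z] at
    [z] and [tw w] at [w], and [- tz z - tw w] is at least the asserted lower
    bound. *)
Theorem kobayashi_lower_bound (eta Rb eps : R) : 0 < eta -> 0 < Rb -> 0 < eps ->
  exists C : R, 0 < C /\ forall G, open G -> (forall p, G p -> enorm p <= Rb) ->
    (forall zeta, boundary G zeta -> peak eta G zeta) ->
    forall z w, G z -> G w -> eps <= enorm (z - w) ->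
    ((- 2^-1 * ln (dist_to z (boundary G)) - 2^-1 * ln (dist_to w (boundary G)) - C)%:E
     <= kobayashi G z w)%E.
Proof.
move=> eta0 Rb0 eps0; have e30 : 0 < eps / 3 by rewrite divr_gt0.
have [C [C0 hC]] := localized_barrier eta0 Rb0 e30.
exists (2 * C + 1); split; first lra.
move=> G oG GRb Gp z w Gz Gw zw.
have [tz [z1 z2 z3]] := hC G oG GRb Gp z Gz.
have [tw [w1 w2 w3]] := hC G oG GRb Gp w Gw.
have zw3 : 3 * (eps / 3) <= enorm (z - w) by lra.
apply: le_trans (kobayashi_ge z w (disc_lipschitz_sub e30 zw3 z1 z2 w1 w2)).
have -> : tw z = 0 by apply: w2 => //; lra.
have -> : tz w = 0 by apply: z2 => //; rewrite enormB; lra.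
rewrite lee_fin; lra.
Qed.
End LowerBound.

(** * Taylor expansion to second order *)
Section EuclideanTopology.
Context {R : realType} {n : nat}.
Implicit Types (p q z w v X Y : 'rV[R[i]]_n) (A B : set 'rV[R[i]]_n).

Lemma enorm_lt_coord (d : R) X : 0 < d -> (forall k, cmod (X ord0 k) < d / (n%:R + 1)) ->
  enorm X < d.
Proof.
move=> d0 h; have N0 : 0 < n%:R + 1 :> R by rewrite ltr_wpDl ?ler0n.
rewrite -(@ltr_pXn2r _ 2) ?nnegrE ?enorm_ge0 ?(ltW d0) // enorm_sqr.
apply: (@le_lt_trans _ _ (\sum_(k < n) (d / (n%:R + 1)) ^+ 2)).
  apply: ler_sum => k _; rewrite ler_pXn2r ?nnegrE ?cmod_ge0 ?(ltW (h k)) //.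
  by rewrite divr_ge0 ?ltW.
rewrite sumr_const card_ord expr_div_n -[_ *+ n]mulr_natl mulrCA gtr_pMr ?exprn_gt0 //.
rewrite ltr_pdivrMr ?exprn_gt0 // mul1r.
have := ler0n R n; rewrite expr2; nra.
Qed.

Lemma nbhs_enormP z A : nbhs z A <->
  exists2 d : R, 0 < d & forall w, enorm (w - z) < d -> A w.
Proof.
split.
  move=> /nbhs_ballP[e /= e0 he]; have [d d0 dE] := posC_real e0.
  exists d => // w wz; apply: he; split=> // i k; rewrite !ord1.
  rewrite /ball /= normC_cmod cmodB dE ltcR.
  by apply: le_lt_trans wz; have := cmod_le_enorm (w - z) k; rewrite !mxE.
move=> [d d0 hd]; have N0 : 0 < n%:R + 1 :> R by rewrite ltr_wpDl ?ler0n.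
apply/nbhs_ballP; exists (d / (n%:R + 1))%:C; first by rewrite /= ltcR divr_gt0.
move=> w [_ hw]; apply: hd; apply: enorm_lt_coord => // k.
by have := hw ord0 k; rewrite /ball /= normC_cmod cmodB ltcR !mxE.
Qed.

Lemma continuous_enormP (u : 'rV[R[i]]_n -> R) z : {for z, continuous u} <->
  forall e, 0 < e -> exists2 d : R, 0 < d & forall w, enorm (w - z) < d -> `|u w - u z| <= e.
Proof.
split=> [/(@cvgrPdist_le _ _ _ (nbhs z) (nbhs_filter z)) h e /h /nbhs_enormP [d d0 hd]|h].
  by exists d => // w wz; rewrite distrC; apply: hd.
apply/(@cvgrPdist_le _ _ _ (nbhs z) (nbhs_filter z)) => e /h [d d0 hd]; apply/nbhs_enormP; exists d => // w /hd.
by rewrite distrC.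
Qed.

Lemma open_enormP A : open A -> forall z, A z ->
  exists2 d : R, 0 < d & forall w, enorm (w - z) < d -> A w.
Proof. by move=> oA z Az; apply/nbhs_enormP; exact: open_nbhs_nbhs. Qed.
End EuclideanTopology.

Section SecondOrderTaylor.
Context {R : realType} {n : nat}.
Implicit Types (p q z w v X Y : 'rV[R[i]]_n) (U : set 'rV[R[i]]_n) (u : 'rV[R[i]]_n -> R).

Lemma unit_mvt (F dF : R -> R) (b k : R) :
  (forall s : R, 0 <= s <= 1 -> is_derive s (1 : R) F (dF s)) ->
  (forall s : R, 0 <= s <= 1 -> `|dF s - b| <= k) -> `|F 1 - F 0 - b| <= k.
Proof.
move=> hd hb; have [||c] := @MVT_segment R F dF 0 1 ler01.
- by move=> x; rewrite in_itv /= => /andP[x0 x1]; apply: hd; rewrite !ltW.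
- apply: derivable_within_continuous => x; rewrite in_itv /= => xx.
  by apply: ex_derive; exact: hd.
rewrite in_itv /= subr0 mulr1 => hc ->; exact: hb.
Qed.

Lemma unit_taylor2 (F F1 F2 : R -> R) (h K : R) : 0 <= K ->
  (forall s : R, 0 <= s <= 1 -> is_derive s (1 : R) F (F1 s)) ->
  (forall s : R, 0 <= s <= 1 -> is_derive s (1 : R) F1 (F2 s)) ->
  (forall s : R, 0 <= s <= 1 -> `|F2 s - h| <= K) ->
  `|F 1 - F 0 - F1 0 - 2^-1 * h| <= K.
Proof.
move=> K0 dF dF1 bF2.
have b1 (s : R) : 0 <= s <= 1 -> `|F1 s - F1 0 - h * s| <= K.
  move=> /andP[s0 s1].
  have -> : F1 s - F1 0 - h * s = F1 (s * 1) - F1 (s * 0) - h * s by rewrite mulr1 mulr0.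
  apply: (@unit_mvt (fun t => F1 (s * t)) (fun t => s * F2 (s * t))) => t /andP[t0 t1].
    apply: bound_is_derive => e e0.
    have st : 0 <= s * t <= 1 by rewrite mulr_ge0 //= mulr_ile1.
    have [d d0 hd] := is_derive_bound (dF1 _ st) e0; exists d => // y yt.
    have yt' : `|s * y - s * t| <= `|y - t|.
      by rewrite -mulrBr normrM ger0_norm // ler_piMl.
    have := hd _ (le_lt_trans yt' yt).
    rewrite -mulrBr mulrA [F2 _ * s]mulrC => /le_trans; apply.
    by rewrite ler_wpM2l ?(ltW e0) // normrM ger0_norm // ler_piMl.
  rewrite [h * s]mulrC -mulrBr normrM ger0_norm //.
  have st : 0 <= s * t <= 1 by rewrite mulr_ge0 //= mulr_ile1.
  by apply: le_trans (bF2 _ st); rewrite ler_piMl.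
have -> : F 1 - F 0 - F1 0 - 2^-1 * h =
  (F 1 - F1 0 * 1 - 2^-1 * h * 1 ^+ 2) - (F 0 - F1 0 * 0 - 2^-1 * h * 0 ^+ 2) - 0 by ring.
apply: (@unit_mvt (fun s => F s - F1 0 * s - 2^-1 * h * s ^+ 2) (fun s => F1 s - F1 0 - h * s)).
  move=> s s01; apply: bound_is_derive => e e0.
  have e20 : 0 < e / 2 by rewrite divr_gt0.
  have [d d0 hd] := is_derive_bound (dF s s01) e20.
  have c0 : 0 < `|h| + 1 by rewrite ltr_wpDl.
  exists (Num.min d (e / (`|h| + 1))); first by rewrite lt_min d0 divr_gt0.
  move=> t; rewrite lt_min => /andP[/hd h1]; rewrite ltr_pdivlMr // => h2.
  have -> : F t - F1 0 * t - 2^-1 * h * t ^+ 2 - (F s - F1 0 * s - 2^-1 * h * s ^+ 2)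
      - (F1 s - F1 0 - h * s) * (t - s) =
    (F t - F s - F1 s * (t - s)) - 2^-1 * (h * (t - s)) * (t - s) by field.
  apply: le_trans (ler_normB _ _) _; rewrite (normrM _ (t - s)) (normrM 2^-1) (normrM h) gtr0_norm //.
  have : 2^-1 * (`|h| * `|t - s|) * `|t - s| <= 2^-1 * e * `|t - s|.
    rewrite ler_wpM2r // ler_wpM2l //; apply: ltW; apply: le_lt_trans h2.
    by rewrite mulrC ler_wpM2l // lerDl.
  lra.
by move=> s /b1; rewrite subr0.
Qed.

Lemma line_is_derive v u z (s : R) : pderivable v u (z + s%:C *: v) ->
  is_derive s (1 : R) (fun t => u (z + t%:C *: v)) (pderiv v u (z + s%:C *: v)).
Proof.
move=> hp; apply: bound_is_derive => e e0.
have hd : is_derive (0 : R) (1 : R) (line_restriction v u (z + s%:C *: v)) (pderiv v u (z + s%:C *: v)).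
  by rewrite /pderiv derive1E; exact: derivableP.
have [d d0 h] := is_derive_bound hd e0; exists d => // t ts.
have E x : z + s%:C *: v + x%:C *: v = z + (s + x)%:C *: v.
  by rewrite rmorphD scalerDl addrA.
by have := h (t - s); rewrite subr0 /line_restriction !E addr0 [s + _]addrC subrK; exact.
Qed.

Lemma bound_pderiv v u z l : is_derive (0 : R) (1 : R) (fun t => u (z + t%:C *: v)) l ->
  pderivable v u z /\ pderiv v u z = l.
Proof.
move=> h; split; first exact: (@ex_derive _ _ _ _ _ _ _ h).
by rewrite /pderiv derive1E; exact: (@derive_val _ _ _ _ _ _ _ h).
Qed.

Lemma enorm_real_dir (a : 'I_n * bool) : enorm (real_dir a : 'rV[R[i]]_n) <= 1.
Proof.
rewrite /real_dir enormZ; have -> : cmod (if a.2 then 'i else 1) = 1 :> R.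
  by case: a.2; rewrite ?cmod1 // cmodE /= expr0n expr1n add0r sqrtr1.
rewrite mul1r -(@ler_pXn2r _ 2) ?nnegrE ?enorm_ge0 // enorm_sqr expr1n.
rewrite (bigD1 a.1) //= mxE !eqxx cmod1 expr1n big1 ?addr0 // => k ka.
by rewrite mxE (negbTE ka) andbF cmod0 expr0n.
Qed.

(** Mean value theorem along a path that moves in one coordinate direction at a time:
    this is how hypotheses on partial derivatives in the coordinate directions
    yield estimates in arbitrary directions. *)
Lemma coordinate_steps u p (al : 'I_n * bool -> R) (k S : R) (x : 'I_n * bool -> R)
    (s : seq ('I_n * bool)) : 0 <= k ->
  \sum_(a <- s) `|x a| <= S ->
  (forall Y, enorm Y <= S -> forall a, pderivable (real_dir a) u (p + Y) /\
     `|pderiv (real_dir a) u (p + Y) - al a| <= k) ->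
  `|u (p + \sum_(a <- s) (x a)%:C *: real_dir a) - u p - \sum_(a <- s) x a * al a|
    <= k * \sum_(a <- s) `|x a|.
Proof.
move=> k0 + hu; elim: s => [|a s IH].
  by rewrite !big_nil addr0 subrr subr0 normr0 mulr0.
rewrite !big_cons => hS.
have hs : \sum_(b <- s) `|x b| <= S by have := normr_ge0 (x a); lra.
set T := \sum_(b <- s) _ *: _; have {}IH := IH hs; rewrite -/T in IH.
have eT : enorm T <= \sum_(b <- s) `|x b|.
  rewrite /T; elim: (s) => [|b l ih]; first by rewrite !big_nil enorm0.
  rewrite !big_cons; apply: le_trans (enormD _ _) _; apply: lerD => //.
  by rewrite enormZ cmodR ler_piMr ?enorm_real_dir.
pose F t := u (p + T + (t * x a)%:C *: real_dir a).
have hF : `|F 1 - F 0 - x a * al a| <= k * `|x a|.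
  have hT (t : R) : 0 <= t <= 1 -> enorm (T + (t * x a)%:C *: real_dir a) <= S.
    move=> /andP[t0 t1]; apply: le_trans (enormD _ _) _; rewrite enormZ cmodR normrM.
    have : `|t| * `|x a| * enorm (real_dir a : 'rV[R[i]]_n) <= `|x a|.
      rewrite -[leRHS]mulr1 ler_pM ?mulr_ge0 ?enorm_ge0 ?enorm_real_dir //.
      by rewrite ler_piMl // ger0_norm.
    lra.
  apply: (@unit_mvt F (fun t => x a * pderiv (real_dir a) u (p + (T + (t * x a)%:C *: real_dir a)))).
    move=> t t01; have [dt _] := hu _ (hT t t01) a; rewrite addrA in dt.
    have hl := line_is_derive dt; rewrite -addrA in hl.
    apply: bound_is_derive => e e0.
    have K0 : 0 < `|x a| + 1 by have := normr_ge0 (x a); lra.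
    have [d d0 hd] := is_derive_bound hl (divr_gt0 e0 K0).
    exists (d / (`|x a| + 1)); first by rewrite divr_gt0.
    move=> y; rewrite ltr_pdivlMr // => yt.
    have e1 : `|y * x a - t * x a| = `|y - t| * `|x a| by rewrite -mulrBl normrM.
    have := hd (y * x a); rewrite e1 => hh.
    have -> : F y - F t - x a * pderiv (real_dir a) u (p + (T + (t * x a)%:C *: real_dir a)) * (y - t)
     = u (p + T + (y * x a)%:C *: real_dir a) - u (p + T + (t * x a)%:C *: real_dir a)
      - pderiv (real_dir a) u (p + (T + (t * x a)%:C *: real_dir a)) * (y * x a - t * x a).
      by rewrite /F; ring.
    apply: le_trans (hh _) _.
      by apply: le_lt_trans yt; rewrite ler_wpM2l // lerDl.
    rewrite mulrCA [leRHS]mulrC ler_wpM2l // -mulrA ler_piMr ?(ltW e0) //.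
    by rewrite mulrC ler_pdivrMr // mul1r lerDl.
  move=> t t01; have [_ ht] := hu _ (hT t t01) a.
  by rewrite -mulrBr normrM mulrC ler_wpM2r.
have e0 : F 0 = u (p + T) by rewrite /F mul0r scale0r addr0.
have e1 : F 1 = u (p + ((x a)%:C *: real_dir a + T)).
  by rewrite /F mul1r -addrA [T + _]addrC.
rewrite -e1 mulrDr; rewrite e0 in hF.
move: hF IH; rewrite !ler_norml; lra.
Qed.

Definition rcoord (a : 'I_n * bool) X : R :=
  if a.2 then complex.Im (X ord0 a.1) else complex.Re (X ord0 a.1).

Lemma rcoord_le a X : `|rcoord a X| <= enorm X.
Proof.
apply: le_trans (cmod_le_enorm X a.1); rewrite /rcoord.
by case: a.2; [exact: Im_le_cmod | exact: Re_le_cmod].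
Qed.

Lemma rcoordZ a (t : R) X : rcoord a (t%:C *: X) = t * rcoord a X.
Proof. by rewrite /rcoord mxE cReM cImM /= !mul0r subr0 addr0; case: a.2. Qed.

Lemma sum_real_dirs (V : zmodType) (F : 'I_n * bool -> V) :
  \sum_a F a = \sum_(k < n) (F (k, false) + F (k, true)).
Proof.
rewrite (eq_bigr (fun ab : 'I_n * bool => F (ab.1, ab.2))); last by case.
rewrite -(pair_bigA _ (fun k b => F (k, b))) /=; apply: eq_bigr => k _.
by rewrite big_bool /= addrC.
Qed.

Lemma rcoord_expand X : X = \sum_a (rcoord a X)%:C *: real_dir a.
Proof.
rewrite sum_real_dirs; apply/rowP => j; rewrite summxE (bigD1 j) //= big1 ?addr0.
  rewrite !mxE !eqxx /rcoord /= !mulr1; case: (X ord0 j) => x y.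
  by apply: complex_ext; rewrite ?cReD ?cImD /=; ring.
by move=> k kj; rewrite !mxE [j == k]eq_sym (negbTE kj) andbF !mulr0 addr0.
Qed.

(** Directional derivatives from continuous partial derivatives, by the estimate
    along coordinate steps. *)
Lemma chain_rule u p : (exists2 d : R, 0 < d & forall q, enorm (q - p) < d ->
    forall a, pderivable (real_dir a) u q) ->
  (forall a, {for p, continuous (pderiv (real_dir a) u)}) ->
  forall X, is_derive (0 : R) (1 : R) (fun t => u (p + t%:C *: X))
    (\sum_a rcoord a X * pderiv (real_dir a) u p).
Proof.
move=> [d d0 hd] hc X; apply: bound_is_derive => e e0.
pose S := \sum_(a : 'I_n * bool) `|rcoord a X|.
have S0 : 0 <= S by apply: sumr_ge0.
have S1 : 0 < S + 1 by lra.
have eS : 0 < e / (S + 1) by rewrite divr_gt0.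
have [d' hd'] := choice (fun a => let: ex_intro2 d d0 h := (continuous_enormP _ _).1 (hc a) _ eS in
  ex_intro (fun d => 0 < d /\ forall w, enorm (w - p) < d ->
    `|pderiv (real_dir a) u w - pderiv (real_dir a) u p| <= e / (S + 1)) d (conj d0 h)).
pose d1 := \big[Num.min/d]_a d' a.
have d10 : 0 < d1.
  by rewrite /d1; elim/big_ind: _ => // [x y x0 y0|a _]; [rewrite lt_min x0 | case: (hd' a)].
exists (d1 / (S + 1)); first by rewrite divr_gt0.
move=> t; rewrite subr0 ltr_pdivlMr // => td.
have hx a : rcoord a (t%:C *: X) = t * rcoord a X by exact: rcoordZ.
have sumx : \sum_a `|rcoord a (t%:C *: X)| = `|t| * S.
  by rewrite mulr_sumr; apply: eq_bigr => a _; rewrite hx normrM.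
have tS : `|t| * S < d1.
  by apply: le_lt_trans td; rewrite ler_wpM2l // lerDl.
have := @coordinate_steps u p (fun a => pderiv (real_dir a) u p) (e / (S + 1)) (`|t| * S)
  (fun a => rcoord a (t%:C *: X)) (index_enum _) (ltW eS).
rewrite sumx -rcoord_expand => /(_ (lexx _)) H.
rewrite scale0r addr0.
have -> : (\sum_a rcoord a X * pderiv (real_dir a) u p) * t =
    \sum_a rcoord a (t%:C *: X) * pderiv (real_dir a) u p.
  by rewrite mulr_suml; apply: eq_bigr => a _; rewrite hx; ring.
apply: le_trans (H _) _.
  move=> Y YS a; have Yd1 : enorm (p + Y - p) < d1.
    by rewrite addrC addKr; exact: le_lt_trans YS tS.
  split.
    by apply: hd; apply: lt_le_trans Yd1 _; rewrite /d1 bigmin_le_id.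
  have [_] := hd' a; apply; apply: lt_le_trans Yd1 _; exact: bigmin_le_cond.
rewrite mulrCA [leRHS]mulrC ler_wpM2l // -mulrA ler_piMr ?(ltW e0) //.
by rewrite mulrC ler_pdivrMr // mul1r lerDl.
Qed.

Lemma C2_chain U u p : open U -> C2_on U u -> U p -> forall X,
  is_derive (0 : R) (1 : R) (fun t => u (p + t%:C *: X))
    (\sum_a rcoord a X * pderiv (real_dir a) u p).
Proof.
move=> oU hu Up; have [d d0 hd] := open_enormP oU Up.
apply: chain_rule; last by move=> a; case: (hu p Up) => _ /(_ a)[].
by exists d => // q /hd Uq a; case: (hu q Uq) => _ /(_ a)[].
Qed.

Lemma C2_chain2 U u p a : open U -> C2_on U u -> U p -> forall X,
  is_derive (0 : R) (1 : R) (fun t => pderiv (real_dir a) u (p + t%:C *: X))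
    (\sum_b rcoord b X * pderiv (real_dir b) (pderiv (real_dir a) u) p).
Proof.
move=> oU hu Up; have [d d0 hd] := open_enormP oU Up.
apply: chain_rule; last by move=> b; case: (hu p Up) => _ _ /(_ a b)[].
by exists d => // q /hd Uq b; case: (hu q Uq) => _ _ /(_ a b)[].
Qed.

Lemma is_derive_shift (F : R -> R) s l : is_derive (0 : R) (1 : R) (fun t => F (s + t)) l ->
  is_derive s (1 : R) F l.
Proof.
move=> h; apply: bound_is_derive => e /(is_derive_bound h) [d d0 hd].
exists d => // t ts; have := hd (t - s); rewrite subr0 addr0 [s + _]addrC subrK; exact.
Qed.

(** [H] is a constant matrix close to the Hessian on the ball; later it is the Hessian
    at [z], and [k] its modulus of continuity.  Then the remainder is uniform over
    families of functions with the same [k] and [rho]. *)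
Lemma taylor2 U u z X (H : 'I_n * bool -> 'I_n * bool -> R) (k rho : R) :
  open U -> C2_on U u -> 0 <= k ->
  (forall q, enorm (q - z) < rho -> U q /\ forall a b,
     `|pderiv (real_dir b) (pderiv (real_dir a) u) q - H a b| <= k) ->
  enorm X < rho ->
  `|u (z + X) - u z - \sum_a rcoord a X * pderiv (real_dir a) u z
     - 2^-1 * \sum_a \sum_b H a b * rcoord a X * rcoord b X|
   <= k * (n * 2)%:R ^+ 2 * enorm X ^+ 2.
Proof.
move=> oU hu k0 hH Xr.
pose q s := z + s%:C *: X.
have qU (s : R) : 0 <= s <= 1 -> U (q s) /\ forall a b,
     `|pderiv (real_dir b) (pderiv (real_dir a) u) (q s) - H a b| <= k.
  move=> /andP[s0 s1]; apply: hH; rewrite /q addrC addKr enormZ cmodR ger0_norm //.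
  by apply: le_lt_trans Xr; rewrite ler_piMl ?enorm_ge0.
pose F s := u (q s).
pose F1 s := \sum_a rcoord a X * pderiv (real_dir a) u (q s).
pose F2 s := \sum_a rcoord a X * (\sum_b rcoord b X * pderiv (real_dir b) (pderiv (real_dir a) u) (q s)).
pose h := \sum_a \sum_b H a b * rcoord a X * rcoord b X.
pose K := k * (n * 2)%:R ^+ 2 * enorm X ^+ 2.
have qD (s t : R) : q (s + t) = q s + t%:C *: X by rewrite /q rmorphD scalerDl addrA.
have dF (s : R) : 0 <= s <= 1 -> is_derive s (1 : R) F (F1 s).
  move=> /qU[Uq _]; apply: is_derive_shift.
  have -> : (fun t => F (s + t)) = (fun t => u (q s + t%:C *: X)).
    by apply/funext => t; rewrite /F qD.
  exact: (C2_chain oU hu Uq X).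
have dF1 (s : R) : 0 <= s <= 1 -> is_derive s (1 : R) F1 (F2 s).
  move=> /qU[Uq _].
  have -> : F1 = \sum_a (rcoord a X \*: (fun t => pderiv (real_dir a) u (q t))).
    by apply/funext => t; rewrite fct_sumE.
  rewrite /F2; elim/big_ind2: _ => [|f1 d1 f2 d2 h1 h2|a _].
  - exact: is_derive_cst.
  - exact: is_deriveD.
  apply: is_deriveZ; apply: is_derive_shift.
  have -> : (fun t => pderiv (real_dir a) u (q (s + t))) =
      (fun t => pderiv (real_dir a) u (q s + t%:C *: X)).
    by apply/funext => t; rewrite qD.
  exact: (C2_chain2 a oU hu Uq X).
have bF2 (s : R) : 0 <= s <= 1 -> `|F2 s - h| <= K.
  move=> /qU[_ hs]; rewrite /F2 /h -sumrB.
  apply: (@le_trans _ _ (\sum_(a : 'I_n * bool) \sum_(b : 'I_n * bool) k * enorm X ^+ 2)).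
    apply: le_trans (ler_norm_sum _ _ _) _; apply: ler_sum => a _.
    rewrite mulr_sumr -sumrB; apply: le_trans (ler_norm_sum _ _ _) _; apply: ler_sum => b _.
    set D := pderiv _ _ _.
    have -> : rcoord a X * (rcoord b X * D) - H a b * rcoord a X * rcoord b X =
       (D - H a b) * (rcoord a X * rcoord b X) by ring.
    rewrite normrM normrM expr2; apply: ler_pM => //; first exact: hs.
    by apply: ler_pM; rewrite // rcoord_le.
  rewrite !sumr_const card_prod card_ord card_bool /K -mulrnA -[leLHS]mulr_natr natrM.
  rewrite le_eqVlt; apply/orP; left; apply/eqP; ring.
have K0 : 0 <= K by apply: mulr_ge0; rewrite ?sqr_ge0 // mulr_ge0 // sqr_ge0.
have := unit_taylor2 K0 dF dF1 bF2.
have q0 : q 0 = z by rewrite /q scale0r addr0.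
have q1 : q 1 = z + X by rewrite /q scale1r.
by rewrite /F /F1 q0 q1.
Qed.
End SecondOrderTaylor.

(** * The Levi form in real coordinates *)
Section LeviAlgebra.
Context {R : realType} {n : nat}.
Implicit Types (X Y z : 'rV[R[i]]_n) (al : 'I_n * bool -> R)
  (H : 'I_n * bool -> 'I_n * bool -> R) (r : 'rV[R[i]]_n -> R).

(** With [al] the real gradient of [r] this is [2 * \sum_k (d r / d z_k) X_k]. *)
Definition lin al X : R[i] :=
  \sum_(k < n) (al (k, false) -i* al (k, true)) * X ord0 k.

Definition qform H X : R := \sum_a \sum_b H a b * rcoord a X * rcoord b X.

(** The Levi form of a function with real Hessian [H], as a mean over [X] and [i X]. *)
Definition levi H X : R := 4^-1 * (qform H X + qform H ('i *: X)).

(** With [H] the real Hessian of [r] this is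
    [2 * \sum_(j, k) (d^2 r / d z_j d z_k) X_j X_k]. *)
Definition holq H X : R[i] := \sum_(j < n) \sum_(k < n)
  (2^-1 * (H (j, false) (k, false) - H (j, true) (k, true))
   -i* (2^-1 * (H (j, true) (k, false) + H (j, false) (k, true))))
  * (X ord0 j * X ord0 k).

Lemma Re_lin al X : complex.Re (lin al X) = \sum_a rcoord a X * al a.
Proof.
rewrite Re_sum sum_real_dirs; apply: eq_bigr => k _.
rewrite cReM /rcoord /=; ring.
Qed.

Lemma qform_pairs H X : qform H X = \sum_(j < n) \sum_(k < n)
  (H (j, false) (k, false) * complex.Re (X ord0 j) * complex.Re (X ord0 k)
   + H (j, false) (k, true) * complex.Re (X ord0 j) * complex.Im (X ord0 k)
   + (H (j, true) (k, false) * complex.Im (X ord0 j) * complex.Re (X ord0 k)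
   + H (j, true) (k, true) * complex.Im (X ord0 j) * complex.Im (X ord0 k))).
Proof.
rewrite /qform sum_real_dirs; apply: eq_bigr => j _.
by rewrite !sum_real_dirs -big_split /=.
Qed.

(** The Hessian is the sum of its part invariant under multiplication by [i], which is the
    Levi form, and its anti-invariant part, which is the real part of a holomorphic
    quadratic polynomial. *)
Lemma qform_split H X : qform H X = 2 * levi H X + complex.Re (holq H X).
Proof.
rewrite /levi !qform_pairs Re_sum -big_split /= !mulr_sumr -big_split /=.
apply: eq_bigr => j _; rewrite Re_sum -big_split /= !mulr_sumr -big_split /=.
apply: eq_bigr => k _; rewrite !mxE !cReM !cImM /=; by field.
Qed.

Lemma linZ al (t : R) X : lin al (t%:C *: X) = t%:C * lin al X.
Proof. by rewrite /lin mulr_sumr; apply: eq_bigr => k _; rewrite mxE mulrCA. Qed.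

Lemma linB al al' X : lin al X - lin al' X = lin (fun a => al a - al' a) X.
Proof.
rewrite /lin -sumrB; apply: eq_bigr => k _; rewrite -mulrBl; congr (_ * _).
by apply: complex_ext; rewrite ?cReD ?cImD ?cReN ?cImN /=; ring.
Qed.

Lemma qformZ H (t : R) X : qform H (t%:C *: X) = t ^+ 2 * qform H X.
Proof.
rewrite /qform mulr_sumr; apply: eq_bigr => a _; rewrite mulr_sumr.
by apply: eq_bigr => b _; rewrite !rcoordZ; ring.
Qed.

Lemma qformB H H' X : qform H X - qform H' X = qform (fun a b => H a b - H' a b) X.
Proof.
rewrite /qform -sumrB; apply: eq_bigr => a _; rewrite -sumrB.
by apply: eq_bigr => b _; ring.
Qed.

Lemma leviZ H (t : R) X : levi H (t%:C *: X) = t ^+ 2 * levi H X.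
Proof.
rewrite /levi qformZ.
have -> : 'i *: (t%:C *: X) = t%:C *: ('i *: X) by rewrite !scalerA mulrC.
rewrite qformZ; ring.
Qed.

Lemma leviB H H' X : levi H X - levi H' X = levi (fun a b => H a b - H' a b) X.
Proof. by rewrite /levi -!qformB; ring. Qed.

Local Notation N := ((n * 2)%:R : R).

Lemma cmod_Complex_le (x y : R) : cmod (x -i* y) <= `|x| + `|y|.
Proof. by apply: le_trans (cmod_le_ReIm _) _; rewrite /= normrN. Qed.

Lemma lin_bound al X (B : R) : (forall a, `|al a| <= B) -> cmod (lin al X) <= B * N * enorm X.
Proof.
move=> hB; rewrite /lin; apply: le_trans (cmod_sum _ _) _.
apply: (@le_trans _ _ (\sum_(k < n) (B + B) * enorm X)).
  apply: ler_sum => k _; rewrite cmodM; apply: ler_pM; rewrite ?cmod_ge0 ?cmod_le_enorm //.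
  by apply: le_trans (cmod_Complex_le _ _) _; apply: lerD.
rewrite sumr_const card_ord -[leLHS]mulr_natr natrM le_eqVlt; apply/orP; left; apply/eqP; ring.
Qed.

Lemma qform_bound H X (B : R) : (forall a b, `|H a b| <= B) ->
  `|qform H X| <= B * N ^+ 2 * enorm X ^+ 2.
Proof.
move=> hB; rewrite /qform.
apply: (@le_trans _ _ (\sum_(a : 'I_n * bool) \sum_(b : 'I_n * bool) B * enorm X ^+ 2)).
  apply: le_trans (ler_norm_sum _ _ _) _; apply: ler_sum => a _.
  apply: le_trans (ler_norm_sum _ _ _) _; apply: ler_sum => b _.
  rewrite -mulrA !normrM expr2; apply: ler_pM => //.
  by apply: ler_pM; rewrite // rcoord_le.
rewrite !sumr_const card_prod card_ord card_bool -mulrnA -[leLHS]mulr_natr natrM.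
rewrite le_eqVlt; apply/orP; left; apply/eqP; ring.
Qed.

Lemma enormZi X : enorm ('i *: X) = enorm X.
Proof. by rewrite enormZ cmodE /= expr0n expr1n add0r sqrtr1 mul1r. Qed.

Lemma levi_bound H X (B : R) : (forall a b, `|H a b| <= B) ->
  `|levi H X| <= B * N ^+ 2 * enorm X ^+ 2.
Proof.
move=> hB; rewrite /levi.
have h1 := qform_bound X hB; have := qform_bound ('i *: X) hB; rewrite enormZi => h2.
have := le_trans (normr_ge0 _) h1.
move: h1 h2; rewrite !ler_norml; lra.
Qed.

Lemma holq_bound H X (B : R) : (forall a b, `|H a b| <= B) ->
  cmod (holq H X) <= B * N ^+ 2 * enorm X ^+ 2.
Proof.
move=> hB; rewrite /holq; apply: le_trans (cmod_sum _ _) _.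
apply: (@le_trans _ _ (\sum_(j < n) \sum_(k < n) (2 * B) * enorm X ^+ 2)).
  apply: ler_sum => j _; apply: le_trans (cmod_sum _ _) _; apply: ler_sum => k _.
  rewrite cmodM; apply: ler_pM; rewrite ?cmod_ge0 //.
    apply: le_trans (cmod_Complex_le _ _) _.
    have h1 := hB (j, false) (k, false); have h2 := hB (j, true) (k, true).
    have h3 := hB (j, true) (k, false); have h4 := hB (j, false) (k, true).
    rewrite !normrM gtr0_norm //.
    have := ler_normB (H (j, false) (k, false)) (H (j, true) (k, true)).
    have := ler_normD (H (j, true) (k, false)) (H (j, false) (k, true)); lra.
  by rewrite cmodM expr2; apply: ler_pM; rewrite ?cmod_ge0 ?cmod_le_enorm.
rewrite !sumr_const !card_ord -mulrnA -[leLHS]mulr_natr !natrM.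
have [nE|n0] := posnP n.
  have -> : n%:R = 0 :> R by rewrite nE.
  by rewrite !mul0r !mulr0 expr0n mulr0 mul0r.
have B0 : 0 <= B.
  by apply: le_trans (normr_ge0 _) (hB (Ordinal n0, true) (Ordinal n0, true)).
have : 0 <= B * enorm X ^+ 2 * (n%:R * n%:R).
  by apply: mulr_ge0; apply: mulr_ge0; rewrite ?sqr_ge0 ?ler0n.
lra.
Qed.

Lemma pderiv_scale v r z (c : R) : pderivable v r z ->
  pderiv v (fun x => c * r x) z = c * pderiv v r z.
Proof.
move=> hr.
have hd : is_derive (0 : R) (1 : R) (line_restriction v r z) (pderiv v r z).
  by rewrite /pderiv derive1E; exact: derivableP.
have := is_deriveZ c hd; rewrite /pderiv [in LHS]derive1E => h.
by rewrite -[RHS](@derive_val _ _ _ _ _ _ _ h).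
Qed.

Lemma pderiv_cst v (c : R) z : pderiv v (fun _ : 'rV[R[i]]_n => c) z = 0.
Proof. by rewrite /pderiv derive1_cst. Qed.

Lemma pderivC_real v r z : pderivC v (fun x => (r x)%:C) z = (pderiv v r z)%:C.
Proof. by rewrite /pderivC /= pderiv_cst. Qed.

Lemma d_dz_real j r z : d_dz j (fun x => (r x)%:C) z =
  2^-1 * (pderiv (real_dir (j, false)) r z -i* pderiv (real_dir (j, true)) r z).
Proof.
rewrite /d_dz !pderivC_real; move: (pderiv _ r z) (pderiv _ r z) => x y.
congr (_ * _); apply: complex_ext.
  by rewrite cReD cReN cReM /=; ring.
by rewrite cImD cImN cImM /=; ring.
Qed.

Lemma half_complex : (2^-1 : R[i]) = (2^-1)%:C.
Proof. by rewrite fmorphV rmorph_nat. Qed.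

Lemma d_dzbar_real k r z : d_dzbar k (fun x => (r x)%:C) z =
  (2^-1 * pderiv (real_dir (k, false)) r z) +i* (2^-1 * pderiv (real_dir (k, true)) r z).
Proof.
rewrite /d_dzbar !pderivC_real half_complex.
move: (pderiv _ r z) (pderiv _ r z) => x y; apply: complex_ext.
  by rewrite cReM cReD cReM cImD cImM /=; ring.
by rewrite cImM cReD cReM cImD cImM /=; ring.
Qed.

Lemma complex_tangentE r z X : complex_tangent r z X <->
  lin (fun a => pderiv (real_dir a) r z) X = 0.
Proof.
rewrite /complex_tangent /=.
have -> : \sum_(j < n) d_dz j (fun x => (r x)%:C) z * X ord0 j =
    2^-1 * lin (fun a => pderiv (real_dir a) r z) X.
  by rewrite /lin mulr_sumr; apply: eq_bigr => j _; rewrite d_dz_real mulrA.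
split=> [/eqP|->]; last by rewrite mulr0.
by rewrite mulf_eq0 invr_eq0 pnatr_eq0 /= => /eqP.
Qed.

Lemma pderivC_dzbar U r z k a : C2_on U r -> U z ->
  let H a b := pderiv (real_dir b) (pderiv (real_dir a) r) z in
  pderivC (real_dir a) (d_dzbar k (fun x => (r x)%:C)) z =
  (2^-1 * H (k, false) a) +i* (2^-1 * H (k, true) a).
Proof.
move=> hr Uz H; have [_ _ h2] := hr z Uz.
have E b : pderiv (real_dir a) (fun x => 2^-1 * pderiv (real_dir b) r x) z = 2^-1 * H b a.
  by apply: pderiv_scale; case: (h2 b a).
have ERe : (fun x => complex.Re (d_dzbar k (fun x => (r x)%:C) x)) =
    (fun x => 2^-1 * pderiv (real_dir (k, false)) r x).
  by apply: funext => x; rewrite d_dzbar_real.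
have EIm : (fun x => complex.Im (d_dzbar k (fun x => (r x)%:C) x)) =
    (fun x => 2^-1 * pderiv (real_dir (k, true)) r x).
  by apply: funext => x; rewrite d_dzbar_real.
have e1 := congr1 (fun g => pderiv (real_dir a) g z) ERe.
have e2 := congr1 (fun g => pderiv (real_dir a) g z) EIm.
exact: (f_equal2 (@Complex R) (etrans e1 (E (k, false))) (etrans e2 (E (k, true)))).
Qed.

Lemma d_dz_dzbar U r z j k : C2_on U r -> U z ->
  let H a b := pderiv (real_dir b) (pderiv (real_dir a) r) z in
  d_dz j (d_dzbar k (fun x => (r x)%:C)) z =
  (4^-1 * (H (k, false) (j, false) + H (k, true) (j, true)))
   +i* (4^-1 * (H (k, true) (j, false) - H (k, false) (j, true))).
Proof.
move=> hr Uz H.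
have E a : pderivC (real_dir a) (d_dzbar k (fun x => (r x)%:C)) z =
  (2^-1 * H (k, false) a) +i* (2^-1 * H (k, true) a) := pderivC_dzbar k a hr Uz.
rewrite /d_dz (E (j, false)) (E (j, true)) half_complex.
move: (H (k, false) (j, false)) (H (k, true) (j, false)) (H (k, false) (j, true))
  (H (k, true) (j, true)) => a1 a2 a3 a4.
by apply: complex_ext => /=; field.
Qed.

(** Taking real parts symmetrises the double sum, which then matches the mean of the
    Hessian over [X] and [i X] term by term. *)
Lemma Re_levi_form U r z X : C2_on U r -> U z ->
  complex.Re (levi_form r z X) =
  levi (fun a b => pderiv (real_dir b) (pderiv (real_dir a) r) z) X.
Proof.
move=> hr Uz.
pose H a b := pderiv (real_dir b) (pderiv (real_dir a) r) z; rewrite -/H.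
have -> : levi_form r z X = \sum_(j < n) \sum_(k < n)
   ((4^-1 * (H (k, false) (j, false) + H (k, true) (j, true)))
   +i* (4^-1 * (H (k, true) (j, false) - H (k, false) (j, true))))
   * X ord0 j * (X ord0 k)^*.
  by apply: eq_bigr => j _; apply: eq_bigr => k _; rewrite (d_dz_dzbar _ _ hr Uz).
rewrite /levi !qform_pairs Re_sum -big_split /= mulr_sumr.
under eq_bigr do rewrite Re_sum.
rewrite exchange_big /=; apply: eq_bigr => k _; rewrite -big_split /= mulr_sumr.
apply: eq_bigr => j _; rewrite !mxE !cReM !cImM /=.
move: (H (k, false) (j, false)) (H (k, true) (j, false)) (H (k, false) (j, true))
  (H (k, true) (j, true)) (X ord0 j) (X ord0 k) => a1 a2 a3 a4 [x1 x2] [y1 y2] /=.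
by field.
Qed.
End LeviAlgebra.

(** * Compactness and coercivity *)
Section Compactness.
Context {R : realType} {n : nat}.

Lemma compact_square (M : R) :
  compact [set c : R[i] | `|complex.Re c| <= M /\ `|complex.Im c| <= M].
Proof.
have cB : compact ((`[- M, M] : set R) `*` (`[- M, M] : set R)).
  by apply: compact_setX; exact: segment_compact.
have -> : [set c : R[i] | `|complex.Re c| <= M /\ `|complex.Im c| <= M] =
    (fun p : R * R => p.1 +i* p.2) @` ((`[- M, M] : set R) `*` (`[- M, M] : set R)).
  apply/seteqP; split=> [[x y] /= [hx hy]|_ [[x y] [hx hy] <-]] /=.
    by exists (x, y) => //; split; rewrite /= in_itv /= -ler_norml.
  by split; rewrite ler_norml; [move: hx | move: hy]; rewrite /= in_itv.
apply: continuous_compact cB; apply: continuous_subspaceT => -[x y].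
apply/(@cvgrPdist_lt _ _ _ (nbhs (x, y)) (nbhs_filter _)) => e e0.
have [d d0 ->] := posC_real e0; have d20 : 0 < d / 2 by rewrite divr_gt0.
exists (ball x (d / 2), ball y (d / 2)); first by split; apply: nbhsx_ballx.
move=> [s t] /= [xs yt]; rewrite normC_cmod ltcR.
apply: le_lt_trans (cmod_le_ReIm _) _ => /=.
move: xs yt; rewrite /ball /=; lra.
Qed.

Lemma bounded_closed_compactC (A : set 'rV[R[i]]_n) (M : R) : closed A ->
  (forall z, A z -> enorm z <= M) -> compact A.
Proof.
move=> cA hA.
have cB := @rV_compact R[i] n (fun=> [set c | `|complex.Re c| <= M /\ `|complex.Im c| <= M])
  (fun _ : 'I_n => @compact_square M).
apply: (subclosed_compact cA cB) => z Az /= k; have h := le_trans (cmod_le_enorm z k) (hA z Az).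
by split; apply: le_trans h; [exact: Re_le_cmod | exact: Im_le_cmod].
Qed.

Lemma closed_enormP (A : set 'rV[R[i]]_n) :
  (forall z, (forall d : R, 0 < d -> exists2 w, A w & enorm (w - z) < d) -> A z) -> closed A.
Proof.
move=> h z clz; apply: h => d d0.
have [|w [Aw wz]] := clz [set w | enorm (w - z) < d]; last by exists w.
by apply/nbhs_enormP; exists d.
Qed.

Lemma closure_enormP (A : set 'rV[R[i]]_n) z : closure A z <->
  (forall d : R, 0 < d -> exists2 w, A w & enorm (w - z) < d).
Proof.
split=> [clz d d0|h B /nbhs_enormP[d d0 hd]].
  have [|w [Aw wz]] := clz [set w | enorm (w - z) < d]; last by exists w.
  by apply/nbhs_enormP; exists d.
by have [w Aw wz] := h d d0; exists w; split=> //; exact: hd.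
Qed.

(** Compactness in the form needed for uniform constants: [P e x] holds near each
    point for all small [e], and a finite subcover lets one [e] serve all points. *)
Lemma compact_scale (T : topologicalType) (K : set T) (P : R -> T -> Prop) : compact K ->
  (forall x, K x -> exists2 e : R, 0 < e & exists2 V, nbhs x V &
     forall y e', V y -> 0 < e' -> e' <= e -> P e' y) ->
  exists2 e : R, 0 < e & forall x, K x -> P e x.
Proof.
move=> /compact_near_coveringP cK hP.
have : \forall e \near (0 : R)^'+, K `<=` P e.
  apply: cK => x Kx; have [e e0 [V Vx hV]] := hP x Kx.
  exists (V, [set e' | 0 < e' <= e]) => /=.
    split=> //; apply: filterS (filterI (nbhs_right_gt 0) (nbhs_right_le e0)).
    by move=> e' [e'0 e'e]; apply/andP.
  by move=> [y e'] /= [Vy /andP[e'0 e'e]]; apply: hV.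
move=> h; have [e [e0 he]] : exists e : R, 0 < e /\ K `<=` P e.
  have [e he] := @filter_ex _ _ (at_right_proper_filter (0 : R)) _ (filterI h (nbhs_right_gt (0 : R))).
  by exists e; case: he.
by exists e.
Qed.
End Compactness.

Section LocalPeak.
Context {R : realType} {n : nat}.
Implicit Types (X Y z : 'rV[R[i]]_n) (al : 'I_n * bool -> R)
  (H : 'I_n * bool -> 'I_n * bool -> R) (r : 'rV[R[i]]_n -> R).
Local Notation N := ((n * 2)%:R : R).

Lemma rcoordB a X Y : rcoord a X - rcoord a Y = rcoord a (X - Y).
Proof. by rewrite /rcoord !mxE cReD cImD cReN cImN; case: a.2. Qed.

Lemma qform_lipschitz H X Y (B M : R) : (forall a b, `|H a b| <= B) ->
  enorm X <= M -> enorm Y <= M -> `|qform H X - qform H Y| <= 2 * M * B * N ^+ 2 * enorm (X - Y).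
Proof.
move=> hB X2 Y2; rewrite /qform -sumrB.
apply: (@le_trans _ _ (\sum_(a : 'I_n * bool) \sum_(b : 'I_n * bool) 2 * M * B * enorm (X - Y))).
  apply: le_trans (ler_norm_sum _ _ _) _; apply: ler_sum => a _; rewrite -sumrB.
  apply: le_trans (ler_norm_sum _ _ _) _; apply: ler_sum => b _.
  have -> : H a b * rcoord a X * rcoord b X - H a b * rcoord a Y * rcoord b Y =
    H a b * (rcoord a (X - Y) * rcoord b X + rcoord a Y * rcoord b (X - Y)).
    by rewrite -!rcoordB; ring.
  have -> : 2 * M * B * enorm (X - Y) = B * (enorm (X - Y) * M + M * enorm (X - Y)) by ring.
  rewrite normrM; apply: ler_pM => //; apply: le_trans (ler_normD _ _) _.
  by apply: lerD; rewrite normrM; apply: ler_pM; rewrite // ?rcoord_le //;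
    apply: le_trans (rcoord_le _ _) _.
rewrite !sumr_const card_prod card_ord card_bool -mulrnA -[leLHS]mulr_natr natrM.
rewrite le_eqVlt; apply/orP; left; apply/eqP; ring.
Qed.

Lemma levi_lipschitz H X Y (B : R) : (forall a b, `|H a b| <= B) ->
  enorm X <= 2 -> enorm Y <= 2 -> `|levi H X - levi H Y| <= 4 * B * N ^+ 2 * enorm (X - Y).
Proof.
move=> hB X2 Y2; have h1 := qform_lipschitz hB X2 Y2.
have := @qform_lipschitz H ('i *: X) ('i *: Y) B 2 hB.
rewrite !enormZi -scalerBr enormZi => /(_ X2 Y2) h2.
rewrite /levi; have := le_trans (normr_ge0 _) h1; move: h1 h2; rewrite !ler_norml; lra.
Qed.

Lemma lin_lipschitz al X Y (B : R) : (forall a, `|al a| <= B) ->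
  cmod (lin al X) - cmod (lin al Y) <= B * N * enorm (X - Y).
Proof.
move=> hB; have := lin_bound (X - Y) hB; apply: le_trans.
have -> : lin al (X - Y) = lin al X - lin al Y.
  by rewrite /lin -sumrB; apply: eq_bigr => k _; rewrite !mxE mulrBr.
have := cmodD (lin al X - lin al Y) (lin al Y); rewrite subrK; lra.
Qed.

(** Positivity of the Levi form on the kernel of [lin al], made quantitative and stated for
    all vectors, so that it survives small changes of [al] and [H]. *)
Definition coercive (c : R) al H := forall X,
  c * enorm X ^+ 2 <= levi H X + c^-1 * cmod (lin al X) ^+ 2.

Lemma data_bounded al H : exists2 B : R, 0 < B &
  (forall a, `|al a| <= B) /\ (forall a b, `|H a b| <= B).
Proof.
exists (1 + \sum_a `|al a| + \sum_a \sum_b `|H a b|).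
  by rewrite ltr_pwDl ?ltr_pwDl // !sumr_ge0 // => a _; rewrite sumr_ge0.
have p1 : 0 <= \sum_a `|al a| by rewrite sumr_ge0.
have p2 : 0 <= \sum_a \sum_b `|H a b| by rewrite sumr_ge0 // => a _; rewrite sumr_ge0.
split=> [a|a b].
  have : `|al a| <= \sum_a `|al a| by rewrite (bigD1 a) //= lerDl sumr_ge0.
  lra.
have : `|H a b| <= \sum_a \sum_b `|H a b|.
  rewrite (bigD1 a) //= (bigD1 b) //= -addrA lerDl addr_ge0 ?sumr_ge0 // => i _.
  by rewrite sumr_ge0.
lra.
Qed.

(** By homogeneity [X] may be taken on the unit sphere.  Near a point where
    [lin al X] is not 0, the term with [c^-1] exceeds everything for small [c]; near
    the others the Levi form is bounded below. *)
Lemma levi_positive_coercive al H :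
  (forall X, X != 0 -> lin al X = 0 -> 0 < levi H X) ->
  exists2 c : R, 0 < c & coercive c al H.
Proof.
move=> hpos; have [B B0 [hal hH]] := data_bounded al H.
pose S := [set X : 'rV[R[i]]_n | enorm X = 1].
have cS : compact S.
  apply: (@bounded_closed_compactC _ _ _ 1); last by move=> z ->.
  apply: closed_enormP => z hz; apply/eqP; rewrite eq_le; apply/andP; split;
    apply/ler_addgt0Pr => e /hz [w w1 we]; rewrite /S /= in w1.
    have := enorm_dist_triangle z w 0; rewrite !subr0 w1 enormB; lra.
  have := enorm_dist_triangle w z 0; rewrite !subr0 w1; lra.
pose P (e : R) X := e <= levi H X + e^-1 * cmod (lin al X) ^+ 2.
have N0 : 0 <= N by rewrite ler0n.
have K10 : 0 < 4 * B * N ^+ 2 + 1 by rewrite ltr_wpDl // !mulr_ge0 ?sqr_ge0 // ltW.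
have K20 : 0 < B * N + 1 by rewrite ltr_wpDl // mulr_ge0 // ltW.
have [c c0 hc] : exists2 e : R, 0 < e & forall X, S X -> P e X.
  apply: compact_scale => // X X1; rewrite /S /= in X1.
  have [l0|l0] := eqVneq (lin al X) 0.
    have X0 : X != 0 by apply/eqP => X0; move: X1; rewrite X0 enorm0; lra.
    have lp := hpos X X0 l0.
    exists (levi H X / 2); first lra.
    pose d := Num.min 1 (levi H X / 2 / (4 * B * N ^+ 2 + 1)).
    have d0 : 0 < d by rewrite lt_min ltr01 !divr_gt0.
    exists [set Y | enorm (Y - X) < d]; first by apply/nbhs_enormP; exists d.
    move=> Y e' /=; rewrite lt_min ltr_pdivlMr // => /andP[Y1 Y2] e'0 e'e.
    have Y3 : enorm Y <= 2 by have := enormD (Y - X) X; rewrite subrK X1; lra.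
    have X2 : enorm X <= 2 by lra.
    have := levi_lipschitz hH Y3 X2; rewrite ler_norml => /andP[h _].
    have : 0 <= e'^-1 * cmod (lin al Y) ^+ 2 by rewrite mulr_ge0 ?sqr_ge0 // invr_ge0 ltW.
    rewrite /P; have := enorm_ge0 (Y - X); lra.
  have lp : 0 < cmod (lin al X) by rewrite cmod_gt0.
  pose b := cmod (lin al X) / 2; have b0 : 0 < b by rewrite divr_gt0.
  pose Q := B * N ^+ 2 * 4; have Q0 : 0 <= Q by rewrite !mulr_ge0 ?sqr_ge0 // ltW.
  have Q10 : 0 < Q + 1 by lra.
  exists (Num.min 1 (b ^+ 2 / (Q + 1))); first by rewrite lt_min ltr01 divr_gt0 // exprn_gt0.
  pose d := Num.min 1 (b / (B * N + 1)).
  have d0 : 0 < d by rewrite lt_min ltr01 divr_gt0.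
  exists [set Y | enorm (Y - X) < d]; first by apply/nbhs_enormP; exists d.
  move=> Y e' /=; rewrite lt_min ltr_pdivlMr // => /andP[Y1 Y2] e'0.
  rewrite le_min ler_pdivlMr // => /andP[e'1 e'2].
  have Y3 : enorm Y <= 2 by have := enormD (Y - X) X; rewrite subrK X1; lra.
  have lY : b <= cmod (lin al Y).
    have := lin_lipschitz X Y hal; rewrite enormB /b => h.
    have := enorm_ge0 (Y - X); rewrite /b in Y2; lra.
  have q1 : b ^+ 2 <= cmod (lin al Y) ^+ 2 by rewrite ler_pXn2r ?nnegrE ?cmod_ge0 ?(ltW b0).
  have q2 : Q + 1 <= e'^-1 * cmod (lin al Y) ^+ 2.
    rewrite mulrC ler_pdivlMr // mulrC; exact: le_trans e'2 q1.
  have : `|levi H Y| <= Q.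
    apply: le_trans (levi_bound Y hH) _; rewrite /Q ler_wpM2l ?mulr_ge0 ?sqr_ge0 ?(ltW B0) //.
    have -> : 4 = 2 ^+ 2 :> R by ring.
    by rewrite ler_pXn2r ?nnegrE ?enorm_ge0.
  rewrite ler_norml /P; lra.
exists c => // X; have [->|X0] := eqVneq X 0.
  rewrite enorm0 expr0n mulr0 -[0 : 'rV_n](scale0r (0 : 'rV_n)) -[(0 : R[i])]/(0%:C) leviZ linZ.
  by rewrite expr0n mul0r mul0r cmod0 expr0n mulr0 addr0.
have eX : 0 < enorm X.
  by rewrite lt_def enorm_ge0 andbT; apply/eqP => /enorm_eq0 /eqP; exact/negP.
pose t := enorm X; pose Y := (t^-1)%:C *: X.
have Y1 : S Y.
  by rewrite /S /= /Y enormZ cmodR gtr0_norm ?invr_gt0 // mulVf // gt_eqF.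
have XE : X = t%:C *: Y.
  by rewrite /Y scalerA -rmorphM /= mulfV ?gt_eqF // scale1r.
have := hc Y Y1; rewrite /P => h.
rewrite {2 3}XE leviZ linZ cmodM cmodR gtr0_norm // exprMn -/t.
have -> : t ^+ 2 * levi H Y + c^-1 * (t ^+ 2 * cmod (lin al Y) ^+ 2) =
  (levi H Y + c^-1 * cmod (lin al Y) ^+ 2) * t ^+ 2 by ring.
by rewrite ler_wpM2r ?sqr_ge0.
Qed.

Lemma coercive_perturb (c : R) al H : 0 < c -> coercive c al H ->
  exists2 k : R, 0 < k & forall al' H', (forall a, `|al' a - al a| <= k) ->
    (forall a b, `|H' a b - H a b| <= k) -> coercive (c / 2) al' H'.
Proof.
move=> c0 hc; have N0 : 0 <= N by rewrite ler0n.
pose L1 := N ^+ 2 + 1; pose L2 := 2 * c^-1 * N ^+ 2 + 1.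
have L10 : 0 < L1 by rewrite ltr_wpDl ?sqr_ge0.
have L20 : 0 < L2 by rewrite ltr_wpDl // !mulr_ge0 ?sqr_ge0 // invr_ge0 ltW.
pose k := Num.min 1 (Num.min (c / 4 / L1) (c / 4 / L2)).
have k0 : 0 < k by rewrite !lt_min ltr01 !divr_gt0.
have k1 : k <= 1 by rewrite ge_min lexx.
have kL1 : k * L1 <= c / 4.
  by rewrite -ler_pdivlMr //; do 2 rewrite ge_min ?lexx ?orbT.
have kL2 : k * L2 <= c / 4.
  by rewrite -ler_pdivlMr //; do 2 rewrite ge_min ?lexx ?orbT.
exists k => // al' H' hal hH X; have := hc X.
set E := enorm X; have E0 : 0 <= E ^+ 2 by rewrite sqr_ge0.
have : `|levi H' X - levi H X| <= k * N ^+ 2 * E ^+ 2 by rewrite leviB; exact: levi_bound.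
have d1 : cmod (lin al' X - lin al X) <= k * N * E by rewrite linB; exact: lin_bound.
have d2 : cmod (lin al X) ^+ 2 <= 2 * cmod (lin al' X) ^+ 2 + 2 * (k * N * E) ^+ 2.
  have d3 : cmod (lin al X) <= cmod (lin al' X) + k * N * E.
    have := cmodD (lin al X - lin al' X) (lin al' X); rewrite subrK cmodB; lra.
  apply: (@le_trans _ _ ((cmod (lin al' X) + k * N * E) ^+ 2)).
    by rewrite ler_pXn2r ?nnegrE ?cmod_ge0 // (le_trans _ d3) ?cmod_ge0.
  have := sqr_ge0 (cmod (lin al' X) - k * N * E); lra.
have d4 : c^-1 * cmod (lin al X) ^+ 2 <= c^-1 * (2 * cmod (lin al' X) ^+ 2 + 2 * (k * N * E) ^+ 2).
  by rewrite ler_wpM2l // invr_ge0 ltW.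
have d5 : c^-1 * (2 * (k * N * E) ^+ 2) <= c / 4 * E ^+ 2.
  apply: le_trans (_ : k * (2 * c^-1 * N ^+ 2) * E ^+ 2 <= _).
    have -> : c^-1 * (2 * (k * N * E) ^+ 2) = k * (k * (2 * c^-1 * N ^+ 2) * E ^+ 2) by ring.
    have c1 : 0 <= c^-1 by rewrite invr_ge0 ltW.
    have k' : 0 <= k by exact: ltW.
    by rewrite ler_piMl // mulr_ge0 // mulr_ge0 // mulr_ge0 ?sqr_ge0 // mulr_ge0.
  rewrite ler_wpM2r //; apply: le_trans kL2; rewrite ler_pM2l // lerDl //.
have d6 : k * N ^+ 2 * E ^+ 2 <= c / 4 * E ^+ 2.
  rewrite ler_wpM2r //; apply: le_trans kL1; rewrite ler_pM2l // lerDl //.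
have -> : (c / 2)^-1 = 2 * c^-1 by field; rewrite gt_eqF.
rewrite ler_norml; lra.
Qed.
End LocalPeak.

(** * The peak polynomial *)
Section PeakPolynomial.
Context {R : realType} {n : nat}.
Implicit Types (X Y z p q : 'rV[R[i]]_n) (al : 'I_n * bool -> R) (U : set 'rV[R[i]]_n)
  (H : 'I_n * bool -> 'I_n * bool -> R) (r : 'rV[R[i]]_n -> R).
Local Notation N := ((n * 2)%:R : R).

Definition grad r z (a : 'I_n * bool) := pderiv (real_dir a) r z.
Definition hess r z (a b : 'I_n * bool) := pderiv (real_dir b) (pderiv (real_dir a) r) z.

(** The Levi polynomial of [- r] at the origin: [- r] is approximated to second order
    by its real part minus the Levi form. *)
Definition levi_poly al H X : R[i] := - (lin al X + 2^-1 * holq H X).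

Lemma disc_holomorphic_shift (g : 'rV[R[i]]_n -> R[i]) z :
  disc_holomorphic g -> disc_holomorphic (fun p => g (p - z)).
Proof.
move=> hg f a fd; apply: (hg (fun w => f w - z)) => k.
apply: (@cdiff_ext _ (fun w => f w ord0 k - z ord0 k) _ _ 1) => //.
  by move=> w _; rewrite !mxE.
exact: cdiffB (cdiff_cst _ _).
Qed.

Lemma disc_holomorphic_levi_poly al H : disc_holomorphic (levi_poly al H).
Proof.
move=> f a fd; apply: cdiffN; apply: cdiffD.
  by apply: cdiff_sum => k; apply: cdiffZ.
apply: cdiffZ; apply: cdiff_sum => j; apply: cdiff_sum => k.
by apply: cdiffZ; apply: cdiffM.
Qed.

Lemma Re_levi_poly al H X : complex.Re (levi_poly al H X) =
  - (\sum_a rcoord a X * al a + 2^-1 * (qform H X - 2 * levi H X)).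
Proof.
by rewrite cReN cReD Re_lin half_complex cReM /= mul0r subr0 qform_split; ring.
Qed.

(** With [P = x + i y], the hypothesis bounds [Re P] below only up to [- K |P|^2].
    Subtracting [4 K P^2] from [P] adds [4 K y^2], which covers the defect in
    [y]; the terms in [x^2] are small multiples of [|x|]. *)
Lemma real_peak_ineq (x y K s : R) : 0 < K -> K * `|x| <= 16^-1 -> 0 <= s ->
  s <= x + K * (x ^+ 2 + y ^+ 2) -> s / 2 <= x - 4 * K * (x ^+ 2 - y ^+ 2).
Proof.
move=> K0 Kx s0 h.
have w1 : K * x ^+ 2 <= `|x| / 16.
  rewrite -[x ^+ 2]real_normK ?num_real // expr2 mulrA mulrC.
  by rewrite ler_wpM2l.
have v0 : 0 <= K * y ^+ 2 by rewrite mulr_ge0 ?sqr_ge0 // ltW.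
have w0 : 0 <= K * x ^+ 2 by rewrite mulr_ge0 ?sqr_ge0 // ltW.
have [x0|x0] := leP 0 x.
  rewrite ger0_norm // in w1; lra.
rewrite ltr0_norm // in w1; lra.
Qed.

(** On [r < 0], Taylor's formula gives [Re P >= Levi (X) - c / 4 |X|^2], and coercivity
    bounds the Levi form below by [c |X|^2 - c^-1 |lin X|^2].  As [lin X] is [- P] up to
    second order, [c / 2 |X|^2 <= Re P + K |P|^2], and [real_peak_ineq] makes
    [P - 4 K P^2] a peak function. *)
Lemma peak_of_data (B c : R) : 0 < B -> 0 < c -> exists rho0 kap eta : R,
  [/\ 0 < rho0, 0 < kap, 0 < eta & forall U r z rho, open U -> C2_on U r ->
    0 < rho -> rho <= rho0 ->
    (forall q, enorm (q - z) < rho -> U q /\ forall a b, `|hess r q a b - hess r z a b| <= kap) ->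
    r z = 0 -> (forall a, `|grad r z a| <= B) -> (forall a b, `|hess r z a b| <= B) ->
    coercive c (grad r z) (hess r z) ->
    exists g, disc_holomorphic g /\ forall p, enorm (p - z) < rho -> r p < 0 ->
      eta * enorm (p - z) ^+ 2 <= complex.Re (g p) <= eta^-1 * enorm (p - z)].
Proof.
move=> B0 c0; have N0 : 0 <= N by rewrite ler0n.
pose kap := c / 4 / (N ^+ 2 + 1).
have NN : 0 < N ^+ 2 + 1 by rewrite ltr_wpDl ?sqr_ge0.
have kap0 : 0 < kap by rewrite !divr_gt0.
pose C1 := B * N + B * N ^+ 2 + 1.
have C10 : 0 < C1 by rewrite ltr_wpDl // addr_ge0 // mulr_ge0 ?sqr_ge0 // ltW.
pose K := 2 * c^-1; have K0 : 0 < K by rewrite mulr_gt0 ?invr_gt0.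
pose D := 2^-1 * c^-1 * (B * N ^+ 2) ^+ 2 + 1.
have D0 : 0 < D.
  by rewrite ltr_wpDl // mulr_ge0 ?sqr_ge0 // mulr_ge0 ?invr_ge0 // ltW.
pose rho0 := Num.min 1 (Num.min (16 * K * C1)^-1 (c / 4 / D)).
have KC0 : 0 < 16 * K * C1 by rewrite mulr_gt0 // mulr_gt0.
have rho00 : 0 < rho0 by rewrite !lt_min ltr01 invr_gt0 KC0 !divr_gt0.
have rho01 : rho0 <= 1 by rewrite ge_min lexx.
have rho02 : rho0 * (16 * K * C1) <= 1.
  by rewrite -ler_pdivlMr // div1r; do 2 rewrite ge_min ?lexx ?orbT.
have rho03 : rho0 * D <= c / 4.
  by rewrite -ler_pdivlMr //; do 2 rewrite ge_min ?lexx ?orbT.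
pose eta := Num.min (c / 4) (2 * C1)^-1.
have eta0 : 0 < eta by rewrite lt_min divr_gt0 // invr_gt0 mulr_gt0.
exists rho0, kap, eta; split=> // U r z rho oU hr rho_gt0 rho_le hq rz hal hH hc.
pose P X := levi_poly (grad r z) (hess r z) X.
pose g X := P X + (- (4 * K))%:C * (P X * P X).
exists (fun p => g (p - z)); split.
  apply: disc_holomorphic_shift => f a fd.
  have hP : cdiff (fun w => P (f w)) a by exact: disc_holomorphic_levi_poly.
  by apply: cdiffD => //; apply: cdiffZ; apply: cdiffM.
move=> p pz rp; set X := p - z in pz *.
have pE : p = z + X by rewrite /X addrC subrK.
set e := enorm X in pz *.
have e0 : 0 <= e by exact: enorm_ge0.
have e_rho0 : e <= rho0 by apply: le_trans rho_le; exact: ltW.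
have e1 : e <= 1 by lra.
have ee : e ^+ 2 <= e by rewrite expr2 ler_piMl.
have ee0 : 0 <= e ^+ 2 by rewrite sqr_ge0.
have T := @taylor2 R n U r z X (hess r z) kap rho oU hr (ltW kap0) hq pz.
rewrite -pE rz subr0 -/e in T.
have T' : - (kap * N ^+ 2 * e ^+ 2) <= r p - (\sum_a rcoord a X * grad r z a)
     - 2^-1 * qform (hess r z) X by move: T; rewrite ler_norml => /andP[].
have kN : kap * N ^+ 2 * e ^+ 2 <= c / 4 * e ^+ 2.
  rewrite ler_wpM2r // /kap mulrAC ler_pdivrMr // ler_pM2l ?divr_gt0 //; lra.
have hl := lin_bound X hal; have hh := holq_bound X hH; rewrite -/e in hl hh.
have hcX := hc X; rewrite -/e in hcX.
set L := lin (grad r z) X in hl hcX; set q := holq (hess r z) X in hh.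
have PE : P X = - (L + 2^-1 * q) by [].
have ReP := Re_levi_poly (grad r z) (hess r z) X; rewrite -/(P X) in ReP.
have c2 : cmod (2^-1 : R[i]) = 2^-1 by rewrite half_complex cmodR gtr0_norm.
have Pb : cmod (P X) <= C1 * e.
  rewrite PE cmodN; apply: le_trans (cmodD _ _) _; rewrite cmodM c2.
  have : B * N ^+ 2 * e ^+ 2 <= B * N ^+ 2 * e.
    by rewrite ler_wpM2l // mulr_ge0 ?sqr_ge0 // ltW.
  have := cmod_ge0 q; rewrite /C1; lra.
have L2 : cmod L ^+ 2 <= 2 * cmod (P X) ^+ 2 + 2^-1 * (B * N ^+ 2 * e ^+ 2) ^+ 2.
  have t1 : cmod L <= cmod (P X) + 2^-1 * (B * N ^+ 2 * e ^+ 2).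
    have -> : L = - P X + - (2^-1 * q) by rewrite PE; ring.
    apply: le_trans (cmodD _ _) _; rewrite !cmodN cmodM c2; lra.
  apply: (@le_trans _ _ ((cmod (P X) + 2^-1 * (B * N ^+ 2 * e ^+ 2)) ^+ 2)).
    by rewrite ler_pXn2r ?nnegrE ?cmod_ge0 // (le_trans _ t1) ?cmod_ge0.
  have := sqr_ge0 (cmod (P X) - 2^-1 * (B * N ^+ 2 * e ^+ 2)); lra.
have cL : c^-1 * cmod L ^+ 2 <= K * cmod (P X) ^+ 2 + c / 4 * e ^+ 2.
  apply: (@le_trans _ _ (c^-1 * (2 * cmod (P X) ^+ 2 + 2^-1 * (B * N ^+ 2 * e ^+ 2) ^+ 2))).
    by rewrite ler_wpM2l // invr_ge0 ltW.
  have t2 : 2^-1 * c^-1 * (B * N ^+ 2) ^+ 2 * e ^+ 2 <= c / 4.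
    apply: le_trans rho03; apply: (@le_trans _ _ (D * e ^+ 2)).
      by rewrite ler_wpM2r // /D lerDl.
    by rewrite mulrC ler_wpM2r ?(ltW D0) //; lra.
  have : 2^-1 * c^-1 * (B * N ^+ 2) ^+ 2 * e ^+ 2 * e ^+ 2 <= c / 4 * e ^+ 2.
    by rewrite ler_wpM2r.
  rewrite /K; lra.
have KP : K * cmod (P X) <= 16^-1.
  apply: (@le_trans _ _ (K * (C1 * rho0))).
    by rewrite ler_pM2l //; apply: le_trans Pb _; rewrite ler_pM2l.
  lra.
have main := @real_peak_ineq (complex.Re (P X)) (complex.Im (P X)) K (c / 2 * e ^+ 2) K0.
have KRe : K * `|complex.Re (P X)| <= 16^-1.
  by apply: le_trans KP; rewrite ler_pM2l // Re_le_cmod.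
have ce0 : 0 <= c / 2 * e ^+ 2 by rewrite mulr_ge0 // divr_ge0 // ltW.
have gE : complex.Re (g X) = complex.Re (P X)
    - 4 * K * (complex.Re (P X) ^+ 2 - complex.Im (P X) ^+ 2).
  by rewrite /g cReD !cReM /= mul0r subr0; ring.
have {}main := main KRe ce0; rewrite -gE -cmod_sqr in main.
apply/andP; split.
  have eta1 : eta * e ^+ 2 <= c / 4 * e ^+ 2 by rewrite ler_wpM2r // ge_min lexx.
  have : c / 2 * e ^+ 2 / 2 <= complex.Re (g X) by apply: main; rewrite ReP; lra.
  lra.
have Kp2 : K * complex.Im (P X) ^+ 2 <= 16^-1 * cmod (P X).
  apply: (@le_trans _ _ (K * cmod (P X) * cmod (P X))).
    by rewrite -mulrA -expr2 ler_pM2l // cmod_sqr lerDr sqr_ge0.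
  by rewrite ler_wpM2r ?cmod_ge0.
have Kp1 : 0 <= K * complex.Re (P X) ^+ 2 by rewrite mulr_ge0 ?sqr_ge0 // ltW.
have up : 2 * C1 * e <= eta^-1 * e.
  rewrite ler_wpM2r // -[2 * C1]invrK lef_pV2 ?posrE ?invr_gt0 ?mulr_gt0 //.
  by rewrite ge_min lexx orbT.
have := le_trans (ler_norm _) (Re_le_cmod (P X)); rewrite gE.
have := cmod_ge0 (P X); lra.
Qed.
End PeakPolynomial.

(** * Peak functions under perturbation *)
Section UniformPeaks.
Context {R : realType} {n : nat}.
Implicit Types (X Y z p q : 'rV[R[i]]_n) (U K : set 'rV[R[i]]_n)
  (r : 'rV[R[i]]_n -> R).

(** Closeness of the values themselves is included: it forces zeros of [r] on a compact
    set to lie near zeros of [r0]. *)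
Definition C2_close U (e : R) r r0 := forall q, U q ->
  [/\ `|r q - r0 q| <= e, forall a, `|grad r q a - grad r0 q a| <= e &
      forall a b, `|hess r q a b - hess r0 q a b| <= e].

Definition levi_positive r z := forall X, X != 0 -> lin (grad r z) X = 0 -> 0 < levi (hess r z) X.

(** A peak function for [r < 0] near [z], without mention of a domain, so that all [r]
    close to a given function can be treated together. *)
Definition peak_at U (e : R) r z := exists g, disc_holomorphic g /\
  forall p, enorm (p - z) < e -> U p /\ (r p < 0 ->
    e * enorm (p - z) ^+ 2 <= complex.Re (g p) <= e^-1 * enorm (p - z)).

Lemma common_radius (I : finType) (u : I -> 'rV[R[i]]_n -> R) z (e : R) : 0 < e ->
  (forall i, {for z, continuous (u i)}) ->
  exists2 d : R, 0 < d & forall w, enorm (w - z) < d -> forall i, `|u i w - u i z| <= e.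
Proof.
move=> e0 hc.
have [d hd] := choice (fun i => let: ex_intro2 d d0 h := (continuous_enormP _ _).1 (hc i) _ e0 in
  ex_intro (fun d => 0 < d /\ forall w, enorm (w - z) < d -> `|u i w - u i z| <= e) d (conj d0 h)).
exists (\big[Num.min/1]_i d i).
  by elim/big_ind: _ => // [x y x0 y0|i _]; [rewrite lt_min x0 | case: (hd i)].
move=> w wz i; have [_] := hd i; apply; apply: lt_le_trans wz _; exact: bigmin_le_cond.
Qed.

Lemma abs_dist_triangle (x y w a b c : R) : `|x - y| <= a -> `|y - w| <= b -> a + b <= c ->
  `|x - w| <= c.
Proof. rewrite !ler_norml; lra. Qed.

(** Coercivity of the data of [r0] at [z0] persists, with a smaller constant, for the data
    of [r] at [z] when [r] is C^2-close to [r0] and [z] is near [z0]; then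
    [peak_of_data] applies with the same constants. *)
Lemma local_peaks U r0 z0 : open U -> C2_on U r0 -> U z0 -> levi_positive r0 z0 ->
  exists2 e : R, 0 < e & exists2 V, nbhs z0 V & forall z e', V z -> 0 < e' -> e' <= e ->
    forall r, C2_on U r -> C2_close U e' r r0 -> r z = 0 -> peak_at U e' r z.
Proof.
move=> oU hr0 Uz0 lp.
have [c c0 hc] := levi_positive_coercive lp.
have [k k0 hk] := coercive_perturb c0 hc.
have [B B0 [hBa hBH]] := data_bounded (grad r0 z0) (hess r0 z0).
have B10 : 0 < B + 1 by lra.
have c20 : 0 < c / 2 by lra.
have [rho0 [kap [eta [rho00 kap0 eta0 hpk]]]] := peak_of_data (n := n) B10 c20.
have [m [m0 mk m1 mkap]] : exists m : R, [/\ 0 < m, m <= k / 2, m <= 2^-1 & m <= kap / 4].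
  exists (Num.min (Num.min (k / 2) 2^-1) (kap / 4)).
  by rewrite !lt_min invr_gt0 ltr0n !divr_gt0 // !ge_min !lexx ?orbT.
have [_ cg ch] := hr0 z0 Uz0.
have [d1 d10 hd1] := @common_radius _ (fun a => pderiv (real_dir a) r0) z0 m m0 (fun a => (cg a).2).
have [d2 d20 hd2] := @common_radius ((('I_n * bool) * ('I_n * bool))%type)
  (fun ab => pderiv (real_dir ab.2) (pderiv (real_dir ab.1) r0)) z0 m m0 (fun ab => (ch ab.1 ab.2).2).
have [d3 d30 hd3] := open_enormP oU Uz0.
pose d := Num.min (Num.min d1 d2) d3.
have d0 : 0 < d by rewrite !lt_min d10 d20.
have near_z0 q : enorm (q - z0) < d ->
    [/\ U q, forall a, `|grad r0 q a - grad r0 z0 a| <= m &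
      forall a b, `|hess r0 q a b - hess r0 z0 a b| <= m].
  rewrite !lt_min => /andP[/andP[/hd1 h1 /hd2 h2] /hd3 h3]; split=> // a b.
  exact: (h2 (a, b)).
exists (Num.min (Num.min m rho0) (Num.min eta (d / 2))).
  by rewrite !lt_min m0 rho00 eta0 divr_gt0.
exists [set z | enorm (z - z0) < d / 2].
  by apply/nbhs_enormP; exists (d / 2) => //; rewrite divr_gt0.
move=> z e /= zz0 e0; rewrite !le_min => /andP[/andP[em erho] /andP[eeta ed]] r hr hcl rz.
have zd : enorm (z - z0) < d by lra.
have near_z q : enorm (q - z) < e ->
    [/\ U q, forall a, `|grad r q a - grad r0 z0 a| <= 2 * m &
      forall a b, `|hess r q a b - hess r0 z0 a b| <= 2 * m].
  move=> qz; have qd : enorm (q - z0) < d.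
    by have := enorm_dist_triangle q z z0; lra.
  have [Uq h1 h2] := near_z0 q qd; have [_ h3 h4] := hcl q Uq.
  split; [exact: Uq|move=> a|move=> a b].
    apply: abs_dist_triangle (h3 a) (h1 a) _; lra.
  apply: abs_dist_triangle (h4 a b) (h2 a b) _; lra.
have zz : enorm (z - z) < e by rewrite subrr enorm0.
have [Uz g1 h1] := near_z z zz.
have [g [gh gp]] : exists g, disc_holomorphic g /\ forall p, enorm (p - z) < e -> r p < 0 ->
      eta * enorm (p - z) ^+ 2 <= complex.Re (g p) <= eta^-1 * enorm (p - z).
  apply: (hpk U r z e oU hr e0 erho _ rz).
  - move=> q qz; have [Uq _ h2] := near_z q qz; split; first exact: Uq.
    move=> a b; have h3 := h1 a b; rewrite distrC in h3.
    apply: abs_dist_triangle (h2 a b) h3 _; lra.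
  - move=> a; rewrite -[grad r z a]subr0.
    have h3 := hBa a; rewrite -[grad r0 z0 a]subr0 in h3.
    apply: abs_dist_triangle (g1 a) h3 _; lra.
  - move=> a b; rewrite -[hess r z a b]subr0.
    have h3 := hBH a b; rewrite -[hess r0 z0 a b]subr0 in h3.
    apply: abs_dist_triangle (h1 a b) h3 _; lra.
  - apply: hk => [a|a b].
      apply: le_trans (g1 a) _; lra.
    apply: le_trans (h1 a b) _; lra.
exists g; split=> // p pz; have [Up _ _] := near_z p pz; split=> // rp.
have /andP[l1 l2] := gp p pz rp; apply/andP; split.
  by apply: le_trans l1; rewrite ler_wpM2r ?sqr_ge0.
apply: le_trans l2 _; rewrite ler_wpM2r ?enorm_ge0 //.
by rewrite lef_pV2 ?posrE.
Qed.

(** [compact_scale] over [K], with [local_peaks] near the zeros of [r0]; near the other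
    points no function close to [r0] vanishes. *)
Lemma uniform_peaks U K r0 : open U -> compact K -> K `<=` U -> C2_on U r0 ->
  (forall z, K z -> r0 z = 0 -> levi_positive r0 z) ->
  exists2 e : R, 0 < e & forall r, C2_on U r -> C2_close U e r r0 ->
    forall z, K z -> r z = 0 -> peak_at U e r z.
Proof.
move=> oU cK KU hr0 lp.
have [e e0 he] : exists2 e : R, 0 < e & forall z, K z ->
    (forall r, C2_on U r -> C2_close U e r r0 -> r z = 0 -> peak_at U e r z).
  have := compact_scale (P := fun e z => forall r, C2_on U r -> C2_close U e r r0 ->
    r z = 0 -> peak_at U e r z) cK; apply=> z Kz.
  have [rz|rz] := eqVneq (r0 z) 0; first exact: local_peaks oU hr0 (KU _ Kz) (lp _ Kz rz).
  pose m := `|r0 z| / 4; have m0 : 0 < m by rewrite divr_gt0 // normr_gt0.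
  have [cz _ _] := hr0 z (KU _ Kz).
  have [d d0 hd] := (continuous_enormP _ _).1 cz m m0.
  have [d' d'0 hd'] := open_enormP oU (KU _ Kz).
  exists m => //; exists [set w | enorm (w - z) < Num.min d d'].
    by apply/nbhs_enormP; exists (Num.min d d'); rewrite // lt_min d0.
  move=> w e /=; rewrite lt_min => /andP[/hd h1 /hd' Uw] e0 em r hr hcl rw.
  have [h2 _ _] := hcl w Uw; rewrite rw sub0r normrN in h2.
  exfalso; have := ler_normB (r0 w) (r0 w - r0 z).
  rewrite opprB addrC subrK; have : `|r0 z| = 4 * m by rewrite /m; field.
  lra.
by exists e => // r hr hcl z Kz; exact: he.
Qed.

Lemma is_derive_pderiv v r z : pderivable v r z ->
  is_derive (0 : R) (1 : R) (fun t => r (z + t%:C *: v)) (pderiv v r z).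
Proof. by move=> h; rewrite /pderiv derive1E; exact: derivableP. Qed.

Lemma pderivB v r1 r2 z : pderivable v r1 z -> pderivable v r2 z ->
  pderivable v (fun x => r1 x - r2 x) z /\
  pderiv v (fun x => r1 x - r2 x) z = pderiv v r1 z - pderiv v r2 z.
Proof.
move=> h1 h2; apply: bound_pderiv.
exact: (is_deriveB (is_derive_pderiv h1) (is_derive_pderiv h2)).
Qed.

Lemma pderiv_near_eq v r1 r2 z : pderivable v r2 z ->
  (exists2 d : R, 0 < d & forall q, enorm (q - z) < d -> r1 q = r2 q) ->
  pderiv v r1 z = pderiv v r2 z.
Proof.
move=> h [d d0 hd]; suff [] : pderivable v r1 z /\ pderiv v r1 z = pderiv v r2 z by [].
apply: bound_pderiv; apply: bound_is_derive => e e0.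
have [d' d'0 hd'] := is_derive_bound (is_derive_pderiv h) e0.
have v0 : 0 < enorm v + 1 by rewrite ltr_wpDl ?enorm_ge0.
exists (Num.min d' (d / (enorm v + 1))); first by rewrite lt_min d'0 divr_gt0.
move=> t; rewrite subr0 lt_min ltr_pdivlMr // => /andP[td' td].
have tv : enorm (z + t%:C *: v - z) < d.
  rewrite addrC addKr enormZ cmodR; apply: le_lt_trans td.
  by rewrite ler_wpM2l // lerDl.
rewrite (hd _ tv) scale0r addr0 hd; last by rewrite subrr enorm0.
by have := hd' t; rewrite subr0 scale0r addr0; exact.
Qed.

Lemma C2_norm_close U r r0 (e : R) : open U -> C2_on U r -> C2_on U r0 ->
  (C2_norm U (fun z => r z - r0 z)%R < e%:E)%E -> C2_close U e r r0.
Proof.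
move=> oU hr hr0 he q Uq.
have ub s : (exists2 z, U z &
    [\/ s = `|r z - r0 z|%:E,
       (exists a, s = `|pderiv (real_dir a) (fun x => r x - r0 x) z|%:E) |
       exists a b, s = `|pderiv (real_dir b) (pderiv (real_dir a) (fun x => r x - r0 x)) z|%:E]) ->
    (s <= e%:E)%E.
  by move=> hs; apply: le_trans (ltW he); apply: ereal_sup_ubound.
have D1 p : U p -> forall a, pderiv (real_dir a) (fun x => r x - r0 x) p
    = pderiv (real_dir a) r p - pderiv (real_dir a) r0 p.
  move=> Up a; have [_ /(_ a)[h1 _] _] := hr p Up; have [_ /(_ a)[h2 _] _] := hr0 p Up.
  by case: (pderivB h1 h2).
split=> [|a|a b].
- by rewrite -lee_fin; apply: ub; exists q => //; apply: Or31.
- rewrite -lee_fin /grad -D1 //; apply: ub; exists q => //; apply: Or32; by exists a.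
have [_ _ /(_ a b)[h1 _]] := hr q Uq; have [_ _ /(_ a b)[h2 _]] := hr0 q Uq.
have [h3 h4] := pderivB h1 h2.
rewrite -lee_fin /hess -h4; apply: ub; exists q => //; apply: Or33; exists a, b.
congr (`| _ |%:E); apply/esym; apply: pderiv_near_eq => //.
have [d d0 hd] := open_enormP oU Uq; exists d => // p /hd Up; exact: D1.
Qed.

Lemma defining_zero G U r z : open G -> C2_defining_function G U r -> boundary G z ->
  r z = 0 /\ U z.
Proof.
move=> oG [[oU bU] [_ h1 h2 _]] bz; have Uz := bU z bz; split=> //.
case: (bz) => clz nint.
have [rz|rz|//] := ltgtP (r z) 0.
  have : (G `&` U) z by rewrite h1.
  by move=> [Gz _]; case: nint; exact: open_nbhs_nbhs.
have : (~` closure G `&` U) z by rewrite h2.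
by case.
Qed.

Lemma defining_neg G U r z : C2_defining_function G U r -> G z -> U z -> r z < 0.
Proof. by move=> [_ [_ h1 _ _]] Gz Uz; have : (G `&` U) z by []; rewrite h1 => -[]. Qed.

Lemma peak_at_peak G U r z (e : R) : C2_defining_function G U r -> peak_at U e r z -> peak e G z.
Proof.
move=> hG [g [gh gp]]; exists g; split=> // p Gp pz.
by have [Up h] := gp p pz; apply: h; exact: defining_neg hG Gp Up.
Qed.
End UniformPeaks.

(** * Two defining functions of one domain *)
Section TwoDefiningFunctions.
Context {R : realType} {n : nat}.
Implicit Types (X Y z p q nu : 'rV[R[i]]_n) (G U : set 'rV[R[i]]_n) (r : 'rV[R[i]]_n -> R).
Local Notation N := ((n * 2)%:R : R).

Definition ddir r z X := \sum_a rcoord a X * grad r z a.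

Lemma rcoordD a X Y : rcoord a (X + Y) = rcoord a X + rcoord a Y.
Proof. by rewrite /rcoord !mxE cReD cImD; case: a.2. Qed.

Lemma ddirD r z X Y : ddir r z (X + Y) = ddir r z X + ddir r z Y.
Proof.
by rewrite /ddir -big_split /=; apply: eq_bigr => a _; rewrite rcoordD mulrDl.
Qed.

Lemma ddirZ r z (t : R) X : ddir r z (t%:C *: X) = t * ddir r z X.
Proof. by rewrite /ddir mulr_sumr; apply: eq_bigr => a _; rewrite rcoordZ mulrA. Qed.

Lemma lin_eq0 r z X : lin (grad r z) X = 0 <-> ddir r z X = 0 /\ ddir r z ('i *: X) = 0.
Proof.
have e1 : complex.Re (lin (grad r z) X) = ddir r z X by exact: Re_lin.
have e2 : complex.Im (lin (grad r z) X) = - ddir r z ('i *: X).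
  have <- : complex.Re (lin (grad r z) ('i *: X)) = ddir r z ('i *: X) by exact: Re_lin.
  have -> : lin (grad r z) ('i *: X) = 'i * lin (grad r z) X.
    by rewrite /lin mulr_sumr; apply: eq_bigr => k _; rewrite mxE mulrCA.
  by rewrite cReM /= mul0r mul1r sub0r opprK.
split=> [h|[h1 h2]]; first by rewrite -e1 h; split=> //; move: e2; rewrite h /= => /esym/eqP; rewrite oppr_eq0 => /eqP.
by apply: complex_ext; rewrite /= ?e1 ?e2 ?h1 ?h2 ?oppr0.
Qed.

Lemma gradient_normal r z : gradient r z != 0 -> exists nu, 0 < ddir r z nu.
Proof.
move=> g0; pose nu : 'rV[R[i]]_n := \row_k (grad r z (k, false) +i* grad r z (k, true)).
exists nu; have dE : ddir r z nu = \sum_a grad r z a ^+ 2.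
  by apply: eq_bigr => -[k b] _; rewrite /rcoord mxE; case: b; rewrite /= expr2.
rewrite dE lt_def sumr_ge0 ?andbT => [|a _]; last exact: sqr_ge0.
apply: contra g0 => /eqP s0; apply/eqP/rowP => k; rewrite !mxE d_dzbar_real.
have h a : grad r z a = 0.
  apply/eqP; rewrite -sqrf_eq0; move/eqP: s0; rewrite psumr_eq0 => [/allP/(_ a)|b _]; last exact: sqr_ge0.
  by rewrite mem_index_enum => /(_ isT).
by rewrite -/(grad r z (k, false)) -/(grad r z (k, true)) !h !mulr0.
Qed.

Lemma first_order_sign U r z X : open U -> C2_on U r -> U z -> r z = 0 -> ddir r z X != 0 ->
  exists2 d : R, 0 < d & forall t : R, 0 < t -> t < d ->
    0 < r (z + t%:C *: X) * ddir r z X.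
Proof.
move=> oU hr Uz rz D0; set D := ddir r z X in D0 *.
have hD := C2_chain oU hr Uz X; rewrite -/(ddir r z X) -/D in hD.
have D20 : 0 < `|D| / 2 by rewrite divr_gt0 // normr_gt0.
have [d d0 hd] := is_derive_bound hD D20; exists d => // t t0 td.
have := hd t; rewrite subr0 gtr0_norm // scale0r addr0 rz subr0 => /(_ td).
move: (r _) => x hx.
have : `|x * D - D * t * D| <= `|D| / 2 * t * `|D|.
  by rewrite -mulrBl normrM ler_wpM2r.
have DD : `|D| * `|D| = D * D by rewrite -normrM ger0_norm // -expr2 sqr_ge0.
have : 0 < D * D * t by rewrite mulr_gt0 // -expr2 exprn_even_gt0.
have -> : `|D| / 2 * t * `|D| = D * D * t / 2 by rewrite -DD; ring.
rewrite ler_norml; lra.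
Qed.

(** Along [z + t Y + t^2 b nu] with [Y] tangent to [r = 0], the Taylor expansion of [r] is
    [t^2 A + o (t^2)]. *)
Lemma second_order_sign U r z Y nu (b : R) : open U -> C2_on U r -> U z -> r z = 0 ->
  ddir r z Y = 0 ->
  let A := b * ddir r z nu + 2^-1 * qform (hess r z) Y in A != 0 ->
  exists2 d : R, 0 < d & forall t : R, 0 < t -> t < d ->
    0 < r (z + t%:C *: (Y + (t * b)%:C *: nu)) * A.
Proof.
move=> oU hr Uz rz DY A A0.
have N0 : 0 <= N by rewrite ler0n.
have [B B0 [_ hB]] := data_bounded (grad r z) (hess r z).
pose M := enorm Y + `|b| * enorm nu + 1.
have M0 : 0 < M by rewrite ltr_wpDl // addr_ge0 ?mulr_ge0 ?enorm_ge0.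
have nA : 0 < `|A| by rewrite normr_gt0.
pose c := `|A| / 4 / (N ^+ 2 * M ^+ 2 + 1).
have K10 : 0 < N ^+ 2 * M ^+ 2 + 1 by rewrite ltr_wpDl // mulr_ge0 ?sqr_ge0.
have c0 : 0 < c by rewrite !divr_gt0.
have [_ _ ch] := hr z Uz.
have [d1 d10 hd1] := @common_radius _ _ ((('I_n * bool) * ('I_n * bool))%type)
  (fun ab => pderiv (real_dir ab.2) (pderiv (real_dir ab.1) r)) z c c0 (fun ab => (ch ab.1 ab.2).2).
have [d2 d20 hd2] := open_enormP oU Uz.
pose rho := Num.min d1 d2; have rho0 : 0 < rho by rewrite lt_min d10.
have hrho q : enorm (q - z) < rho -> U q /\ forall a b', `|hess r q a b' - hess r z a b'| <= c.
  rewrite lt_min => /andP[/hd1 h1 /hd2 Uq]; split=> // a b'; exact: (h1 (a, b')).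
pose E := M * B * N ^+ 2 * (`|b| * enorm nu) + 1.
have E0 : 0 < E.
  by rewrite ltr_wpDl // mulr_ge0 ?mulr_ge0 ?sqr_ge0 ?enorm_ge0 ?(ltW M0) ?(ltW B0).
exists (Num.min (Num.min 1 (rho / M)) (`|A| / 4 / E)).
  by rewrite !lt_min ltr01 !divr_gt0.
move=> t t0; rewrite !lt_min => /andP[/andP[t1]]; rewrite !ltr_pdivlMr // => tM tE.
set W := Y + (t * b)%:C *: nu.
have WM : enorm W <= M.
  apply: le_trans (enormD _ _) _; rewrite enormZ cmodR normrM gtr0_norm //.
  have : t * `|b| * enorm nu <= `|b| * enorm nu.
    by rewrite -mulrA ler_piMl ?mulr_ge0 ?enorm_ge0 // ltW.
  rewrite /M; lra.
have Wr : enorm (t%:C *: W) < rho.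
  rewrite enormZ cmodR gtr0_norm //; apply: le_lt_trans tM.
  by rewrite ler_wpM2l // ltW.
have T := taylor2 oU hr (ltW c0) hrho Wr.
rewrite rz subr0 -/(ddir r z (t%:C *: W)) -/(qform (hess r z) (t%:C *: W)) in T.
rewrite ddirZ {2}/W ddirD DY add0r ddirZ qformZ enormZ cmodR (gtr0_norm t0) in T.
have YM : enorm Y <= M.
  by rewrite /M; have := mulr_ge0 (normr_ge0 b) (enorm_ge0 nu); lra.
have Q := qform_lipschitz hB WM YM.
have WY : enorm (W - Y) = t * (`|b| * enorm nu).
  by rewrite /W addrC addKr enormZ cmodR normrM gtr0_norm // mulrA.
rewrite WY in Q.
set q1 := qform (hess r z) W in T Q; set q2 := qform (hess r z) Y in Q *.
have b1 : `|q1 - q2| <= `|A| / 2.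
  apply: le_trans Q _; move: tE; rewrite /E; move: (`|b| * enorm nu) => x; lra.
have b2 : c * N ^+ 2 * (t * enorm W) ^+ 2 <= `|A| / 4 * t ^+ 2.
  have h1 : enorm W ^+ 2 <= M ^+ 2 by rewrite ler_pXn2r ?nnegrE ?enorm_ge0 ?(ltW M0).
  have h2 : c * (N ^+ 2 * enorm W ^+ 2) <= c * (N ^+ 2 * M ^+ 2 + 1).
    rewrite ler_wpM2l ?(ltW c0) //.
    have : N ^+ 2 * enorm W ^+ 2 <= N ^+ 2 * M ^+ 2 by rewrite ler_wpM2l ?sqr_ge0.
    lra.
  have h3 : c * (N ^+ 2 * M ^+ 2 + 1) = `|A| / 4 by rewrite /c divfK // gt_eqF.
  rewrite h3 in h2; rewrite exprMn.
  have -> : c * N ^+ 2 * (t ^+ 2 * enorm W ^+ 2) = c * (N ^+ 2 * enorm W ^+ 2) * t ^+ 2 by ring.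
  by rewrite ler_wpM2r ?sqr_ge0.
have t20 : 0 < t ^+ 2 by rewrite exprn_gt0.
move: T; move: (r _) => x T.
have b3 : `|x - t ^+ 2 * A| <= `|A| / 2 * t ^+ 2.
  have -> : x - t ^+ 2 * A = (x - t * (t * b * ddir r z nu) - 2^-1 * (t ^+ 2 * q1))
      + 2^-1 * t ^+ 2 * (q1 - q2).
    have e (y1 y2 y3 : R) : x - t ^+ 2 * (b * y1 + 2^-1 * y3) =
      (x - t * (t * b * y1) - 2^-1 * (t ^+ 2 * y2)) + 2^-1 * t ^+ 2 * (y2 - y3) by ring.
    exact: e.
  apply: le_trans (ler_normD _ _) _; rewrite (normrM (2^-1 * t ^+ 2)).
  rewrite [`|2^-1 * _|]gtr0_norm ?mulr_gt0 ?invr_gt0 //.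
  have : 2^-1 * t ^+ 2 * `|q1 - q2| <= 2^-1 * t ^+ 2 * (`|A| / 2).
    by rewrite ler_wpM2l // mulr_ge0 // ltW.
  lra.
have : `|x * A - t ^+ 2 * A * A| <= `|A| / 2 * t ^+ 2 * `|A|.
  by rewrite -mulrBl normrM ler_wpM2r.
have AA : `|A| * `|A| = A * A by rewrite -normrM ger0_norm // -expr2 sqr_ge0.
have : 0 < A * A * t ^+ 2 by rewrite mulr_gt0 // -AA mulr_gt0.
have -> : `|A| / 2 * t ^+ 2 * `|A| = A * A * t ^+ 2 / 2 by rewrite -AA; ring.
rewrite ler_norml; lra.
Qed.

Lemma defining_same_sign G U U' r r' p :
  C2_defining_function G U r -> C2_defining_function G U' r' -> U p -> U' p ->
  0 <= r p * r' p.
Proof.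
move=> [_ [_ h1 h2 _]] [_ [_ h1' h2' _]] Up U'p.
have [rp|rp|->] := ltgtP (r p) 0; last by rewrite mul0r.
  have [Gp _] : (G `&` U) p by rewrite h1.
  have : (G `&` U') p by []. by rewrite h1' => -[_ r'p]; rewrite ltW // nmulr_rgt0.
have [Gp _] : (~` closure G `&` U) p by rewrite h2.
have : (~` closure G `&` U') p by []. by rewrite h2' => -[_ r'p]; rewrite ltW // mulr_gt0.
Qed.

Lemma small_time (d1 d2 : R) : 0 < d1 -> 0 < d2 -> exists t : R, [/\ 0 < t, t < d1 & t < d2].
Proof.
move=> h1 h2; exists (Num.min d1 d2 / 2).
have m0 : 0 < Num.min d1 d2 by rewrite lt_min h1.
have : Num.min d1 d2 <= d1 by rewrite ge_min lexx.
have : Num.min d1 d2 <= d2 by rewrite ge_min lexx orbT.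
by split; lra.
Qed.

Lemma same_sign_mul (x x' y y' : R) : 0 < x * y -> 0 < x' * y' -> 0 <= x * x' -> 0 <= y * y'.
Proof.
move=> h1 h2 h3; rewrite leNgt; apply/negP => h4.
have : 0 < (x * y) * (x' * y') by rewrite mulr_gt0.
have -> : (x * y) * (x' * y') = (x * x') * (y * y') by ring.
by rewrite ltNge mulr_ge0_le0 // ltW.
Qed.

Section Compare.
Variables (G U U' : set 'rV[R[i]]_n) (r r' : 'rV[R[i]]_n -> R) (z : 'rV[R[i]]_n).
Hypotheses (oG : open G) (hr : C2_defining_function G U r) (hr' : C2_defining_function G U' r').
Hypothesis bz : boundary G z.

Let oU : open U. Proof. by case: hr => [[]]. Qed.
Let oU' : open U'. Proof. by case: hr' => [[]]. Qed.
Let Cr : C2_on U r. Proof. by case: hr => _ []. Qed.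
Let Cr' : C2_on U' r'. Proof. by case: hr' => _ []. Qed.
Let Uz : U z. Proof. by case: (defining_zero oG hr bz). Qed.
Let U'z : U' z. Proof. by case: (defining_zero oG hr' bz). Qed.
Let rz : r z = 0. Proof. by case: (defining_zero oG hr bz). Qed.
Let r'z : r' z = 0. Proof. by case: (defining_zero oG hr' bz). Qed.

Let in_both (M : R) : 0 < M -> exists2 d : R, 0 < d & forall (t : R) X, 0 < t -> t < d ->
  enorm X <= M -> U (z + t%:C *: X) /\ U' (z + t%:C *: X).
Proof.
move=> M0; have [d1 d10 h1] := open_enormP oU Uz; have [d2 d20 h2] := open_enormP oU' U'z.
exists (Num.min d1 d2 / M); first by rewrite divr_gt0 // lt_min d10.
move=> t X t0; rewrite ltr_pdivlMr // lt_min => /andP[t1 t2] XM.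
have e : enorm (z + t%:C *: X - z) <= t * M.
  by rewrite addrC addKr enormZ cmodR gtr0_norm // ler_wpM2l // ltW.
by split; [apply: h1 | apply: h2]; exact: le_lt_trans e _.
Qed.

Let exists_time (d1 d2 M : R) : 0 < d1 -> 0 < d2 -> 0 < M -> exists t : R,
  [/\ 0 < t, t < d1, t < d2 & t < 1 /\ forall X, enorm X <= M ->
     U (z + t%:C *: X) /\ U' (z + t%:C *: X)].
Proof.
move=> d10 d20 M0; have [d3 d30 h3] := in_both M0.
have m0 : 0 < Num.min (Num.min d1 d2) 1 by rewrite !lt_min d10 d20 ltr01.
have [t [t0]] := small_time m0 d30; rewrite !lt_min => /andP[/andP[t1 t2] t3] t4.
by exists t; split=> //; split=> // X; exact: h3.
Qed.

Lemma ddir_same_sign X : 0 <= ddir r z X * ddir r' z X.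
Proof.
have [->|D0] := eqVneq (ddir r z X) 0; first by rewrite mul0r.
have [->|D'0] := eqVneq (ddir r' z X) 0; first by rewrite mulr0.
have [d1 d10 h1] := first_order_sign oU Cr Uz rz D0.
have [d2 d20 h2] := first_order_sign oU' Cr' U'z r'z D'0.
have X1 : 0 < enorm X + 1 by rewrite ltr_wpDl ?enorm_ge0.
have [t [t0 t1 t2 [_ t3]]] := exists_time d10 d20 X1.
have [|Ut U't] := t3 X; first lra.
exact: same_sign_mul (h1 t t0 t1) (h2 t t0 t2) (defining_same_sign hr hr' Ut U't).
Qed.

Lemma second_same_sign Y nu (b : R) : ddir r z Y = 0 -> ddir r' z Y = 0 ->
  0 <= (b * ddir r z nu + 2^-1 * qform (hess r z) Y) *
       (b * ddir r' z nu + 2^-1 * qform (hess r' z) Y).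
Proof.
move=> DY D'Y; set A := (X in X * _); set A' := (X in _ * X).
have [->|A0] := eqVneq A 0; first by rewrite mul0r.
have [->|A'0] := eqVneq A' 0; first by rewrite mulr0.
have [d1 d10 h1] := second_order_sign oU Cr Uz rz DY A0.
have [d2 d20 h2] := second_order_sign oU' Cr' U'z r'z D'Y A'0.
have M1 : 0 < enorm Y + `|b| * enorm nu + 1.
  by rewrite ltr_wpDl // addr_ge0 ?mulr_ge0 ?enorm_ge0.
have [t [t0 t1 t2 [t4 t3]]] := exists_time d10 d20 M1.
have [|Ut U't] := t3 (Y + (t * b)%:C *: nu).
  apply: le_trans (enormD _ _) _; rewrite enormZ cmodR normrM gtr0_norm //.
  have : t * `|b| * enorm nu <= `|b| * enorm nu.
    by rewrite -mulrA ler_piMl ?mulr_ge0 ?enorm_ge0 // ltW.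
  lra.
exact: same_sign_mul (h1 t t0 t1) (h2 t t0 t2) (defining_same_sign hr hr' Ut U't).
Qed.
End Compare.

(** If [d r (X) = 0], moving [X] by multiples of [nu] on either side makes [d r] change
    sign; [d r'] never has the opposite sign, so it vanishes at [X] too. *)
Lemma ddir_kernel_sub G U U' r r' z X : open G -> C2_defining_function G U r ->
  C2_defining_function G U' r' -> boundary G z -> ddir r z X = 0 -> ddir r' z X = 0.
Proof.
move=> oG hr hr' bz DX.
have [nu Dnu] : exists nu, 0 < ddir r z nu.
  by apply: gradient_normal; case: hr => _ [_ _ _]; exact.
have pos (s : R) : 0 <= s * (ddir r' z X + s * ddir r' z nu).
  have := ddir_same_sign oG hr hr' bz (X + s%:C *: nu).
  by rewrite !ddirD !ddirZ DX add0r [s * ddir r z nu]mulrC -mulrA pmulr_rge0.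
apply/eqP; rewrite -normr_eq0 eq_le normr_ge0 andbT; apply/ler_addgt0Pr => e e0; rewrite add0r.
pose s := e / (`|ddir r' z nu| + 1).
have n1 : 0 < `|ddir r' z nu| + 1 by rewrite ltr_wpDl.
have s0 : 0 < s by rewrite divr_gt0.
have sn : `|s * ddir r' z nu| <= e.
  rewrite normrM gtr0_norm // /s mulrAC ler_pdivrMr // ler_pM2l // lerDl //.
have := pos s; rewrite pmulr_rge0 //; have := pos (- s).
rewrite mulNr -mulrN pmulr_rge0 // mulNr.
move: sn; rewrite !ler_norml; lra.
Qed.

(** Two defining functions have equal signs near [z], hence proportional differentials
    at [z].  Along the curves [z + t Y + t^2 b nu] with [Y] tangent, the second-order
    terms have equal signs for every [b], which makes the Hessians proportional on
    tangent vectors, with the same positive factor.  Complex tangent vectors [X] have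
    [X] and [i X] both tangent, so the Levi forms are proportional as well. *)
Lemma levi_positive_transfer G U U' r r' z : open G -> C2_defining_function G U r ->
  C2_defining_function G U' r' -> boundary G z -> levi_positive r' z -> levi_positive r z.
Proof.
move=> oG hr hr' bz lp X X0 /lin_eq0[DX DiX].
have D'X := ddir_kernel_sub oG hr hr' bz DX.
have D'iX := ddir_kernel_sub oG hr hr' bz DiX.
have lX : lin (grad r' z) X = 0 by apply/lin_eq0.
have L' := lp X X0 lX.
have [nu Dnu] : exists nu, 0 < ddir r z nu.
  by apply: gradient_normal; case: hr => _ [_ _ _]; exact.
have D'nu : 0 < ddir r' z nu.
  rewrite lt_def; apply/andP; split.
    by apply/eqP => h; have := ddir_kernel_sub oG hr' hr bz h; lra.
  by have := ddir_same_sign oG hr hr' bz nu; rewrite pmulr_rge0.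
set d := ddir r z nu in Dnu; set d' := ddir r' z nu in D'nu.
(* second_same_sign at b0 + s, with b0 the zero of the first factor: the second
   factor must vanish there too, or the product would be negative for some s *)
have key Y : ddir r z Y = 0 -> ddir r' z Y = 0 ->
    d * qform (hess r' z) Y = d' * qform (hess r z) Y.
  move=> DY D'Y; set q := qform (hess r z) Y; set q' := qform (hess r' z) Y.
  pose b0 := - (2^-1 * q) / d.
  have h (s : R) : 0 <= s * (s * d' + (b0 * d' + 2^-1 * q')).
    have := second_same_sign oG hr hr' bz nu (b0 + s) DY D'Y.
    rewrite -/d -/d' -/q -/q'.
    have -> : (b0 + s) * d + 2^-1 * q = d * s by rewrite /b0; field; rewrite gt_eqF.
    have -> : (b0 + s) * d' + 2^-1 * q' = s * d' + (b0 * d' + 2^-1 * q') by ring.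
    by rewrite -mulrA pmulr_rge0.
  have z0 : b0 * d' + 2^-1 * q' = 0.
    set w := b0 * d' + _ in h *.
    have := h (- w / (2 * d')).
    have -> : - w / (2 * d') * (- w / (2 * d') * d' + w) = - (w ^+ 2 / (4 * d')).
      by field; rewrite gt_eqF.
    rewrite oppr_ge0 pmulr_lle0 ?invr_gt0 ?mulr_gt0 // => w2.
    by apply/eqP; rewrite -sqrf_eq0 eq_le w2 sqr_ge0.
  have : d * (b0 * d' + 2^-1 * q') = 0 by rewrite z0 mulr0.
  have -> : d * (b0 * d' + 2^-1 * q') = 2^-1 * (d * q' - d' * q).
    by rewrite /b0; field; rewrite gt_eqF.
  move/eqP; rewrite mulf_eq0 invr_eq0 pnatr_eq0 /= subr_eq0 => /eqP; exact.
have k1 := key X DX D'X; have k2 := key _ DiX D'iX.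
have : d * levi (hess r' z) X = d' * levi (hess r z) X.
  by rewrite /levi mulrCA mulrDr k1 k2; ring.
have : 0 < d * levi (hess r' z) X by rewrite mulr_gt0.
by move=> h e; rewrite e pmulr_rgt0 in h.
Qed.
End TwoDefiningFunctions.

(** * Families of domains *)
Section Assembly.
Context {R : realType} {n : nat}.
Implicit Types (X Y z p q w : 'rV[R[i]]_n) (G U K : set 'rV[R[i]]_n) (r : 'rV[R[i]]_n -> R).

Lemma bounded_set_enorm (A : set 'rV[R[i]]_n) : bounded_set A ->
  exists2 M : R, 0 < M & forall z, A z -> enorm z < M.
Proof.
move=> [M0 [M0r hM]].
have [M MM] : exists M : R, M0 < M%:C.
  by exists (complex.Re M0 + 1); move/complex_realP: M0r => [k ->] /=; rewrite ltcR ltrDl.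
exists ((n%:R + 1) * (`|M| + 2)); first by rewrite mulr_gt0 // ltr_wpDl // ?ler0n.
move=> z Az; apply: enorm_lt_coord => [|k]; first by rewrite mulr_gt0 // ltr_wpDl // ?ler0n.
have := hM _ MM z Az => zM.
have b : ball (0 : 'rV[R[i]]_n) (`|z| + 1) z.
  by rewrite mx_norm_ball /ball_ /= sub0r normrN ltrDl.
have [_ /(_ ord0 k)] := b; rewrite /ball /= mxE sub0r normrN normC_cmod => h.
have : (cmod (z ord0 k))%:C < (M + 1)%:C.
  by apply: lt_le_trans h _; rewrite rmorphD /= lerD2r.
rewrite ltcR mulrAC mulfV ?mul1r; last by rewrite gt_eqF // ltr_wpDl // ?ler0n.
have := ler_norm M; lra.
Qed.

Lemma compact_enorm_bounded K : compact K -> exists2 M : R, 0 < M & forall z, K z -> enorm z <= M.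
Proof.
move=> cK; have [e e0 he] : exists2 e : R, 0 < e & forall z, K z -> enorm z <= e^-1.
  have := compact_scale (P := fun e z => enorm z <= e^-1) cK; apply => z Kz.
  have z1 : 0 < enorm z + 1 by rewrite ltr_wpDl ?enorm_ge0.
  exists (enorm z + 1)^-1; first by rewrite invr_gt0.
  exists [set w | enorm (w - z) < 1]; first by apply/nbhs_enormP; exists 1.
  move=> w e /= wz e0 ee; apply: (@le_trans _ _ (enorm z + 1)).
    have := enormD (w - z) z; rewrite subrK; lra.
  by rewrite -[enorm z + 1]invrK lef_pV2 ?posrE ?invr_gt0.
by exists e^-1; rewrite ?invr_gt0.
Qed.

Lemma compact_closure_precompact (A : set 'rV[R[i]]_n) : precompact A -> compact (closure A).
Proof. by rewrite precompactE. Qed.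

Lemma boundary_closed G : open G -> closed (boundary G).
Proof.
by move=> oG; apply: closedI; [exact: closed_closure | apply: open_closedC; exact: open_interior].
Qed.

(** The ray from [z] away from the origin leaves [G] at a boundary point whose norm is
    at least that of [z]. *)
Lemma bounded_by_boundary G (M Rb : R) : open G -> 0 <= Rb ->
  (forall z, G z -> enorm z < M) -> (forall z, boundary G z -> enorm z <= Rb) ->
  forall z, G z -> enorm z <= Rb.
Proof.
move=> oG Rb0 hM hb z Gz; rewrite leNgt; apply/negP => zb.
have z0 : 0 < enorm z by lra.
pose S := [set s : R | 1 <= s /\ forall t, 1 <= t <= s -> G (t%:C *: z)].
have S1 : S 1.
  by split=> // t t1; have -> : t = 1 by [lra]; rewrite scale1r.
have Sb s : S s -> s <= M / enorm z.
  move=> [s1 hs]; rewrite ler_pdivlMr //; apply: ltW.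
  have := hM _ (hs s _); rewrite enormZ cmodR ger0_norm; last lra.
  by apply; rewrite s1 lexx.
have hS : has_sup S by split; [exists 1 | exists (M / enorm z) => s; exact: Sb].
pose s0 := sup S.
have s01 : 1 <= s0 by apply: sup_upper_bound.
have bd : boundary G (s0%:C *: z).
  split.
    apply/closure_enormP => d d0.
    have [s Ss hs] := sup_adherent (divr_gt0 d0 z0) hS.
    exists (s%:C *: z); first by have [s1 h] := Ss; apply: h; rewrite s1 lexx.
    have ss0 : s <= s0 by apply: sup_upper_bound.
    rewrite -scalerBl -rmorphB enormZ cmodR distrC ger0_norm ?subr_ge0 //.
    by rewrite -ltr_pdivlMr //; move: hs; rewrite -/s0; lra.
  move=> /nbhs_enormP[d d0 hd].
  have [s Ss hs] := sup_adherent (divr_gt0 d0 z0) hS.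
  have ss0 : s <= s0 by apply: sup_upper_bound.
  pose s' := s0 + d / enorm z / 2.
  have e0 : 0 < d / enorm z by rewrite divr_gt0.
  suff : S s' by move=> /(sup_upper_bound hS); rewrite -/s0 /s'; lra.
  split; first by rewrite /s'; lra.
  move=> t /andP[t1 ts']; have [ts|ts] := leP t s.
    by have [_ h] := Ss; apply: h; rewrite t1.
  apply: hd; rewrite -scalerBl -rmorphB enormZ cmodR -ltr_pdivlMr //.
  move: hs ts'; rewrite -/s0 /s' ltr_norml; lra.
have := hb _ bd; rewrite enormZ cmodR ger0_norm; last lra.
have : 1 * enorm z <= s0 * enorm z by rewrite ler_wpM2r // ltW.
lra.
Qed.

Lemma levi_positive_of_form G U r z : C2_defining_function G U r -> U z ->
  (forall X, X != 0 -> complex_tangent r z X -> 0 < levi_form r z X) -> levi_positive r z.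
Proof.
move=> [_ [Cr _ _ _]] Uz h X X0 lX.
have := h X X0 ((complex_tangentE r z X).2 lX); rewrite ltcE => /andP[_].
by rewrite (Re_levi_form X Cr Uz).
Qed.

Lemma C2_close_refl U r (e : R) : 0 <= e -> C2_close U e r r.
Proof. by move=> e0 q _; split=> *; rewrite subrr normr0. Qed.

Lemma peak_at_le U (e e' : R) r z : 0 < e' -> e' <= e -> peak_at U e r z -> peak_at U e' r z.
Proof.
move=> e'0 ee [g [gh gp]]; exists g; split=> // p pz.
have e0 : 0 < e by lra.
have [|Up h] := gp p; first lra.
split=> // /h /andP[h1 h2]; apply/andP; split.
  by apply: le_trans h1; rewrite ler_wpM2r ?sqr_ge0.
by apply: le_trans h2 _; rewrite ler_wpM2r ?enorm_ge0 // lef_pV2 ?posrE.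
Qed.

(** The estimate in terms of [z] and [w] alone: being close to two separated boundary
    points matters only through [|z - w|]. *)
Definition kobayashi_bound G (eps C : R) := forall z w, G z -> G w -> eps <= enorm (z - w) ->
  ((- 2^-1 * ln (dist_to z (boundary G)) - 2^-1 * ln (dist_to w (boundary G)) - C)%:E
     <= kobayashi G z w)%E.

Lemma kobayashi_bound_le G (eps C C' : R) : C <= C' -> kobayashi_bound G eps C ->
  kobayashi_bound G eps C'.
Proof.
move=> CC h z w Gz Gw zw; apply: le_trans (h z w Gz Gw zw); rewrite lee_fin; lra.
Qed.

Lemma strictly_pseudoconvex_bound G (eps : R) : strictly_pseudoconvex G -> 0 < eps ->
  exists2 C : R, 0 < C & kobayashi_bound G eps C.
Proof.
move=> [[_ oG _] bG [U [r [hr hl]]]] eps0.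
have [M M0 hM] := bounded_set_enorm bG.
have [[oU bU] [Cr _ _ _]] := hr.
have cK : compact (boundary G).
  apply: (@bounded_closed_compactC _ _ _ (M + 1)); first exact: boundary_closed.
  move=> z [/closure_enormP/(_ 1 ltr01)[w Gw wz] _].
  have := enormD (z - w) w; rewrite subrK enormB; have := hM w Gw; lra.
have [|e e0 he] := uniform_peaks oU cK bU Cr.
  by move=> z bz _; apply: levi_positive_of_form hr (bU _ bz) (fun X => hl z X bz).
have [C [C0 hC]] := kobayashi_lower_bound (n := n) e0 M0 eps0.
exists C => // z w Gz Gw zw; apply: hC => //.
  by move=> p Gp; apply/ltW/hM.
move=> zeta bz; have [rz Uz] := defining_zero oG hr bz.
apply: peak_at_peak hr _; have hc : C2_close U e r r by apply: C2_close_refl; exact: ltW.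
exact: (he r Cr hc zeta bz rz).
Qed.

(** The domains share a peak scale and, by [bounded_by_boundary], a bound
    on their size, so [kobayashi_lower_bound] gives one constant for all. *)
Lemma family_bound (I : Type) (Gs : I -> set 'rV[R[i]]_n) U K (rs : I -> 'rV[R[i]]_n -> R) (e M eps : R) :
  0 < e -> 0 < M -> 0 < eps ->
  (forall i, [/\ open (Gs i), bounded_set (Gs i) & C2_defining_function (Gs i) U (rs i)]) ->
  (forall z, U z -> enorm z <= M) -> (forall i, boundary (Gs i) `<=` K) ->
  (forall i z, K z -> rs i z = 0 -> peak_at U e (rs i) z) ->
  exists2 C : R, 0 < C & forall i, kobayashi_bound (Gs i) eps C.
Proof.
move=> e0 M0 eps0 hG hU hK hp.
have [C [C0 hC]] := kobayashi_lower_bound (n := n) e0 M0 eps0.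
exists C => // i z w Gz Gw zw; have [oG bG hr] := hG i.
have [[oU bU] _] := hr.
have [M' M'0 hM'] := bounded_set_enorm bG.
apply: hC => //.
  apply: (bounded_by_boundary oG (ltW M0) hM') => p bp; exact/hU/bU.
move=> zeta bz; have [rz Uz] := defining_zero oG hr bz.
by apply: peak_at_peak hr _; apply: hp => //; exact: hK bz.
Qed.

(** Near each parameter [t0], [uniform_peaks] for [r t0] covers all [r t]; compactness of
    the parameter space, through [compact_scale], makes the scale uniform. *)
Lemma admissible_bound (T : metricType R) (G : T -> set 'rV[R[i]]_n) (eps : R) :
  admissible_family G -> 0 < eps -> exists2 C : R, 0 < C & forall t, kobayashi_bound (G t) eps C.
Proof.
move=> [cT psG [U [[_ oU _] [pU _] [pK KU] [r [hr hcont]]]]] eps0.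
have cK := compact_closure_precompact pK.
have [M M0 hM] := compact_enorm_bounded (compact_closure_precompact pU).
have Cr t : C2_on U (r t) by case: (hr t) => -[_ []].
set K := closure _ in cK KU.
have [e e0 he] : exists2 e : R, 0 < e & forall t : T, [set: T] t ->
    forall z, K z -> r t z = 0 -> peak_at U e (r t) z.
  have := compact_scale (P := fun e t => forall z, K z -> r t z = 0 -> peak_at U e (r t) z) cT.
  apply=> t0 _.
  have [|e e0 he] := uniform_peaks oU cK KU (Cr t0).
    move=> z Kz _; have [h1 h2] := hr t0.
    by apply: levi_positive_of_form h1 (KU _ Kz) _ => X X0 _; exact: h2 (KU _ Kz) X0.
  have [d d0 hd] := hcont e e0.
  exists e => //; exists [set t | mdist t0 t < d].
    by apply/metricType_numDomainType.nbhs_mdistP; exists d.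
  move=> t e' /= tt0 e'0 ee z Kz rz; apply: (peak_at_le e'0 ee).
  apply: he => //; apply: C2_norm_close => //; exact: hd (ltW tt0).
apply: (@family_bound T G U K r e M eps e0 M0 eps0).
- by move=> t; have [[_ oG _] bG _] := psG t; have [hrt _] := hr t; split.
- by move=> z Uz; apply: hM; exact: subset_closure.
- by move=> t z bz; apply: subset_closure; exists t.
by move=> t; exact: he.
Qed.

(** The zeros of [r] in [U] are boundary points of the limit domain, where its Levi
    form is positive by [levi_positive_transfer]; [uniform_peaks] then covers all large
    [j].  The constants of the remaining domains are added up. *)
Lemma sequence_bound (G : nat -> set 'rV[R[i]]_n) (G0 : set 'rV[R[i]]_n) (eps : R) :
  (forall j, strictly_pseudoconvex (G j)) -> strictly_pseudoconvex G0 ->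
  C2_converges G G0 -> 0 < eps ->
  exists2 C : R, 0 < C & forall j, kobayashi_bound (G j) eps C.
Proof.
move=> psG psG0 [U [j0 [oU bU [pK KU] [r [rs [hr hrs hcv]]]]]] eps0.
have cK := compact_closure_precompact pK.
set K := closure _ in cK KU.
have [M M0 hM] := bounded_set_enorm bU.
have [[_ oG0 _] _ [U' [r' [hr' hl']]]] := psG0.
have [_ [Cr h1 h2 _]] := hr.
have [|e e0 he] := uniform_peaks oU cK KU Cr.
  move=> z Kz rz; have Uz := KU _ Kz.
  have bz : boundary G0 z.
    split.
      apply: contrapT => nz; have : (~` closure G0 `&` U) z by [].
      by rewrite h2 => -[_]; rewrite rz ltxx.
    move=> /interior_subset Gz; have : (G0 `&` U) z by [].
    by rewrite h1 => -[_]; rewrite rz ltxx.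
  apply: (levi_positive_transfer oG0 hr hr' bz).
  have U'z : U' z by case: (hr') => [[_ bU'] _]; exact: bU'.
  exact: (levi_positive_of_form hr' U'z (fun X => hl' z X bz)).
have [j1 hj1] : exists j1, forall j, (j1 <= j)%N ->
    (C2_norm U (fun z => rs j z - r z)%R < e%:E)%E.
  have : \forall j \near \oo, (C2_norm U (fun z => rs j z - r z)%R < e%:E)%E.
    by apply: (hcv [set x | (x < e%:E)%E]); apply: open_ereal_lt'; rewrite lte_fin.
  by move=> [j1 _ h]; exists j1 => j jj; exact: h.
pose j2 := maxn j0 j1.
have [C C0 hC] : exists2 C : R, 0 < C & forall j, kobayashi_bound (G (j2 + j)%N) eps C.
  have j02 j : (j0 <= j2 + j)%N by apply: leq_trans (leq_maxl _ _) (leq_addr _ _).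
  have j12 j : (j1 <= j2 + j)%N by apply: leq_trans (leq_maxr _ _) (leq_addr _ _).
  apply: (@family_bound nat (fun j => G (j2 + j)%N) U K (fun j => rs (j2 + j)%N) e M eps e0 M0 eps0).
  - by move=> j; have [[_ oG _] bG _] := psG (j2 + j)%N; split; [exact: oG|exact: bG|exact: hrs].
  - by move=> z /hM /ltW.
  - move=> j z bz; apply: subset_closure; right; exists (j2 + j)%N; [exact: j02|exact: bz].
  move=> j z Kz rz; have [_ [Crj _ _ _]] := hrs _ (j02 j).
  have hc : C2_close U e (rs (j2 + j)%N) r by apply: C2_norm_close oU Crj Cr (hj1 _ (j12 j)).
  exact: (he (rs (j2 + j)%N) Crj hc z Kz rz).
have [D hD] := choice (fun j => let: ex_intro2 c c0 h := strictly_pseudoconvex_bound (psG j) eps0 in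
  ex_intro (fun c => 0 < c /\ kobayashi_bound (G j) eps c) c (conj c0 h)).
have D0 j : 0 < D j by case: (hD j).
exists (C + \sum_(j < j2) D j).
  by rewrite ltr_wpDr // sumr_ge0 // => j _; exact: ltW.
move=> j; have [jj|jj] := leqP j2 j.
  rewrite -(subnKC jj); apply: kobayashi_bound_le (hC _).
  by rewrite lerDl sumr_ge0 // => i _; exact: ltW.
apply: kobayashi_bound_le (hD j).2.
rewrite (bigD1 (Ordinal jj)) //= addrCA lerDl addr_ge0 ?(ltW C0) // sumr_ge0 // => i _; exact: ltW.
Qed.
End Assembly.

Theorem proposition3p5 (R : realType) (n : nat) :
  (forall (T : metricType R) (G : T -> set 'rV[R[i]]_n),
     admissible_family G ->
     forall eps : R, 0 < eps ->
     exists C delta : R, [/\ 0 < C, 0 < delta &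
       forall (t : T) (zeta xi : 'rV[R[i]]_n),
         boundary (G t) zeta -> boundary (G t) xi -> eps <= enorm (zeta - xi) ->
         forall z w : 'rV[R[i]]_n,
           (G t `&` eball zeta delta) z -> (G t `&` eball xi delta) w ->
           ((- 2^-1 * ln (dist_to z (boundary (G t)))
             - 2^-1 * ln (dist_to w (boundary (G t))) - C)%:E
            <= kobayashi (G t) z w)%E])
  /\
  (forall (G : nat -> set 'rV[R[i]]_n) (G0 : set 'rV[R[i]]_n),
     (forall j, strictly_pseudoconvex (G j)) -> strictly_pseudoconvex G0 ->
     C2_converges G G0 ->
     forall eps : R, 0 < eps ->
     exists C delta : R, [/\ 0 < C, 0 < delta &
       forall (j : nat) (zeta xi : 'rV[R[i]]_n),
         (boundary (G j) `|` boundary G0) zeta ->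
         (boundary (G j) `|` boundary G0) xi ->
         zeta != xi -> eps <= enorm (zeta - xi) ->
         forall z w : 'rV[R[i]]_n,
           (G j `&` eball zeta delta) z -> (G j `&` eball xi delta) w ->
           ((- 2^-1 * ln (dist_to z (boundary (G j)))
             - 2^-1 * ln (dist_to w (boundary (G j))) - C)%:E
            <= kobayashi (G j) z w)%E]).
Proof.
(* balls of radius eps / 4 about points at distance eps are eps / 2 apart *)
have far (eps : R) (zeta xi z w : 'rV[R[i]]_n) : eps <= enorm (zeta - xi) ->
    enorm (z - zeta) < eps / 4 -> enorm (w - xi) < eps / 4 -> eps / 2 <= enorm (z - w).
  move=> h1 h2 h3; have := enorm_dist_triangle zeta z xi.
  have := enorm_dist_triangle z w xi; rewrite (enormB zeta z); lra.
split=> [T G hG eps eps0|G G0 psG psG0 hcv eps eps0];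
    have e20 : 0 < eps / 2 by [lra]; have e40 : 0 < eps / 4 by lra.
  have [C C0 hC] := admissible_bound hG e20; exists C, (eps / 4); split=> //.
  move=> t zeta xi _ _ zx z w [Gz bz] [Gw bw]; apply: hC => //; exact: far zx bz bw.
have [C C0 hC] := sequence_bound psG psG0 hcv e20; exists C, (eps / 4); split=> //.
move=> j zeta xi _ _ _ zx z w [Gz bz] [Gw bw]; apply: hC => //; exact: far zx bz bw.
Qed.
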